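(* Let $a\ge0$ and let $(q,r)$ be $a$-admissible. There is $C(a,r)>0$ such that for every $F\in\mathbb S^+$, $$\Big\|\int_{\mathbb R}S_a(t-\tau)\big(F(\cdot,\tau)\big)\,d\tau\Big\|_{L^q_tL^r_a}\le C(a,r)\|F\|_{L^{q'}_tL^{r'}_a}.$$
   Context: $\mathbb R^+=(0,\infty)$, $d\omega_a(x)=x^a\,dx$, $L^r_a=L^r(\mathbb R^+,d\omega_a)$, $\|u\|_{L^q_tL^r_a}=(\int_{\mathbb R}\|u(\cdot,t)\|_{L^r_a}^q\,dt)^{1/q}$; primes denote conjugate exponents. A pair $(q,r)$ is $a$-admissible if $r>2$, additionally $r<\frac{2(a+1)}{a-1}$ when $a>1$, and $\frac2q=(a+1)(\frac12-\frac1r)$. $\mathbb S^+$ is the set of $F\in C^\infty(\mathbb R^+\times\mathbb R;\mathbb C)$ with $\sup_{k+\ell\le p}\sup_{(x,t)}(1+x^2+t^2)^{p/2}|(x^{-1}\partial_x)^k\partial_t^\ell F(x,t)|<\infty$ for every $p\in\mathbb N_0$. Kernel: for $x,y>0$, $S_a(x,y,t)=\frac{e^{-i(a+1)\pi/4}}{(2|t|)^{(a+1)/2}}\big(\frac{xy}{2|t|}\big)^{\frac{1-a}2}J_{\frac{a-1}2}\big(\frac{xy}{2|t|}\big)e^{i\frac{x^2+y^2}{4|t|}}$ if $t>0$, its analogue with $e^{i(a+1)\pi/4}$ and $e^{-i\frac{x^2+y^2}{4|t|}}$ if $t<0$ ($J_\nu$ Bessel function of the first kind); $S_a(t)\varphi(x)=\int_0^\infty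 S_a(x,y,t)\varphi(y)\,d\omega_a(y)$, $S_a(0)=\mathrm{Id}$. *)

(* Defs.v *)
From HB Require Import structures.
From mathcomp Require Import all_boot all_order all_algebra.
From mathcomp Require Import all_classical all_reals all_analysis.
From mathcomp Require Import complex.
Set Implicit Arguments. Unset Strict Implicit. Unset Printing Implicit Defensive.
Import Order.TTheory GRing.Theory Num.Theory.
Import numFieldNormedType.Exports.
Local Open Scope classical_set_scope.
Local Open Scope ring_scope.

Section Defs.
Variable R : realType.
Local Notation leb := (@lebesgue_measure R).

Definition cabs (z : R[i]) : R := Num.sqrt (complex.Re z ^+ 2 + complex.Im z ^+ 2).

Definition cexpi (th : R) : R[i] := Complex (cos th) (sin th).

Definition cint (D : set R) (w : R -> R) (f : R -> R[i]) : R[i] :=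
  Complex (Rintegral leb D (fun x => complex.Re (f x) * w x))
          (Rintegral leb D (fun x => complex.Im (f x) * w x)).

Definition GammaR (s : R) : R :=
  Rintegral leb `]0%R, +oo[ (fun x => x `^ (s - 1) * expR (- x)).

(* Bessel function of the first kind (used for z > 0, nu >= -1/2):
   J_nu(z) = sum_m (-1)^m / (m! Gamma(m+nu+1)) (z/2)^(2m+nu) *)
Definition BesselJ (nu z : R) : R :=
  limn (series (fun m : nat =>
     (-1) ^+ m / ((m`!)%:R * GammaR (m%:R + nu + 1)) * (z / 2) `^ (2 * m%:R + nu))).

Definition Skernel (a x y t : R) : R[i] :=
  let z := x * y / (2 * `|t|) in
  let common := ((2 * `|t|) `^ ((a + 1) / 2))^-1 * z `^ ((1 - a) / 2)
                * BesselJ ((a - 1) / 2) z in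
  if 0 < t then
    cexpi (- ((a + 1) * pi / 4)) * (common%:C)%C * cexpi ((x ^+ 2 + y ^+ 2) / (4 * `|t|))
  else
    cexpi ((a + 1) * pi / 4) * (common%:C)%C * cexpi (- ((x ^+ 2 + y ^+ 2) / (4 * `|t|))).

Definition Sa (a t : R) (phi : R -> R[i]) (x : R) : R[i] :=
  if t == 0 then phi x
  else cint `]0%R, +oo[ (fun y => y `^ a) (fun y => Skernel a x y t * phi y).

Definition Duhamel (a : R) (F : R -> R -> R[i]) (x t : R) : R[i] :=
  cint setT (fun _ => 1) (fun tau => Sa a (t - tau) (fun y => F y tau) x).

Definition LrNorm (a r : R) (f : R -> R[i]) : \bar R :=
  poweR (\int[leb]_(x in `]0%R, +oo[) ((cabs (f x) `^ r * x `^ a)%:E))%E (r^-1).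

Definition MixNorm (a q r : R) (u : R -> R -> R[i]) : \bar R :=
  poweR (\int[leb]_(t in [set: R]) poweR (LrNorm a r (fun x => u x t)) q)%E (q^-1).

Definition conj_exp (p : R) : R := p / (p - 1).

Definition admissible (a q r : R) : Prop :=
  [/\ 2 < r, (1 < a -> r < 2 * (a + 1) / (a - 1))
    & 2 / q = (a + 1) * (2^-1 - r^-1)].

Definition pdx (G : R -> R -> R[i]) (x t : R) : R[i] :=
  Complex (derive1 (fun y => complex.Re (G y t)) x) (derive1 (fun y => complex.Im (G y t)) x).
Definition pdt (G : R -> R -> R[i]) (x t : R) : R[i] :=
  Complex (derive1 (fun s => complex.Re (G x s)) t) (derive1 (fun s => complex.Im (G x s)) t).
Definition Dx (G : R -> R -> R[i]) (x t : R) : R[i] :=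
  ((x^-1)%:C)%C * pdx G x t.

Fixpoint pword (w : seq bool) (G : R -> R -> R[i]) : R -> R -> R[i] :=
  match w with
  | [::] => G
  | b :: w' => (if b then pdx else pdt) (pword w' G)
  end.

Definition smooth_on_halfplane (G : R -> R -> R[i]) : Prop :=
  forall (w : seq bool) (x t : R), 0 < x ->
    let H := pword w G in
    [/\ derivable (fun y => complex.Re (H y t)) x 1, derivable (fun y => complex.Im (H y t)) x 1,
        derivable (fun s => complex.Re (H x s)) t 1 & derivable (fun s => complex.Im (H x s)) t 1]
    /\ {for (x, t), continuous (fun p : R * R => complex.Re (H p.1 p.2))}
    /\ {for (x, t), continuous (fun p : R * R => complex.Im (H p.1 p.2))}.

Definition Splus (F : R -> R -> R[i]) : Prop :=
  smooth_on_halfplane F /\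
  forall p : nat, exists M : R, forall (k l : nat), (k + l <= p)%N ->
    forall x t : R, 0 < x ->
      Num.sqrt (1 + x ^+ 2 + t ^+ 2) ^+ p
        * cabs (iter k Dx (iter l pdt F) x t) <= M.

End Defs.

(* Main.v *)
Require Import Defs.
From HB Require Import structures.
From mathcomp Require Import all_boot all_order all_algebra.
From mathcomp Require Import all_classical all_reals all_analysis.
From mathcomp Require Import measurable_realfun complex ring lra.
Set Implicit Arguments. Unset Strict Implicit. Unset Printing Implicit Defensive.
Import Order.TTheory GRing.Theory Num.Theory.
Import numFieldNormedType.Exports.
Import HBNNSimple.
Local Open Scope classical_set_scope.
Local Open Scope ring_scope.

(* Up to unimodular factors and a chirp, [Sa a sigma] is the Hankel-type
   transform with kernel j(s x y), s = 1/(2|sigma|), where j is the entire even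
   function z^(-nu) J_nu(z), nu = (a-1)/2.
   - j is bounded because phi^2 + w phi'^2 decreases along the equation
     w phi'' + (nu+1) phi' + phi = 0 satisfied by j(z) = phi(z^2/4).
   - The transform is bounded on L^2(x^a dx): k(z) = z^(a/2) j(z) solves
     k'' + k = O(z^-2) k, so k is a combination of cos and sin up to O(1/z); the
     trigonometric part is handled by an exponentially damped Plancherel
     argument, the remainder by Schur's test.
   - Marcinkiewicz interpolation between these two bounds gives the dispersive
     estimate ||Sa a sigma phi||_r <= C |sigma|^(-lambda) ||phi||_{r'} with
     lambda = (a+1)(1/2 - 1/r), and admissibility says lambda = 2/q < 1.
   - Minkowski's inequality in x and the Hardy-Littlewood-Sobolev inequality in
     t, from L^{q'} to L^q with kernel |t|^(-2/q), conclude. *)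

(** Real-valued integrals read an infinite value as 0, so finiteness has to be settled before
    anything can be split or interchanged. The decay encoded in [Splus] serves that purpose; the
    constants come from norms alone. The function k does not decay, so the square of its transform
    cannot be expanded by Fubini as it stands. The factor e^(-eps x) restores absolute convergence
    and turns the inner integrals into Poisson kernels, whose mass is bounded independently of eps.
    The error O(1/z) barely fails to be integrable at infinity, but 1/(1 + s x y) is a kernel of
    Hilbert type, for which Schur's test works with the weight y^(-1/2). The interpolation in space
    and the Hardy-Littlewood-Sobolev inequality in time rest on one dyadic summation,
    [weak_to_strong]. In both, the datum is cut at a threshold depending on the level and on the
    total norm, so that the discarded part stays below a fixed fraction of the level at every point.
    The relation lambda = 2/q is the scaling condition 1/q' - 1/q = 1 - lambda, and for a > 1 the
    upper bound on r says that lambda < 1. *)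

Lemma le_ge0_integral d (T : measurableType d) (R : realType)
    (mu : {measure set T -> \bar R}) (D : set T) (f g : T -> \bar R) :
  (forall x, D x -> (0 <= f x)%E) -> (forall x, D x -> (f x <= g x)%E) ->
  (\int[mu]_(x in D) f x <= \int[mu]_(x in D) g x)%E.
Proof.
move=> f0 fg.
have g0 x : D x -> (0 <= g x)%E by move=> Dx; exact: le_trans (f0 _ Dx) (fg _ Dx).
rewrite !ge0_integralE//.
apply: ereal_sup_le => _ [h hf <-].
exists h => // x.
apply: (le_trans (hf x)).
by rewrite !patchE; case: ifPn => // /set_mem; exact: fg.
Qed.

(** Stated for arbitrary functions because it is applied to the integrand of [Duhamel], whose
    measurability in time is not established. The positive and negative parts both lie below the
    absolute value, and [fine] sends infinite values to 0. *)
Lemma norm_Rintegral_le d (T : measurableType d) (R : realType)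
    (mu : {measure set T -> \bar R}) (D : set T) (f : T -> R) :
  (`|Rintegral mu D f|%:E <= \int[mu]_(x in D) `|f x|%:E)%E.
Proof.
rewrite /Rintegral integralE.
set A := integral _ _ _; set B := integral _ _ _; set C := integral _ _ _.
have A0 : (0 <= A)%E by exact: integral_ge0.
have B0 : (0 <= B)%E by exact: integral_ge0.
have AC : (A <= C)%E.
  apply: le_ge0_integral => // x _.
  by rewrite funeposE -EFin_max lee_fin ge_max ler_norm normr_ge0.
have BC : (B <= C)%E.
  apply: le_ge0_integral => // x _.
  by rewrite funenegE -EFinN -EFin_max lee_fin ge_max ler_normr lexx orbT normr_ge0.
move: A B C A0 B0 AC BC => [A| |] [B| |] [C| |] //=; rewrite ?lee_fin ?normr0 ?leey//.
by move=> A0 B0 AC BC; rewrite ler_norml; lra.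
Qed.

(** * Fundamental theorem of calculus on the half line, for nonnegative integrands *)

Section exhaustion.
Variable R : realType.
Local Notation leb := (@lebesgue_measure R).
Implicit Types f F : R -> R.

Lemma ge0_FTC_compact f F (a b : R) : a < b ->
  (forall x, a <= x <= b -> {for x, continuous f}) ->
  (forall x, a <= x <= b -> is_derive x 1 F (f x)) ->
  (\int[leb]_(x in `[a, b]) (f x)%:E = (F b - F a)%:E)%E.
Proof.
move=> ab cf dF.
have cF x : a <= x <= b -> {for x, continuous F}.
  by move=> /dF dFx; apply/differentiable_continuous/derivable1_diffP.
rewrite (continuous_FTC2 (F := F))//.
- apply: continuous_in_subspaceT => x /[!inE]/=; rewrite in_itv/=; exact: cf.
- split.
  + by move=> x; rewrite in_itv/= => /andP[/ltW ax /ltW xb]; have := dF x; rewrite ax xb => /(_ isT) [].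
  + by apply: cvg_at_right_filter; apply: cF; rewrite lexx ltW.
  + by apply: cvg_at_left_filter; apply: cF; rewrite lexx ltW.
- move=> x; rewrite in_itv/= => /andP[/ltW ax /ltW xb]; rewrite derive1E.
  by have := dF x; rewrite ax xb => /(_ isT) [].
Qed.

(** The shift by 2 gives [a_ n < 1 < b_ n], so no interval of the exhaustion is degenerate. *)
Let a_ (n : nat) : R := n.+2%:R^-1.
Let b_ (n : nat) : R := n.+2%:R.

Lemma exhaust_gt0 : `]0%R, +oo[%classic = \bigcup_n `[a_ n, b_ n]%classic.
Proof.
apply/seteqP; split => x /=.
  rewrite in_itv/= andbT => x0.
  have [n _ /andP[nx xn]] : exists2 n, True & (x^-1 <= n%:R) && (x <= n%:R).
    exists (maxn (Num.truncn (x^-1)).+1 (Num.truncn x).+1) => //.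
    apply/andP; split.
      apply: le_trans (ltW (truncnS_gt _)) _; by rewrite ler_nat leq_maxl.
    apply: le_trans (ltW (truncnS_gt _)) _; by rewrite ler_nat leq_maxr.
  exists n => //=; rewrite in_itv/=; apply/andP; split.
    rewrite -(invrK x) lef_pV2 ?posrE ?invr_gt0//; first by apply: le_trans nx _; rewrite ler_nat; do 2 apply: leqW.
  by apply: le_trans xn _; rewrite ler_nat; do 2 apply: leqW.
move=> [n _] /=; rewrite !in_itv/= andbT => /andP[+ _]; apply: lt_le_trans.
by rewrite invr_gt0.
Qed.

Lemma ge0_FTC_cvg f F :
  (forall x : R, 0 < x -> 0 <= f x) -> (forall x : R, 0 < x -> {for x, continuous f}) ->
  (forall x : R, 0 < x -> is_derive x 1 F (f x)) ->
  (F (b_ n) - F (a_ n))%:E @[n --> \oo] --> (\int[leb]_(x in `]0%R, +oo[) (f x)%:E)%E.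
Proof.
move=> f0 cf dF; rewrite exhaust_gt0.
have a0 n x : a_ n <= x -> 0 < x by apply: lt_le_trans; rewrite invr_gt0.
have E n : (F (b_ n) - F (a_ n))%:E = (\int[leb]_(x in `[a_ n, b_ n]) (f x)%:E)%E.
  apply/esym/ge0_FTC_compact.
  - rewrite /a_ /b_; apply: (@lt_le_trans _ _ 1); last by rewrite ler1n.
    by rewrite invf_lt1// ltr1n.
  - by move=> x /andP[/a0 + _]; exact: cf.
  - by move=> x /andP[/a0 + _]; exact: dF.
rewrite (funext E).
apply: (@ge0_nondecreasing_set_cvg_integral _ _ _ _ _ leb) => //.
- apply/nondecreasing_seqP => n; rewrite subsetEset => x /=; rewrite !in_itv/=.
  move=> /andP[ax xb]; apply/andP; split.
    by apply: le_trans ax; rewrite lef_pV2 ?posrE// ler_nat.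
  by apply: le_trans xb _; rewrite ler_nat.
- move=> i; apply/measurable_EFinP.
  apply: subspace_continuous_measurable_fun => //.
  apply: continuous_in_subspaceT => x /[!inE]/=; rewrite in_itv/= => /andP[/a0 + _]; exact: cf.
- by move=> i x /=; rewrite in_itv/= lee_fin => /andP[/a0 + _]; exact: f0.
Qed.

Lemma ge0_FTC_le f F (M : R) :
  (forall x : R, 0 < x -> 0 <= f x) -> (forall x : R, 0 < x -> {for x, continuous f}) ->
  (forall x : R, 0 < x -> is_derive x 1 F (f x)) ->
  (forall x y : R, 0 < x -> 0 < y -> F y - F x <= M) ->
  (\int[leb]_(x in `]0%R, +oo[) (f x)%:E <= M%:E)%E.
Proof.
move=> f0 cf dF FM; have h := ge0_FTC_cvg f0 cf dF.
rewrite -(cvg_lim _ h)//; apply: lime_le; first by apply/cvg_ex; eexists; exact: h.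
by near=> n; rewrite lee_fin; apply: FM; rewrite ?invr_gt0.
Unshelve. all: by end_near. Qed.

Lemma ge0_FTC_eq f F (l0 l1 : R) :
  (forall x : R, 0 < x -> 0 <= f x) -> (forall x : R, 0 < x -> {for x, continuous f}) ->
  (forall x : R, 0 < x -> is_derive x 1 F (f x)) ->
  F x @[x --> 0^'+] --> l0 -> F x @[x --> +oo] --> l1 ->
  (\int[leb]_(x in `]0%R, +oo[) (f x)%:E = (l1 - l0)%:E)%E.
Proof.
move=> f0 cf dF Fl0 Fl1; have h := ge0_FTC_cvg f0 cf dF.
rewrite -(cvg_lim _ h)//; apply/cvg_lim => //; apply: cvg_EFin; first exact: nearW.
apply: cvgB.
  apply/((cvg_pinftyP F l1).1 Fl1)/cvgryPge => r.
  near=> n; apply: le_trans (_ : n%:R <= _); last by rewrite ler_nat; do 2 apply: leqW.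
  by near: n; exact: nbhs_infty_ger.
apply/((cvg_at_rightP F 0 l0).1 Fl0); split; first by move=> n; rewrite invr_gt0.
rewrite /a_.
have := @cvg_harmonic R; rewrite -(cvg_shiftn 1).
by under eq_fun do rewrite /harmonic addn1.
Unshelve. all: by end_near. Qed.

End exhaustion.

(** * Closure rules for measurability *)

Section measurability.
Context d (T : measurableType d) (R : realType).
Implicit Types f g : T -> R.

Lemma meas_mul f g : measurable_fun setT f -> measurable_fun setT g ->
  measurable_fun setT (fun x => f x * g x).
Proof. exact: measurable_funM. Qed.

Lemma meas_add f g : measurable_fun setT f -> measurable_fun setT g ->
  measurable_fun setT (fun x => f x + g x).
Proof. exact: measurable_funD. Qed.

Lemma meas_opp f : measurable_fun setT f -> measurable_fun setT (fun x => - f x).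
Proof. exact: measurable_funN. Qed.

Lemma meas_exp f n : measurable_fun setT f -> measurable_fun setT (fun x => f x ^+ n).
Proof. exact: measurable_funX. Qed.

Lemma meas_norm f : measurable_fun setT f -> measurable_fun setT (fun x => `|f x|).
Proof. by move=> mf; apply: (measurableT_comp _ mf). Qed.

Lemma meas_powR f p : measurable_fun setT f -> measurable_fun setT (fun x => f x `^ p).
Proof. by move=> mf; apply: (measurableT_comp (measurable_powR p) mf). Qed.

(** The identity x^-1 = x |x|^(-2) reduces inversion to a power. It also holds at x = 0, where both
    sides are 0 by convention. *)
Lemma meas_inv f : measurable_fun setT f -> measurable_fun setT (fun x => (f x)^-1).
Proof.
move=> mf; rewrite (_ : (fun _ => _) = fun x => f x * (`|f x| `^ (- 2%:R))).
  by apply: meas_mul => //; apply: meas_powR; exact: meas_norm.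
apply/funext => x; have [->|fx0] := eqVneq (f x) 0; first by rewrite invr0 mul0r.
by rewrite powR_invn// real_normK ?num_real// expr2 invfM mulrA divff// mul1r.
Qed.

Lemma meas_cont (h : R -> R) f : continuous h -> measurable_fun setT f ->
  measurable_fun setT (fun x => h (f x)).
Proof. by move=> ch mf; apply: (measurableT_comp (continuous_measurable_fun ch) mf). Qed.

Lemma meas_EFin f : measurable_fun setT f -> measurable_fun setT (fun x => (f x)%:E).
Proof. by move=> mf; apply/measurable_EFinP. Qed.

Lemma meas_lt f g : measurable_fun setT f -> measurable_fun setT g ->
  measurable_fun setT (fun x => (f x < g x)%R%:R : R).
Proof.
move=> mf mg; rewrite (_ : (fun _ => _) = fun x => if f x < g x then 1 else 0).
  by apply: measurable_fun_ifT => //; exact: measurable_fun_ltr.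
by apply/funext => x; case: ifP.
Qed.

Lemma meas_le f g : measurable_fun setT f -> measurable_fun setT g ->
  measurable_fun setT (fun x => (f x <= g x)%R%:R : R).
Proof.
move=> mf mg; rewrite (_ : (fun _ => _) = fun x => if f x <= g x then 1 else 0).
  by apply: measurable_fun_ifT => //; exact: measurable_fun_ler.
by apply/funext => x; case: ifP.
Qed.

Lemma meas_comp (h : R -> R) f : measurable_fun setT h -> measurable_fun setT f ->
  measurable_fun setT (fun x => h (f x)).
Proof. exact: measurableT_comp. Qed.

Lemma meas_comp2 (h : R -> R -> R) f g : measurable_fun setT (fun p : R * R => h p.1 p.2) ->
  measurable_fun setT f -> measurable_fun setT g ->
  measurable_fun setT (fun x => h (f x) (g x)).
Proof.
move=> mh mf mg; apply: (measurableT_comp mh (g := fun x => (f x, g x))).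
by apply/measurable_fun_pairP.
Qed.

End measurability.

Ltac mea := repeat lazymatch goal with
  | |- measurable_fun _ (fun _ => ?c) => exact: measurable_cst
  | |- measurable_fun _ (fun x => x) => exact: measurable_id
  | |- measurable_fun _ (fun x => fst x) => exact: measurable_fst
  | |- measurable_fun _ (fun x => snd x) => exact: measurable_snd
  | |- measurable_fun _ (fun x => fst (fst x)) => exact: (measurableT_comp measurable_fst measurable_fst)
  | |- measurable_fun _ (fun x => snd (fst x)) => exact: (measurableT_comp measurable_snd measurable_fst)
  | |- measurable_fun _ (fun x => EFin _) => apply: meas_EFin
  | |- measurable_fun _ (fun x => @GRing.mul _ _ _) => apply: meas_mul
  | |- measurable_fun _ (fun x => @GRing.add _ _ _) => apply: meas_add
  | |- measurable_fun _ (fun x => @GRing.opp _ _) => apply: meas_opp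
  | |- measurable_fun _ (fun x => @GRing.exp _ _ _) => apply: meas_exp
  | |- measurable_fun _ (fun x => @GRing.inv _ _) => apply: meas_inv
  | |- measurable_fun _ (fun x => Num.norm _) => apply: meas_norm
  | |- measurable_fun _ (fun x => powR _ _) => apply: meas_powR
  | |- measurable_fun _ (fun x => expR _) => apply: (meas_cont (@continuous_expR _))
  | |- measurable_fun _ (fun x => cos _) => apply: (meas_cont (@continuous_cos _))
  | |- measurable_fun _ (fun x => sin _) => apply: (meas_cont (@continuous_sin _))
  | |- measurable_fun _ (fun x => _ (nat_of_bool (_ < _)%R)) => apply: meas_lt
  | |- measurable_fun _ (fun x => _ (nat_of_bool (_ <= _)%R)) => apply: meas_le
  | |- measurable_fun _ (@GRing.add ?V ?c) => change (@GRing.add V c) with (fun y => @GRing.add V c y)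
  | |- measurable_fun _ (@GRing.mul ?V ?c) => change (@GRing.mul V c) with (fun y => @GRing.mul V c y)
  | |- _ => first [ assumption | done | lazymatch goal with
    | |- measurable_fun _ (fun x => ?f (@?g x) (@?h x)) =>
        first [ lazymatch goal with
                | |- measurable_fun _ (fun x => ?k (@?h' x)) =>
                    apply: (@meas_comp _ _ _ k h'); [assumption|]
                end
              | apply: (@meas_comp2 _ _ _ f g h)
              | lazymatch goal with
                | |- measurable_fun _ (fun x => ?k (@?h' x)) => apply: (@meas_comp _ _ _ k h')
                end ]
    | |- measurable_fun _ (fun x => ?f (@?g x)) => apply: (@meas_comp _ _ _ f g)
    | |- measurable_fun _ (?f ?y) => apply: (@meas_comp2 _ _ _ f (cst y) id)
    end ]
  end.

(** * Tonelli's theorem, translations and reflections *)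

Section tonelli.
Variable R : realType.
Local Notation leb := (@lebesgue_measure R).

Lemma tonelli (f : R -> R -> \bar R) :
  measurable_fun setT (fun p : R * R => f p.1 p.2) -> (forall x y, (0 <= f x y)%E) ->
  (\int[leb]_x \int[leb]_y f x y = \int[leb]_y \int[leb]_x f x y)%E.
Proof.
move=> mf f0.
exact: (@fubini_tonelli _ _ _ _ _ leb leb (fun p : R * R => f p.1 p.2) mf (fun p => f0 p.1 p.2)).
Qed.

Lemma meas_integral d (T : measurableType d) (f : T -> R -> \bar R) :
  measurable_fun setT (fun p : T * R => f p.1 p.2) -> (forall x y, (0 <= f x y)%E) ->
  measurable_fun setT (fun x => \int[leb]_y f x y)%E.
Proof.
move=> mf f0.
exact: (@measurable_fun_fubini_tonelli_F _ _ _ _ _ leb (fun p : T * R => f p.1 p.2) mf (fun p => f0 p.1 p.2)).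
Qed.

(** The positive and negative parts are handled separately by Tonelli; since [fine] is measurable on
    all extended reals, parameters at which the integral diverges cause no trouble. *)
Lemma meas_Rintegral d (T : measurableType d) (f : T -> R -> R) :
  measurable_fun setT (fun p : T * R => f p.1 p.2) ->
  measurable_fun setT (fun x => Rintegral leb setT (f x)).
Proof.
move=> mf.
rewrite (_ : (fun _ => _) = fun x => fine (\int[leb]_y (Order.max (f x y) 0)%:E - \int[leb]_y (Order.max (- f x y) 0)%:E)%E).
  apply: (measurableT_comp (fine_measurable measurableT)).
  apply: emeasurable_funB.
    apply: meas_integral; last by move=> x y; rewrite lee_fin le_max lexx orbT.
    by apply: meas_EFin; apply: measurable_maxr.
  apply: meas_integral; last by move=> x y; rewrite lee_fin le_max lexx orbT.
  by apply: meas_EFin; apply: measurable_maxr => //; exact: meas_opp.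
apply/funext => x; rewrite /Rintegral integralE; congr (fine (_ - _)%E).
  by apply: eq_integral => y _; rewrite funeposE EFin_max.
by apply: eq_integral => y _; rewrite funenegE EFin_max EFinN.
Qed.

Lemma ge0_integral_shift (f : R -> \bar R) (c : R) : measurable_fun setT f ->
  (forall x, (0 <= f x)%E) -> (\int[leb]_x f (x + c)%R = \int[leb]_x f x)%E.
Proof.
move=> mf f0; pose s : measurableTypeR R -> measurableTypeR R := fun x => x + c.
have ms : measurable_fun setT s by apply: (@meas_add _ _ R).
have := @ge0_integral_pushforward _ _ _ _ _ s ms leb setT f measurableT mf (fun y _ => f0 y).
rewrite preimage_setT => <-.
apply: eq_measure_integral => //= A mA _.
(* The image of Lebesgue measure under the translation gives half-open intervals their length, which
   characterises Lebesgue measure. *)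
apply/esym; apply: (@lebesgue_measure_unique _ (pushforward leb s)) => //= _ [[a b]] _ <-.
rewrite /pushforward (_ : _ @^-1` _ = `](a - c), (b - c)]%classic); last first.
  by apply/seteqP; split => x /=; rewrite !in_itv/= /s ltrBlDr lerBrDr.
rewrite !lebesgue_measure_itv/= !lte_fin ltrD2r -!EFinB; case: ifP => // _; congr EFin; ring.
Qed.

Lemma ge0_integral_opp (f : R -> \bar R) : measurable_fun setT f ->
  (forall x, (0 <= f x)%E) -> (\int[leb]_x f (- x)%R = \int[leb]_x f x)%E.
Proof.
move=> mf f0; pose s : measurableTypeR R -> measurableTypeR R := fun x => - x.
have ms : measurable_fun setT s by apply: (@meas_opp _ _ R).
have := @ge0_integral_pushforward _ _ _ _ _ s ms leb setT f measurableT mf (fun y _ => f0 y).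
rewrite preimage_setT => <-.
by apply: eq_measure_integral => //= A mA _; exact: lebesgue_measureN.
Qed.

End tonelli.

(** * Differentiation rules *)

Section derivation.
Variable R : realType.
Implicit Types (f g h : R -> R) (x a b p c : R).

Lemma der_id x : is_derive x 1 (fun y : R => y) 1.
Proof. exact: is_derive_id. Qed.

Lemma der_cst c x : is_derive x 1 (fun _ : R => c) 0.
Proof. exact: is_derive_cst. Qed.

Lemma der_add f g x a b : is_derive x 1 f a -> is_derive x 1 g b ->
  is_derive x 1 (fun y => f y + g y) (a + b).
Proof. by move=> fa gb; exact: is_deriveD. Qed.

Lemma der_opp f x a : is_derive x 1 f a -> is_derive x 1 (fun y => - f y) (- a).
Proof. by move=> fa; exact: is_deriveN. Qed.

Lemma der_mul f g x a b : is_derive x 1 f a -> is_derive x 1 g b ->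
  is_derive x 1 (fun y => f y * g y) (a * g x + f x * b).
Proof.
move=> fa gb; have := is_deriveM fa gb.
by rewrite /GRing.scale/= addrC [g x * a]mulrC.
Qed.

Lemma der_exp f n x a : is_derive x 1 f a ->
  is_derive x 1 (fun y => f y ^+ n) (n%:R * f x ^+ n.-1 * a).
Proof.
move=> fa; rewrite (_ : (fun y => _) = f ^+ n); last by rewrite exprfctE.
exact: is_deriveX.
Qed.

Lemma der_comp h f x a b : is_derive (f x) 1 h a -> is_derive x 1 f b ->
  is_derive x 1 (fun y => h (f y)) (a * b).
Proof. by move=> ha fb; exact: is_derive1_comp. Qed.

Lemma der_inv f x a : f x != 0 -> is_derive x 1 f a ->
  is_derive x 1 (fun y => (f y)^-1) (- a / f x ^+ 2).
Proof.
move=> fx fa; have := is_deriveV fx fa.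
by rewrite /GRing.scale/= mulrC mulrN mulNr.
Qed.

Lemma der_powR f p x a : 0 < f x -> is_derive x 1 f a ->
  is_derive x 1 (fun y => f y `^ p) (p * f x `^ (p - 1) * a).
Proof. by move=> f0 fa; apply: (@der_comp (fun y => y `^ p)) => //; exact: is_derive1_powR. Qed.

Lemma der_expR f x a : is_derive x 1 f a ->
  is_derive x 1 (fun y => expR (f y)) (expR (f x) * a).
Proof. by move=> fa; apply: (@der_comp expR). Qed.

Lemma der_cos f x a : is_derive x 1 f a ->
  is_derive x 1 (fun y => cos (f y)) (- sin (f x) * a).
Proof. by move=> fa; apply: (@der_comp cos). Qed.

Lemma der_sin f x a : is_derive x 1 f a ->
  is_derive x 1 (fun y => sin (f y)) (cos (f x) * a).
Proof. by move=> fa; apply: (@der_comp sin). Qed.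

Lemma der_atan f x a : is_derive x 1 f a ->
  is_derive x 1 (fun y => atan (f y)) ((1 + f x ^+ 2)^-1 * a).
Proof. by move=> fa; apply: (@der_comp atan). Qed.

Lemma der_eq f x a b : is_derive x 1 f a -> a = b -> is_derive x 1 f b.
Proof. by move=> fa <-. Qed.

Lemma der_continuous f x a : is_derive x 1 f a -> {for x, continuous f}.
Proof. by move=> fa; apply/differentiable_continuous/derivable1_diffP; case: fa. Qed.

End derivation.

Ltac der := repeat first [ eassumption | match goal with
  | |- is_derive _ _ (fun x => ?c) _ => notypeclasses refine (der_cst _ _)
  | |- is_derive _ _ (fun x => @GRing.mul _ _ _) _ => notypeclasses refine (der_mul _ _)
  | |- is_derive _ _ (fun x => @GRing.add _ _ _) _ => notypeclasses refine (der_add _ _)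
  | |- is_derive _ _ (fun x => @GRing.opp _ _) _ => notypeclasses refine (der_opp _)
  | |- is_derive _ _ (fun x => @GRing.exp _ _ _) _ => notypeclasses refine (der_exp _ _)
  | |- is_derive _ _ (fun x => @GRing.inv _ _) _ => notypeclasses refine (der_inv _ _)
  | |- is_derive _ _ (fun x => powR _ _) _ => notypeclasses refine (der_powR _ _ _)
  | |- is_derive _ _ (fun x => expR _) _ => notypeclasses refine (der_expR _)
  | |- is_derive _ _ (fun x => cos _) _ => notypeclasses refine (der_cos _)
  | |- is_derive _ _ (fun x => sin _) _ => notypeclasses refine (der_sin _)
  | |- is_derive _ _ (fun x => atan _) _ => notypeclasses refine (der_atan _)
  | |- is_derive _ _ (fun x => x) _ => notypeclasses refine (der_id _)
  | |- is_derive _ _ (fun x => _) _ => fail 1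
  | |- is_derive ?x ?v ?f ?d => change (is_derive x v (fun y => f y) d)
  end ]; cbv beta.

Section integral_real.
Context d (T : measurableType d) (R : realType) (mu : {measure set T -> \bar R}).
Variables (D : set T) (mD : measurable D).
Implicit Types f g : T -> R.

Lemma ge0_integral_mulc (k : R) f : 0 <= k -> (forall x, D x -> 0 <= f x) ->
  measurable_fun setT f ->
  (\int[mu]_(x in D) (k * f x)%:E = k%:E * \int[mu]_(x in D) (f x)%:E)%E.
Proof.
move=> k0 f0 mf; under eq_integral do rewrite EFinM.
rewrite ge0_integralZl_EFin//.
by apply: measurable_funTS; exact: meas_EFin.
Qed.

Lemma ge0_integral_add f g : (forall x, D x -> 0 <= f x) -> (forall x, D x -> 0 <= g x) ->
  measurable_fun setT f -> measurable_fun setT g ->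
  (\int[mu]_(x in D) (f x + g x)%:E = \int[mu]_(x in D) (f x)%:E + \int[mu]_(x in D) (g x)%:E)%E.
Proof.
move=> f0 g0 mf mg; under eq_integral do rewrite EFinD.
by rewrite ge0_integralD//; apply: measurable_funTS; exact: meas_EFin.
Qed.

End integral_real.

(** * Gamma and Bessel functions *)

Section gamma.
Variable R : realType.
Local Notation leb := (@lebesgue_measure R).
Local Notation pos := `]0%R, +oo[%classic.

(** In substance the integral of g = psi' is 0, as needed for an integration by parts. As g changes
    sign, it is added to a nonnegative [f] with a known primitive that keeps the sum nonnegative, so
    that only integrals of nonnegative functions occur. *)
Lemma ge0_FTC_perturb (f g F psi : R -> R) :
  (forall x : R, 0 < x -> 0 <= f x) -> (forall x : R, 0 < x -> {for x, continuous f}) ->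
  (forall x : R, 0 < x -> is_derive x 1 F (f x)) ->
  (forall x : R, 0 < x -> 0 <= f x + g x) -> (forall x : R, 0 < x -> {for x, continuous g}) ->
  (forall x : R, 0 < x -> is_derive x 1 psi (g x)) ->
  psi x @[x --> 0^'+] --> 0 -> psi x @[x --> +oo] --> 0 ->
  (\int[leb]_(x in pos) (f x + g x)%:E = \int[leb]_(x in pos) (f x)%:E)%E.
Proof.
move=> f0 cf dF fg0 cg dpsi p0 poo.
have h1 := ge0_FTC_cvg f0 cf dF.
have h2 : (fun n => ((F n.+2%:R + psi n.+2%:R) - (F n.+2%:R^-1 + psi n.+2%:R^-1))%:E)
    @ \oo --> (\int[leb]_(x in pos) (f x + g x)%:E)%E.
  apply: (@ge0_FTC_cvg _ (fun x => f x + g x) (fun x => F x + psi x)) => //.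
  - by move=> x x0; apply: continuousD; [exact: cf|exact: cg].
  - by move=> x x0; apply: der_add; [exact: dF|exact: dpsi].
have h3 : ((psi n.+2%:R - psi n.+2%:R^-1)%:E @[n --> \oo] --> 0%:E)%E.
  apply: cvg_EFin; first exact: nearW.
  rewrite -[X in _ --> X](subr0 0); apply: cvgB.
    apply/((cvg_pinftyP psi 0).1 poo)/cvgryPge => r.
    near=> n; apply: le_trans (_ : n%:R <= _); last by rewrite ler_nat; do 2 apply: leqW.
    by near: n; exact: nbhs_infty_ger.
  apply/((cvg_at_rightP psi 0 0).1 p0); split; first by move=> n; rewrite invr_gt0.
  have := @cvg_harmonic R; rewrite -(cvg_shiftn 1).
  by under eq_fun do rewrite /harmonic addn1.
have h4 := cvgeD (@fin_num_adde_defl _ (\int[leb]_(x in pos) (f x)%:E)%E 0%:E isT) h1 h3.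
rewrite adde0 in h4.
rewrite -(cvg_lim _ h2)//; apply/cvg_lim => //; apply: cvg_trans (h4 _).
apply: near_eq_cvg; near=> n; rewrite /= -EFinD; congr EFin; ring.
Unshelve. all: by end_near. Qed.

(** An integrable majorant with an elementary primitive: it behaves like x^(s-1) at 0 and like
    x^(-2) at infinity, and is the derivative of (x/(1+x))^s / s. It dominates the Gamma integrand
    and later the singular part of |t|^(-lambda). *)
Definition hker (s x : R) : R := x `^ (s - 1) * (1 + x) `^ (- (s + 1)).

Lemma der_hker (s x : R) : 0 < s -> 0 < x ->
  is_derive x 1 (fun x => s^-1 * (x / (1 + x)) `^ s) (hker s x).
Proof.
move=> s0 x0; have x1 : 0 < 1 + x by lra.
apply: der_eq; first der; first by rewrite divr_gt0.
  by rewrite gt_eqF.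
cbv beta.
have -> : (x / (1 + x)) `^ (s - 1) = x `^ (s - 1) * (1 + x) `^ (1 - s).
  rewrite powRM ?invr_ge0 ?(ltW x0) ?(ltW x1)// -powR_inv1 ?(ltW x1)// -powRrM.
  by congr (_ * _ `^ _); ring.
have E : (1 + x) `^ (- (s + 1)) = (1 + x) `^ (1 - s) / (1 + x) ^+ 2.
  rewrite -powR_invn ?(ltW x1)// -powRD ?(gt_eqF x1) ?implybT//.
  by congr (_ `^ _); ring.
by rewrite /hker E; field; rewrite !gt_eqF.
Qed.

Lemma hker_ge0 (s x : R) : 0 <= hker s x.
Proof. by rewrite mulr_ge0 ?powR_ge0. Qed.

Lemma hker_continuous (s x : R) : 0 < x -> {for x, continuous (hker s)}.
Proof.
move=> x0; apply: der_continuous; rewrite /hker.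
by der; lra.
Qed.

Lemma integral_hker_le (s : R) : 0 < s ->
  (\int[leb]_(x in pos) (hker s x)%:E <= s^-1%:E)%E.
Proof.
move=> s0; apply: (@ge0_FTC_le _ (hker s) (fun x => s^-1 * (x / (1 + x)) `^ s)).
- by move=> x _; exact: hker_ge0.
- by move=> x; exact: hker_continuous.
- by move=> x; exact: der_hker.
move=> x y x0 y0; rewrite -mulrBr ler_piMr ?invr_ge0 ?(ltW s0)//.
have h z : 0 < z -> 0 <= (z / (1 + z)) `^ s <= 1.
  move=> z0; rewrite powR_ge0/=; apply: (@le_trans _ _ (1 `^ s)); last by rewrite powR1.
  apply: ge0_ler_powR; rewrite ?nnegrE ?(ltW s0)// ?divr_ge0//; try lra.
  by rewrite ler_pdivrMr; lra.
by have := h x x0; have := h y y0; lra.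
Qed.

(* (1 + x)^m <= m^m e^x for m >= 1, from 1 + x <= m (1 + x/m) <= m e^(x/m) *)
Lemma expR_dominates (s : R) : exists K : R, 0 < K /\
  forall x : R, 0 <= x -> expR (- x) <= K * (1 + x) `^ (- s).
Proof.
pose m := (Num.truncn `|s|).+1.
have sm : s <= m%:R by apply: le_trans (ler_norm _) (ltW (truncnS_gt _)).
exists (m%:R ^+ m); split; first by rewrite exprn_gt0.
move=> x x0; have x1 : 0 < 1 + x by lra.
rewrite powRN ler_pdivlMr ?powR_gt0// expRN mulrC ler_pdivrMr ?expR_gt0//.
apply: (@le_trans _ _ ((1 + x) ^+ m)).
  by rewrite -powR_mulrn ?(ltW x1)// ler_powR//; lra.
have -> : expR x = expR (x / m%:R) ^+ m.
  by rewrite -expRM_natl mulrC divfK ?pnatr_eq0.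
rewrite -exprMn lerXn2r ?nnegrE ?mulr_ge0 ?expR_ge0 ?(ltW x1)//.
apply: (@le_trans _ _ (m%:R * (1 + x / m%:R))); last by rewrite ler_wpM2l// expR_ge1Dx.
rewrite mulrDr mulr1 mulrCA divff ?pnatr_eq0// mulr1 lerD2r ler1n//.
Qed.

Definition gammaI (s : R) : \bar R := (\int[leb]_(x in pos) (x `^ (s - 1) * expR (- x))%:E)%E.

Lemma gamma_integrand_le (s : R) : exists K : R, 0 < K /\
  forall x : R, 0 < x -> x `^ (s - 1) * expR (- x) <= K * hker s x.
Proof.
have [K [K0 hK]] := expR_dominates (s + 1).
exists K; split => // x x0; rewrite /hker mulrCA ler_wpM2l ?powR_ge0//.
exact/hK/ltW.
Qed.

Lemma gammaI_lty (s : R) : 0 < s -> (gammaI s < +oo)%E.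
Proof.
move=> s0; have [K [K0 hK]] := gamma_integrand_le s.
apply: (@le_lt_trans _ _ (K%:E * \int[leb]_(x in pos) (hker s x)%:E)%E).
  rewrite -ge0_integralZl_EFin//=; last 3 first.
  - by move=> x _; rewrite lee_fin hker_ge0.
  - by apply: measurable_funTS; rewrite /hker; mea.
  - exact: ltW.
  apply: le_ge0_integral => x /=; rewrite in_itv/= andbT => x0.
    by rewrite lee_fin mulr_ge0 ?powR_ge0 ?expR_ge0.
  by rewrite -EFinM lee_fin; exact: hK.
apply: (@le_lt_trans _ _ (K%:E * s^-1%:E)%E); last by rewrite -EFinM ltry.
by rewrite lee_wpmul2l ?lee_fin ?(ltW K0)//; exact: integral_hker_le.
Qed.

Lemma gammaI_gt0 (s : R) : 0 < s -> (0 < gammaI s)%E.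
Proof.
(* On [1, 2] one has x^(s-1) >= x^(-1) >= 1/2 and e^(-x) >= e^(-2). *)
move=> s0; pose c : R := expR (- 2) / 2.
have c0 : 0 < c by rewrite divr_gt0 ?expR_gt0.
apply: (@lt_le_trans _ _ (\int[leb]_(x in `[1%R, 2%R]) c%:E)%E).
  rewrite integral_cst//= lebesgue_measure_itv/= lte_fin ltr1n -EFinB -EFinM lte_fin.
  by rewrite mulr_gt0//; lra.
apply: (@le_trans _ _ (\int[leb]_(x in `[1%R, 2%R]) (x `^ (s - 1) * expR (- x))%:E)%E).
  apply: le_ge0_integral => x /=; rewrite in_itv/= => /andP[x1 x2]; rewrite lee_fin ?(ltW c0)//.
  rewrite /c mulrC ler_pM ?invr_ge0 ?expR_ge0//; last by rewrite ler_expR; lra.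
  apply: (@le_trans _ _ (x `^ (-1))); last by apply: ler_powR; lra.
  by rewrite powR_inv1 ?lef_pV2 ?posrE//; lra.
apply: ge0_subset_integral => //.
- by apply: measurable_funTS; mea.
- by move=> x _; rewrite lee_fin mulr_ge0 ?powR_ge0 ?expR_ge0.
- by move=> x /=; rewrite !in_itv/= andbT => /andP[x1 _]; lra.
Qed.

(** Integration by parts with boundary term u = x^s e^(-x), where u' = s v - u. The function [f]
    dominates u, so [f + u'] is nonnegative and has the same integral as [f]; the finite integral of
    [f] is cancelled at the end. *)
Lemma gammaIS (s : R) : 0 < s -> gammaI (s + 1) = (s%:E * gammaI s)%E.
Proof.
move=> s0; have [K [K0 hK]] := gamma_integrand_le (s + 1).
have s1 : 0 < s + 1 by lra.
pose f x : R := K * hker (s + 1) x.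
pose u x : R := x `^ s * expR (- x).
pose v x : R := x `^ (s - 1) * expR (- x).
have uf x : 0 < x -> u x <= f x.
  by move=> x0; have := hK x x0; rewrite addrK.
have u0 x : 0 <= u x by rewrite mulr_ge0 ?powR_ge0 ?expR_ge0.
have v0 x : 0 <= v x by rewrite mulr_ge0 ?powR_ge0 ?expR_ge0.
have f0 x : 0 <= f x by rewrite mulr_ge0 ?(ltW K0) ?hker_ge0.
have cf x : 0 < x -> {for x, continuous f}.
  by move=> x0; apply: continuousM; [exact: cvg_cst|exact: hker_continuous].
have cu x : 0 < x -> {for x, continuous u}.
  by move=> x0; apply: der_continuous; rewrite /u; der.
have cv x : 0 < x -> {for x, continuous v}.
  by move=> x0; apply: der_continuous; rewrite /v; der.
have mf : measurable_fun setT f by rewrite /f /hker; mea.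
have mu : measurable_fun setT u by rewrite /u; mea.
have mv : measurable_fun setT v by rewrite /v; mea.
have g0 x : 0 < x -> 0 <= f x + (s * v x - u x).
  by move=> x0; have := uf x x0; have := mulr_ge0 (ltW s0) (v0 x); lra.
have E : (\int[leb]_(x in pos) (f x + (s * v x - u x))%:E = \int[leb]_(x in pos) (f x)%:E)%E.
  apply: (@ge0_FTC_perturb f _ (fun x => K * ((s + 1)^-1 * (x / (1 + x)) `^ (s + 1))) u).
  - by move=> x _; exact: f0.
  - exact: cf.
  - by move=> x x0; have := der_mul (der_cst K x) (der_hker s1 x0); rewrite mul0r add0r.
  - exact: g0.
  - by move=> x x0; apply: continuousB; [apply: continuousM; [exact: cvg_cst|exact: cv]|exact: cu].
  - move=> x x0; rewrite /u; apply: der_eq; first by der.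
    by rewrite /v; ring.
  - have h2 : expR (- x) @[x --> 0^'+] --> expR (- 0 : R).
      apply: cvg_at_right_filter; apply: (@der_continuous _ (fun x : R => expR (- x)) 0 (expR (- 0) * - 1)).
    by have h := cvgM (powR_cvg0 s0) h2; rewrite mul0r in h; exact: h.
  - apply: (@squeeze_cvgr _ _ _ _ (cst 0) (fun x => K * x^-1)).
    + near=> x; rewrite u0/=; apply: le_trans (uf _ _) _; first by near: x; exact: nbhs_pinfty_gt.
      rewrite /f ler_wpM2l ?(ltW K0)// /hker addrK.
      have x0 : 0 < x by near: x; exact: nbhs_pinfty_gt.
      rewrite (_ : - (s + 1 + 1) = - s + - 2%:R); last by ring.
      rewrite powRD ?(gt_eqF (_ : 0 < 1 + x)) ?implybT//; last by lra.
      rewrite mulrA powRN powR_invn; last by lra.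
      apply: (@le_trans _ _ (1 * (1 + x) ^- 2)).
        rewrite ler_wpM2r ?invr_ge0 ?exprn_ge0//; first by lra.
        rewrite ler_pdivrMr ?powR_gt0 ?mul1r//; last by lra.
        by apply: ge0_ler_powR; rewrite ?nnegrE; lra.
      rewrite mul1r lef_pV2 ?posrE ?exprn_gt0//; last by lra.
      by nra.
    + exact: cvg_cst.
    + have h : (fun x : R => x^-1) @ +oo --> (0 : R).
        by apply/gtr0_cvgV0; [near=> x; near: x; exact: nbhs_pinfty_gt|exact: cvg_id].
      by have h' := cvgM (cvg_cst K) h; rewrite mulr0 in h'; exact: h'.
have fin : (\int[leb]_(x in pos) (f x)%:E)%E \is a fin_num.
  rewrite ge0_fin_numE ?integral_ge0//; last by move=> x _; rewrite lee_fin.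
  apply: (@le_lt_trans _ _ (K%:E * (s + 1)^-1%:E)%E); last by rewrite -EFinM ltry.
  rewrite ge0_integral_mulc ?(ltW K0)//=; last 2 first.
  - by move=> x _; rewrite hker_ge0.
  - by rewrite /hker; mea.
  by rewrite lee_wpmul2l ?lee_fin ?(ltW K0)//; exact: integral_hker_le.
have D1 : (\int[leb]_(x in pos) (f x)%:E + s%:E * gammaI s =
   \int[leb]_(x in pos) (f x + s * v x)%:E)%E.
  have -> : (s%:E * gammaI s = \int[leb]_(x in pos) (s * v x)%:E)%E.
    by rewrite ge0_integral_mulc ?(ltW s0).
  rewrite ge0_integral_add//; last by mea.
  by move=> x _; rewrite mulr_ge0 ?(ltW s0).
have D2 : (\int[leb]_(x in pos) (f x + s * v x)%:E =
   \int[leb]_(x in pos) (f x + (s * v x - u x))%:E + gammaI (s + 1))%E.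
  have -> : gammaI (s + 1) = (\int[leb]_(x in pos) (u x)%:E)%E by rewrite /gammaI addrK.
  rewrite -(@ge0_integral_add _ _ _ leb pos _ (fun x => f x + (s * v x - u x)) u)//.
  - by apply: eq_integral => x _; congr EFin; ring.
  - by move=> x /=; rewrite in_itv/= andbT; exact: g0.
  - by mea.
rewrite D2 E in D1.
have := congr1 (fun z => (z - \int[leb]_(x in pos) (f x)%:E)%E) D1.
by rewrite /= [X in (X - _)%E = _ -> _]addeC [X in _ = (X - _)%E -> _]addeC !addeK.
Unshelve. all: by end_near. Qed.

Lemma GammaR_gt0 (s : R) : 0 < s -> 0 < GammaR s.
Proof.
move=> s0; have := gammaI_gt0 s0; have := gammaI_lty s0.
by rewrite /GammaR /Rintegral -/(gammaI s); case: (gammaI s) => //= r _; rewrite lte_fin.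
Qed.

Lemma GammaRS (s : R) : 0 < s -> GammaR (s + 1) = s * GammaR s.
Proof.
move=> s0; have := gammaIS s0; have := gammaI_lty s0; have := gammaI_gt0 s0.
rewrite /GammaR /Rintegral -/(gammaI s) -/(gammaI (s + 1)).
by case: (gammaI s) => //= r _ _ ->.
Qed.

End gamma.

(** * Monotonicity and limits read off derivatives *)

Section real_calculus.
Variable R : realType.
Implicit Types (f : R -> R) (x y z : R).

Lemma der_le0_nonincr f (f' : R -> R) x y : x <= y ->
  (forall z, x <= z <= y -> is_derive z 1 f (f' z)) ->
  (forall z, x <= z <= y -> f' z <= 0) -> f y <= f x.
Proof.
move=> xy df f0.
have [||c] := @MVT_segment R f f' x y xy.
- by move=> z; rewrite in_itv/= => /andP[/ltW xz /ltW zy]; apply: df; rewrite xz.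
- apply: derivable_within_continuous => z; rewrite in_itv/= => zxy.
  by case: (df z zxy).
rewrite in_itv/= => cxy E.
by rewrite -subr_le0 E; apply: mulr_le0_ge0; [exact: f0|rewrite subr_ge0].
Qed.

Lemma der_ge0_nondecr f (f' : R -> R) x y : x <= y ->
  (forall z, x <= z <= y -> is_derive z 1 f (f' z)) ->
  (forall z, x <= z <= y -> 0 <= f' z) -> f x <= f y.
Proof.
move=> xy df f0; rewrite -lerN2.
apply: (@der_le0_nonincr (fun z => - f z) (fun z => - f' z)) => // z zxy.
  by apply: der_opp; exact: df.
by rewrite oppr_le0; exact: f0.
Qed.

(** The function p - B/z increases and p + B/z decreases, so every value of the first lies below
    every value of the second. The supremum of the first separates them, which gives the limit
    together with its rate. *)
Lemma der_inv_sqr_cvg (p p' : R -> R) (B : R) :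
  (forall z, 1 <= z -> is_derive z 1 p (p' z)) ->
  (forall z, 1 <= z -> `|p' z| <= B / z ^+ 2) ->
  exists al : R, forall z, 1 <= z -> `|p z - al| <= B / z.
Proof.
move=> dp hB.
have B0 : 0 <= B by have := hB 1 (lexx _); rewrite expr1n divr1; apply: le_trans.
have lo x y : 1 <= x -> x <= y -> p x - B / x <= p y - B / y.
  move=> x1 xy; apply: (@der_ge0_nondecr (fun z => p z - B * z^-1) (fun z => p' z + B / z ^+ 2)) => //.
    move=> z /andP[xz _]; have z1 : 1 <= z by lra.
    have := dp z z1 => dpz; apply: der_eq; first der.
      by rewrite gt_eqF//; lra.
    by rewrite /=; field; rewrite gt_eqF//; lra.
  move=> z /andP[xz _]; have z1 : 1 <= z by lra.
  by have := hB z z1; rewrite ler_norml => /andP[]; lra.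
have hi x y : 1 <= x -> x <= y -> p y + B / y <= p x + B / x.
  move=> x1 xy; apply: (@der_le0_nonincr (fun z => p z + B * z^-1) (fun z => p' z - B / z ^+ 2)) => //.
    move=> z /andP[xz _]; have z1 : 1 <= z by lra.
    have := dp z z1 => dpz; apply: der_eq; first der.
      by rewrite gt_eqF//; lra.
    by rewrite /=; field; rewrite gt_eqF//; lra.
  move=> z /andP[xz _]; have z1 : 1 <= z by lra.
  by have := hB z z1; rewrite ler_norml => /andP[]; lra.
have Bp z : 1 <= z -> 0 <= B / z by move=> z1; rewrite divr_ge0//; lra.
pose S := [set p z - B / z | z in [set z : R | 1 <= z]].
have ub z : 1 <= z -> ubound S (p z + B / z).
  move=> z1 _ [y /= y1 <-]; have [yz|zy] := leP y z.
    by have := lo _ _ y1 yz; have := Bp z z1; lra.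
  by have := hi _ _ z1 (ltW zy); have := Bp y y1; lra.
have hs : has_sup S.
  by split; [exists (p 1 - B / 1); exists 1 => //=|exists (p 1 + B / 1); exact: ub].
exists (sup S) => z z1; rewrite ler_norml; apply/andP; split.
  by have := @ge_sup _ S _ hs.1 (ub z z1); lra.
have : p z - B / z <= sup S by apply: ub_le_sup; [case: hs|exists z].
by lra.
Qed.

End real_calculus.

(** * Power series with factorially decaying coefficients *)

Section entire_series.
Variable R : realType.

(** The factor 2^m absorbs the bound m + (a+1)/2 >= 1/2 in the recursion [bcoefS]. The class is
    closed under [pseries_diffs], so its series may be differentiated termwise repeatedly. *)
Definition fact_bounded (c : R^nat) := exists C : R, forall m, `|c m| <= C * 2 ^+ m / m`!%:R.

Lemma fact_bounded_cvg c (K : R) : fact_bounded c -> cvgn (pseries c K).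
Proof.
move=> [C hC].
have C0 : 0 <= C by have := hC 0; rewrite expr0 fact0 mulr1 divr1; apply: le_trans.
apply: normed_cvg; apply: (@series_le_cvg _ _ (C *: exp_coeff (2 * `|K|))).
- by move=> n; exact: normr_ge0.
- by move=> n; rewrite mulr_ge0// divr_ge0// exprn_ge0// mulr_ge0.
- move=> n /=; rewrite normrM normrX /exp_coeff/=.
  rewrite [leRHS](_ : _ = C * 2 ^+ n / n`!%:R * `|K| ^+ n); last first.
    rewrite (_ : _ n = C * ((2 * `|K|) ^+ n / n`!%:R))// exprMn.
    by field; rewrite pnatr_eq0 -lt0n fact_gt0.
  by rewrite ler_wpM2r ?exprn_ge0.
- by apply: is_cvg_seriesZ; exact: is_cvg_series_exp_coeff.
Qed.

Lemma fact_bounded_diffs c : fact_bounded c -> fact_bounded (pseries_diffs c).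
Proof.
move=> [C hC]; exists (2 * C) => m.
rewrite /pseries_diffs normrM normr_nat.
have := hC m.+1; rewrite factS natrM exprS => h.
apply: le_trans (ler_wpM2l _ h) _ => //.
rewrite le_eqVlt; apply/orP; left; apply/eqP; field.
by rewrite pnatr_eq0 -lt0n fact_gt0/= nat1r pnatr_eq0.
Qed.

Lemma is_derive_pseries c (x : R) : fact_bounded c ->
  is_derive x 1 (fun w => limn (pseries c w)) (limn (pseries (pseries_diffs c) x)).
Proof.
move=> hc; apply: (@pseries_snd_diffs _ _ (`|x| + 1)).
- exact: fact_bounded_cvg.
- exact/fact_bounded_cvg/fact_bounded_diffs.
- exact/fact_bounded_cvg/fact_bounded_diffs/fact_bounded_diffs.
- by rewrite [ltRHS]ger0_norm ?ltrDl// addr_ge0.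
Qed.

End entire_series.

Lemma natr_add_half_gt0 (R : realType) (a : R) m : 0 <= a -> 0 < m%:R + (a - 1) / 2 + 1.
Proof. by move=> a0; have := ler0n R m; move: (m%:R) => r r0; lra. Qed.

(** * The entire factor of the Bessel function: equation, bound and asymptotics *)

Section bessel.
Variable R : realType.
Variable a : R.
Hypothesis a0 : 0 <= a.

(* BesselJ_bphi: z^(-nu) J_nu(z) = 2^(-nu) bphi(z^2/4) with nu = (a-1)/2; bphi1 and
   bphi2 are the first two derivatives of bphi. *)
Definition bcoef (m : nat) : R := (-1) ^+ m / (m`!%:R * GammaR (m%:R + (a - 1) / 2 + 1)).
Definition bphi (w : R) : R := limn (pseries bcoef w).
Definition bphi1 (w : R) : R := limn (pseries (pseries_diffs bcoef) w).
Definition bphi2 (w : R) : R := limn (pseries (pseries_diffs (pseries_diffs bcoef)) w).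

Let Gpos m : 0 < GammaR (m%:R + (a - 1) / 2 + 1).
Proof. by apply: GammaR_gt0; exact: natr_add_half_gt0. Qed.

Lemma bcoefS m : bcoef m = - (m.+1%:R * (m%:R + (a + 1) / 2) * bcoef m.+1).
Proof.
rewrite /bcoef.
have -> : m.+1%:R + (a - 1) / 2 + 1 = m%:R + (a - 1) / 2 + 1 + 1 :> R by rewrite -natr1; ring.
rewrite (@GammaRS _ (m%:R + (a - 1) / 2 + 1)); last exact: natr_add_half_gt0.
rewrite factS natrM exprS.
have -> : m%:R + (a + 1) / 2 = m%:R + (a - 1) / 2 + 1 :> R by field.
have := Gpos m; have := natr_add_half_gt0 m a0.
set x := m%:R + _ + _; set G := GammaR x => x0 G0.
by field; rewrite (gt_eqF G0) (gt_eqF x0) nat1r !pnatr_eq0 -lt0n fact_gt0.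
Qed.

Lemma bcoef_bounded : fact_bounded bcoef.
Proof.
exists `|bcoef 0|; elim=> [|m IH]; first by rewrite expr0 fact0 mulr1 divr1.
have h0 : 2^-1 <= m%:R + (a + 1) / 2 :> R.
  rewrite -subr_ge0; have -> : m%:R + (a + 1) / 2 - 2^-1 = m%:R + a / 2 :> R by field.
  by rewrite addr_ge0// divr_ge0.
have h1 : 0 <= m%:R + (a + 1) / 2 :> R by apply: le_trans h0; rewrite invr_ge0.
have E : `|bcoef m| = m.+1%:R * (m%:R + (a + 1) / 2) * `|bcoef m.+1|.
  by rewrite bcoefS normrN normrM ger0_norm// mulr_ge0.
rewrite E in IH.
have h2 : m.+1%:R * 2^-1 * `|bcoef m.+1| <= m.+1%:R * (m%:R + (a + 1) / 2) * `|bcoef m.+1|.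
  by rewrite ler_wpM2r// ler_wpM2l.
have := le_trans h2 IH.
rewrite factS natrM exprS -ler_pdivlMl; last by rewrite divr_gt0.
move=> /le_trans; apply; rewrite le_eqVlt; apply/orP; left; apply/eqP; field.
by rewrite pnatr_eq0 -lt0n fact_gt0/= nat1r pnatr_eq0.
Qed.

Lemma der_bphi (x : R) : is_derive x 1 bphi (bphi1 x).
Proof. exact: is_derive_pseries bcoef_bounded. Qed.

Lemma der_bphi1 (x : R) : is_derive x 1 bphi1 (bphi2 x).
Proof. exact: is_derive_pseries (fact_bounded_diffs bcoef_bounded). Qed.

(** The coefficient of w^m in the equation is the recursion [bcoefS], so the partial sums already
    vanish identically. *)
Lemma bphi_ode w : w * bphi2 w + (a + 1) / 2 * bphi1 w + bphi w = 0.
Proof.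
have h2 := pseries_diffs_equiv (@fact_bounded_cvg _ _ w (fact_bounded_diffs (fact_bounded_diffs bcoef_bounded))).
have h1 := @fact_bounded_cvg _ _ w (fact_bounded_diffs bcoef_bounded).
have h0 := @fact_bounded_cvg _ _ w bcoef_bounded.
have h : (fun n => w * series (fun i => i%:R * pseries_diffs bcoef i * w ^+ i.-1) n
    + (a + 1) / 2 * pseries (pseries_diffs bcoef) w n + pseries bcoef w n) @ \oo -->
    w * bphi2 w + (a + 1) / 2 * bphi1 w + bphi w.
  apply: cvgD; last exact: h0.
  by apply: cvgD; apply: cvgM; [exact: cvg_cst|exact: h2|exact: cvg_cst|exact: h1].
have : (fun n => 0 : R) @ \oo --> w * bphi2 w + (a + 1) / 2 * bphi1 w + bphi w.
  apply: cvg_trans h; apply: near_eq_cvg; near=> n => /=.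
  rewrite /pseries /series/= !mulr_sumr -!big_split/=; apply: big1 => i _.
  rewrite /pseries_diffs (bcoefS i).
  case: i => [|i]; first by rewrite /= !expr0; ring.
  by rewrite /= exprS; ring.
by move=> /(cvg_lim _) => <- //; rewrite lim_cst.
Unshelve. all: by end_near. Qed.

(** By the equation, the energy [bphi w ^+ 2 + w * bphi1 w ^+ 2] has derivative
    [- a * bphi1 w ^+ 2]: the sign of [a] makes it decrease. Its second term vanishes at 0. *)
Lemma bphi_bounded w : 0 <= w -> `|bphi w| <= `|bphi 0|.
Proof.
move=> w0; rewrite -ler_sqr ?nnegrE// !real_normK ?num_real//.
have : bphi w ^+ 2 + w * bphi1 w ^+ 2 <= bphi 0 ^+ 2 + 0 * bphi1 0 ^+ 2.
  apply: (@der_le0_nonincr _ (fun w => bphi w ^+ 2 + w * bphi1 w ^+ 2) (fun w => - a * bphi1 w ^+ 2)) => //.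
    move=> z _; have := der_bphi z; have := der_bphi1 z => d1 d0.
    notypeclasses refine (der_eq _ _); first by der.
    have := bphi_ode z => /eqP; rewrite -addrA addr_eq0 => /eqP E.
    rewrite /=.
    transitivity (2 * bphi z * bphi1 z + bphi1 z ^+ 2 + 2 * bphi1 z * (z * bphi2 z)); first by ring.
    by rewrite E; field.
  by move=> z _; rewrite mulNr oppr_le0 mulr_ge0// sqr_ge0.
rewrite mul0r addr0; have := mulr_ge0 w0 (sqr_ge0 (bphi1 w)); lra.
Qed.

Lemma BesselJ_bphi z : 0 < z ->
  z `^ ((1 - a) / 2) * BesselJ ((a - 1) / 2) z = 2 `^ ((1 - a) / 2) * bphi (z ^+ 2 / 4).
Proof.
move=> z0; rewrite /BesselJ /bphi.
set nu := (a - 1) / 2.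
have -> : (1 - a) / 2 = - nu by rewrite /nu; field.
have -> : limn (series (fun m : nat => (-1) ^+ m / (m`!%:R * GammaR (m%:R + nu + 1)) * (z / 2) `^ (2 * m%:R + nu)))
   = (z / 2) `^ nu * limn (pseries bcoef (z ^+ 2 / 4)).
  have h := @fact_bounded_cvg _ _ (z ^+ 2 / 4) bcoef_bounded.
  apply/cvg_lim => //.
  have h' : (fun n => (z / 2) `^ nu * pseries bcoef (z ^+ 2 / 4) n) @ \oo -->
      (z / 2) `^ nu * limn (pseries bcoef (z ^+ 2 / 4)).
    by apply: cvgM; [exact: cvg_cst|exact: h].
  apply: cvg_trans h'; apply: near_eq_cvg; near=> n => /=.
  rewrite /pseries /series/= mulr_sumr; apply: eq_bigr => m _.
  rewrite /bcoef -/nu powRD; last by rewrite (gt_eqF (divr_gt0 z0 _))// implybT.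
  rewrite powRrM powR_mulrn ?powR_ge0// powR_mulrn ?divr_ge0 ?(ltW z0)//.
  have -> : (z / 2) ^+ 2 = z ^+ 2 / 4 by field.
  ring.
rewrite powRM ?(ltW z0)// -powR_inv1// -powRrM mulN1r mulrA.
rewrite mulrA -powRD ?addNr ?powRr0 ?mul1r//.
by rewrite (gt_eqF z0) implybT.
Unshelve. all: by end_near. Qed.

Let h : R := a / 2.
Definition bk (z : R) : R := z `^ h * bphi (z ^+ 2 / 4).
Definition bk1 (z : R) : R := z `^ h * (h / z * bphi (z ^+ 2 / 4) + z / 2 * bphi1 (z ^+ 2 / 4)).

Lemma der_powR_div (z : R) : 0 < z -> is_derive z 1 (fun y : R => y `^ h) (h * (z `^ h / z)).
Proof.
move=> z0; notypeclasses refine (der_eq _ _); first by der.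
by rewrite mulr1 powRB ?powRr1 ?(ltW z0)// (gt_eqF z0) implybT.
Qed.

Lemma der_bk (z : R) : 0 < z -> is_derive z 1 bk (bk1 z).
Proof.
move=> z0; have dp := der_powR_div z0; rewrite /bk.
have d0 : is_derive z 1 (fun y : R => bphi (y ^+ 2 / 4)) (bphi1 (z ^+ 2 / 4) * (z / 2)).
  apply: der_comp; first exact: der_bphi.
  by notypeclasses refine (der_eq _ _); [der|rewrite /=; field].
notypeclasses refine (der_eq _ _); first by der.
by rewrite /bk1; field; rewrite gt_eqF.
Qed.

Lemma der_bk1 (z : R) : 0 < z ->
  is_derive z 1 bk1 (- bk z + h * (h - 1) / z ^+ 2 * bk z).
Proof.
move=> z0; have dp := der_powR_div z0; rewrite /bk1.
have d0 : is_derive z 1 (fun y : R => bphi (y ^+ 2 / 4)) (bphi1 (z ^+ 2 / 4) * (z / 2)).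
  apply: der_comp; first exact: der_bphi.
  by notypeclasses refine (der_eq _ _); [der|rewrite /=; field].
have d1 : is_derive z 1 (fun y : R => bphi1 (y ^+ 2 / 4)) (bphi2 (z ^+ 2 / 4) * (z / 2)).
  apply: der_comp; first exact: der_bphi1.
  by notypeclasses refine (der_eq _ _); [der|rewrite /=; field].
notypeclasses refine (der_eq _ _); first by der; rewrite gt_eqF.
have E : bphi (z ^+ 2 / 4) = - (z ^+ 2 / 4 * bphi2 (z ^+ 2 / 4) + (a + 1) / 2 * bphi1 (z ^+ 2 / 4)).
  by apply/eqP; rewrite -addr_eq0 addrC; apply/eqP; exact: bphi_ode.
by rewrite /bk /= E /h; field; rewrite gt_eqF.
Qed.

(** Gronwall's argument in closed form. For E = k^2 + k'^2 the equation gives E' = 2 h (h-1) k k' /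
    z^2 <= (c/z^2) E, because 2 |k k'| <= E; hence E e^(c/z) decreases on [1, oo). *)
Lemma bk_bounded : exists M : R, forall z, 1 <= z -> `|bk z| <= M.
Proof.
pose c : R := `|h * (h - 1)|.
pose E z : R := bk z ^+ 2 + bk1 z ^+ 2.
have E0 z : 0 <= E z by rewrite addr_ge0 ?sqr_ge0.
exists (1 + E 1 * expR c) => z z1.
have : E z * expR (c / z) <= E 1 * expR (c / 1).
  apply: (@der_le0_nonincr _ (fun z => E z * expR (c / z))
    (fun z => expR (c / z) * (2 * (h * (h - 1)) / z ^+ 2 * (bk z * bk1 z) - c / z ^+ 2 * E z))) => //.
    move=> y /andP[y1 _]; have y0 : 0 < y by lra.
    have d0 := der_bk y0; have d1 := der_bk1 y0; rewrite /E.
    notypeclasses refine (der_eq _ _); first by der; rewrite gt_eqF.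
    by rewrite /=; field; rewrite gt_eqF.
  move=> y /andP[y1 _]; have y0 : 0 < y by lra.
  rewrite pmulr_rle0 ?expR_gt0// subr_le0.
  have t : h * (h - 1) * (2 * (bk y * bk1 y)) <= c * E y.
    apply: le_trans (ler_norm _) _; rewrite normrM ler_wpM2l// ler_norml /E.
    have := sqr_ge0 (bk y + bk1 y); have := sqr_ge0 (bk y - bk1 y).
    by move: (bk y) (bk1 y) => u v; nra.
  rewrite (_ : _ * _ = h * (h - 1) * (2 * (bk y * bk1 y)) / y ^+ 2); last by field; rewrite gt_eqF.
  by rewrite [leRHS]mulrAC ler_wpM2r ?invr_ge0 ?exprn_ge0 ?(ltW y0).
rewrite divr1 => hE.
have c0 : 0 <= c by exact: normr_ge0.
have z0 : 0 <= z by lra.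
have e1 : 1 <= expR (c / z) by apply: le_trans (expR_ge1Dx _); rewrite lerDl divr_ge0.
have : E z <= E 1 * expR c by apply: le_trans hE; rewrite ler_peMr.
have : `|bk z| <= 1 + bk z ^+ 2.
  rewrite -(@real_normK _ (bk z)) ?num_real//; have := sqr_ge0 (`|bk z| - 2^-1).
  by have := normr_ge0 (bk z); set t := `|bk z| => t0; nra.
by have := sqr_ge0 (bk1 z); rewrite /E; lra.
Qed.

(** Variation of constants. With g = k'' + k = O(z^(-2)), the combinations k cos - k' sin and k sin
    + k' cos have derivatives - g sin and g cos. They therefore converge at rate 1/z to [al] and
    [be], and rotating back recovers k. *)
Lemma bk_asymptotics : exists al be M : R, forall z : R, 0 < z ->
  `|bk z - (al * cos z + be * sin z)| <= M / (1 + z).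
Proof.
have [M hM] := bk_bounded.
pose c : R := `|h * (h - 1)|.
pose g y : R := h * (h - 1) / y ^+ 2 * bk y.
have hg y : 1 <= y -> `|g y| <= c * M / y ^+ 2.
  move=> y1; rewrite /g normrM normrM -/c normfV normrX (@ger0_norm _ y); last by lra.
  by rewrite mulrAC ler_wpM2r ?invr_ge0 ?exprn_ge0//; [lra|rewrite ler_wpM2l ?hM// normr_ge0].
have gb y (t : R) : 1 <= y -> `|t| <= 1 -> `|g y * t| <= c * M / y ^+ 2.
  by move=> y1 t1; rewrite normrM; apply: le_trans (hg _ y1); rewrite ler_piMr.
have [al hal] : exists al : R, forall z, 1 <= z ->
    `|(bk z * cos z - bk1 z * sin z) - al| <= c * M / z.
  apply: (@der_inv_sqr_cvg _ _ (fun y => g y * - sin y)).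
    move=> z z1; have z0 : 0 < z by lra.
    have d0 := der_bk z0; have d1 := der_bk1 z0.
    notypeclasses refine (der_eq _ _); first by der.
    by rewrite /g /=; ring.
  by move=> z z1; apply: gb => //; rewrite normrN ler_norml sin_geN1 sin_le1.
have [be hbe] : exists be : R, forall z, 1 <= z ->
    `|(bk z * sin z + bk1 z * cos z) - be| <= c * M / z.
  apply: (@der_inv_sqr_cvg _ _ (fun y => g y * cos y)).
    move=> z z1; have z0 : 0 < z by lra.
    have d0 := der_bk z0; have d1 := der_bk1 z0.
    notypeclasses refine (der_eq _ _); first by der.
    by rewrite /g /=; ring.
  by move=> z z1; apply: gb => //; rewrite ler_norml cos_geN1 cos_le1.
have cM : 0 <= c * M by have := hal 1 (lexx _); rewrite divr1; apply: le_trans.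
(* The first summand serves z >= 1, where two errors c M / z add up and 1 + z <= 2 z; the second
   serves z < 1, where 1 + z < 2 and every term is bounded. *)
exists al, be, (4 * (c * M) + 2 * (`|bphi 0| + `|al| + `|be|)) => z z0.
have cos1 : `|cos z| <= 1 by rewrite ler_norml cos_geN1 cos_le1.
have sin1 : `|sin z| <= 1 by rewrite ler_norml sin_geN1 sin_le1.
rewrite ler_pdivlMr; last by lra.
have [z1|z1] := leP 1 z.
  have -> : bk z - (al * cos z + be * sin z) =
      (bk z * cos z - bk1 z * sin z - al) * cos z + (bk z * sin z + bk1 z * cos z - be) * sin z.
    by rewrite -{1}[bk z]mulr1 -(cos2Dsin2 z); ring.
  set p := _ - al; set q := _ - be.
  have hp : `|p * cos z| <= c * M / z by rewrite normrM; apply: le_trans (hal _ z1); rewrite ler_piMr.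
  have hq : `|q * sin z| <= c * M / z by rewrite normrM; apply: le_trans (hbe _ z1); rewrite ler_piMr.
  have hpq : `|p * cos z + q * sin z| <= 2 * (c * M) / z.
    by apply: le_trans (ler_normD _ _) _; rewrite -mulrA (_ : 2 * _ = c * M / z + c * M / z) ?lerD//; ring.
  apply: (@le_trans _ _ (2 * (c * M) / z * (2 * z))).
    by apply: ler_pM => //; lra.
  rewrite (_ : 2 * (c * M) / z * (2 * z) = 4 * (c * M)); last by field; rewrite gt_eqF.
  by rewrite lerDl mulr_ge0 ?addr_ge0.
apply: (@le_trans _ _ ((`|bphi 0| + `|al| + `|be|) * 2)).
  apply: ler_pM => //; [lra| |lra].
  apply: le_trans (ler_normB _ _) _; rewrite -addrA lerD//.
    rewrite /bk normrM ger0_norm ?powR_ge0//.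
    apply: (@le_trans _ _ (1 * `|bphi (z ^+ 2 / 4)|)).
      rewrite ler_wpM2r//; apply: (@le_trans _ _ (1 `^ h)); last by rewrite powR1.
      by apply: ge0_ler_powR; rewrite ?nnegrE /h ?divr_ge0//; lra.
    by rewrite mul1r bphi_bounded// divr_ge0// exprn_ge0//; lra.
  apply: le_trans (ler_normD _ _) _; rewrite !normrM.
  by apply: lerD; rewrite ler_piMr.
by rewrite mulrC lerDr mulr_ge0.
Qed.

End bessel.

(** * Half-line integrals, Fubini for bounded kernels, the Hoelder inequality *)

Section halfline.
Variable R : realType.
Local Notation leb := (@lebesgue_measure R).
Local Notation pos := `]0%R, +oo[%classic.

(* Integrals over the half line are written over the whole line with the indicator
   [ip], so that measurability and Fubini are only ever used on [setT]. *)
Definition ip (x : R) : R := (0 < x)%R%:R.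

Lemma ip_ge0 x : 0 <= ip x. Proof. exact: ler0n. Qed.
Lemma ip1 x : 0 < x -> ip x = 1. Proof. by rewrite /ip => ->. Qed.
Lemma ip0 x : x <= 0 -> ip x = 0. Proof. by rewrite /ip leNgt; case: (0 < x). Qed.

Lemma meas_ip : measurable_fun setT ip.
Proof. by rewrite /ip; mea. Qed.

Lemma integral_pos (f : R -> R) :
  (\int[leb]_(x in pos) (f x)%:E = \int[leb]_x (ip x * f x)%:E)%E.
Proof.
rewrite integral_mkcond; apply: eq_integral => x _.
rewrite patchE; case: ifPn.
  by rewrite inE/= in_itv/= andbT => x0; rewrite ip1// mul1r.
rewrite notin_setE/= in_itv/= andbT => /negP; rewrite -leNgt => x0.
by rewrite ip0// mul0r.
Qed.

Lemma integrable_bdd_mul (f k : R -> R) (M : R) : leb.-integrable setT (EFin \o f) ->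
  measurable_fun setT k -> (forall x, `|k x| <= M) ->
  leb.-integrable setT (EFin \o (fun x => f x * k x)).
Proof.
move=> fi mk kM.
have := @integrableMl _ _ _ leb setT measurableT (EFin \o f) k fi mk.
apply; exists M; split; first exact: num_real.
by move=> x Mx y _ /=; apply: le_trans (kM y) (ltW Mx).
Qed.

Lemma integrable_scale (c : R) (f : R -> R) : leb.-integrable setT (EFin \o f) ->
  leb.-integrable setT (EFin \o (fun x => c * f x)).
Proof.
move=> fi; rewrite (_ : (fun x => c * f x) = fun x => f x * cst c x).
  exact: (integrable_bdd_mul (M := `|c|)).
by apply/funext => x; rewrite mulrC.
Qed.

Lemma norm_Rintegral_bdd_mul (f k : R -> R) (M : R) : leb.-integrable setT (EFin \o f) ->
  measurable_fun setT k -> (forall x, `|k x| <= M) ->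
  `|Rintegral leb setT (fun x => f x * k x)| <= Rintegral leb setT (fun x => `|f x|) * M.
Proof.
move=> fi mk kM.
apply: le_trans (le_normr_Rintegral _ _) _ => //; first exact: integrable_bdd_mul fi mk kM.
rewrite -RintegralZr//; last exact: integrable_norm.
apply: le_Rintegral => //.
- by apply: integrable_norm => //; exact: integrable_bdd_mul fi mk kM.
- by apply: (@integrable_bdd_mul (fun x => `|f x|) (cst M) `|M|) => //; exact: integrable_norm.
by move=> x _; rewrite normrM ler_wpM2l.
Qed.

Lemma fubini_kernel (u v : R -> R) (k : R -> R -> R) (M : R) :
  leb.-integrable setT (EFin \o u) -> leb.-integrable setT (EFin \o v) ->
  measurable_fun setT (fun p : R * R => k p.1 p.2) -> (forall x y, `|k x y| <= M) ->
  Rintegral leb setT (fun x => u x * Rintegral leb setT (fun y => v y * k x y)) =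
  Rintegral leb setT (fun y => v y * Rintegral leb setT (fun x => u x * k x y)).
Proof.
move=> iu iv mk kM.
have mu : measurable_fun setT u by apply/measurable_EFinP; case/integrableP : iu.
have mv : measurable_fun setT v by apply/measurable_EFinP; case/integrableP : iv.
have M0 : 0 <= M by apply: le_trans (kM 0 0).
pose f (p : R * R) := (u p.1 * v p.2 * k p.1 p.2)%:E.
have mf : measurable_fun setT f by rewrite /f; mea.
have fi : (leb \x leb)%E.-integrable setT f.
  apply/integrable12ltyP => //.
  have h1 : (\int[leb]_x `|(u x)%:E| < +oo)%E by case/integrableP : iu.
  have h2 : (\int[leb]_x `|(v x)%:E| < +oo)%E by case/integrableP : iv.
  apply: (@le_lt_trans _ _ (\int[leb]_x (`|(u x)%:E| * (M%:E * \int[leb]_y `|(v y)%:E|)))%E).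
    apply: le_ge0_integral => x _; first exact: integral_ge0.
    rewrite -ge0_integralZl_EFin//; last by apply: measurableT_comp => //; exact: meas_EFin.
    rewrite -ge0_integralZl//; last 2 first.
    - by apply: (@meas_EFin _ _ _ (fun y => M * `|v y|)); mea.
    - by move=> y _; rewrite mule_ge0.
    apply: le_ge0_integral => y _ //=.
    by rewrite lee_fin !normrM -mulrA ler_wpM2l// mulrC ler_wpM2r.
  rewrite ge0_integralZr//; last by rewrite mule_ge0//; exact: integral_ge0.
    rewrite lte_mul_pinfty//; first exact: integral_ge0.
      by rewrite ge0_fin_numE//; exact: integral_ge0.
    rewrite lte_mul_pinfty//.
  by apply: (@meas_EFin _ _ _ (fun y => `|u y|)); mea.
have h1 : Rintegral leb setT (fun x => u x * Rintegral leb setT (fun y => v y * k x y)) =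
    fine (\int[leb]_x \int[leb]_y f (x, y))%E.
  congr fine; apply: eq_integral => x _.
  rewrite -RintegralZl//; last first.
    apply: (integrable_bdd_mul (M := M) iv) => [|y]; last exact: kM.
    by apply: (@meas_comp2 _ _ _ k (cst x) id).
  rewrite /Rintegral fineK; first by apply: eq_integral => y _; rewrite /f/= mulrA.
  apply: integrable_fin_num => //.
  apply: integrable_scale; apply: (integrable_bdd_mul (M := M) iv) => [|y]; last exact: kM.
  by apply: (@meas_comp2 _ _ _ k (cst x) id).
rewrite h1 (Fubini fi); congr fine; apply: eq_integral => y _.
rewrite -RintegralZl//; last first.
  apply: (integrable_bdd_mul (M := M) iu) => [|x]; last exact: kM.
  by apply: (@meas_comp2 _ _ _ k id (cst y)).
rewrite /Rintegral fineK; first by apply: eq_integral => x _; rewrite /f/=; congr EFin; ring.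
apply: integrable_fin_num => //.
apply: integrable_scale; apply: (integrable_bdd_mul (M := M) iu) => [|x]; last exact: kM.
by apply: (@meas_comp2 _ _ _ k id (cst y)).
Qed.

Lemma ge0_hoelder (f g : R -> R) (p q : R) : measurable_fun setT f -> measurable_fun setT g ->
  (forall x, 0 <= f x) -> (forall x, 0 <= g x) -> 0 < p -> 0 < q -> p^-1 + q^-1 = 1 ->
  (\int[leb]_x (f x * g x)%:E <=
   poweR (\int[leb]_x (f x `^ p)%:E) p^-1 * poweR (\int[leb]_x (g x `^ q)%:E) q^-1)%E.
Proof.
move=> mf mg f0 g0 p0 q0 pq.
have := @hoelder _ _ _ leb f g p q mf mg p0 q0 pq.
rewrite Lnorm1 unlock /=.
rewrite (_ : (\int[leb]_x `|(f x * g x)%:E|)%E = (\int[leb]_x (f x * g x)%:E)%E); last first.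
  by apply: eq_integral => x _; rewrite /= ger0_norm ?mulr_ge0.
rewrite (_ : (fun x => (`|(f x)%:E| `^ p)%E) = fun x => (f x `^ p)%:E); last first.
  by apply/funext => x; rewrite /= ger0_norm// poweR_EFin.
rewrite (_ : (fun x => (`|(g x)%:E| `^ q)%E) = fun x => (g x `^ q)%:E)//.
by apply/funext => x; rewrite /= ger0_norm// poweR_EFin.
Qed.

Lemma cauchy_schwarz (f g : R -> R) : measurable_fun setT f -> measurable_fun setT g ->
  (forall x, 0 <= f x) -> (forall x, 0 <= g x) ->
  (poweR (\int[leb]_x (f x * g x)%:E) 2 <=
   \int[leb]_x (f x ^+ 2)%:E * \int[leb]_x (g x ^+ 2)%:E)%E.
Proof.
move=> mf mg f0 g0.
have h := @ge0_hoelder f g 2 2 mf mg f0 g0 (ltr0n _ _) (ltr0n _ _).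
have E (k : R -> R) : (forall x, 0 <= k x) -> (fun x => (k x `^ 2)%:E) = fun x => (k x ^+ 2)%:E.
  by move=> k0; apply/funext => x; rewrite powR_mulrn.
rewrite (E _ f0) (E _ g0) in h.
have h2 : ((2 : R)^-1 + 2^-1 = 1)%R by field.
have If : (0 <= \int[leb]_x (f x ^+ 2)%:E)%E by apply: integral_ge0 => x _; rewrite lee_fin sqr_ge0.
have Ig : (0 <= \int[leb]_x (g x ^+ 2)%:E)%E by apply: integral_ge0 => x _; rewrite lee_fin sqr_ge0.
have := gt0_ler_poweR (ler0n R 2) _ _ (h h2).
rewrite poweRM ?poweR_ge0// -!poweRrM mulVf ?pnatr_eq0// !poweRe1//.
apply.
  by rewrite in_itv/= leey andbT; apply: integral_ge0 => x _; rewrite lee_fin mulr_ge0.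
by rewrite in_itv/= leey andbT mule_ge0 ?poweR_ge0.
Qed.

End halfline.

(** * Square-integrability of the Hankel transform *)

Section poisson.
Variable R : realType.
Local Notation leb := (@lebesgue_measure R).

Lemma cvg_expRN_scale (eps : R) : 0 < eps -> expR (- (eps * x)) @[x --> +oo] --> (0 : R).
Proof.
move=> e0; apply: (@squeeze_cvgr _ _ _ _ (cst 0) (fun x => eps^-1 * x^-1)).
- near=> x; have x0 : 0 < x by near: x; exact: nbhs_pinfty_gt.
  rewrite expR_ge0/= expRN -invfM lef_pV2 ?posrE ?mulr_gt0 ?expR_gt0//.
  by rewrite [leLHS]mulrC; apply: le_trans (expR_ge1Dx _); rewrite [x * eps]mulrC lerDr.
- exact: cvg_cst.
- have h : (fun x : R => x^-1) @ +oo --> (0 : R).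
    by apply/gtr0_cvgV0; [near=> x; near: x; exact: nbhs_pinfty_gt|exact: cvg_id].
  by have h' := cvgM (cvg_cst (eps^-1)) h; rewrite mulr0 in h'; exact: h'.
Unshelve. all: by end_near. Qed.

(** The condition on [c0] keeps the integrand nonnegative, within reach of [ge0_FTC_eq]. The
    transform of the cosine alone follows in [damp_cos] by subtracting the case c1 = 0 from the case
    c1 = 1. *)
Lemma laplace_trig (eps b c0 c1 : R) : 0 < eps -> `|c1| <= c0 ->
  (\int[leb]_x (ip x * (expR (- (eps * x)) * (c0 + c1 * cos (b * x))))%:E =
   (c0 / eps + c1 * (eps / (eps ^+ 2 + b ^+ 2)))%:E)%E.
Proof.
move=> e0 c10; rewrite -integral_pos.
have d0 : 0 < eps ^+ 2 + b ^+ 2 by rewrite ltr_pwDl ?exprn_gt0 ?sqr_ge0.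
pose g (x : R) := - (c0 / eps) + c1 * ((b * sin (b * x) - eps * cos (b * x)) / (eps ^+ 2 + b ^+ 2)).
pose F (x : R) := expR (- (eps * x)) * g x.
have dF (x : R) : is_derive x 1 F (expR (- (eps * x)) * (c0 + c1 * cos (b * x))).
  rewrite /F /g; notypeclasses refine (der_eq _ _); first by der.
  by rewrite /=; field; rewrite (gt_eqF d0) (gt_eqF e0).
have -> : c0 / eps + c1 * (eps / (eps ^+ 2 + b ^+ 2)) = 0 - F 0.
  by rewrite /F /g !mulr0 oppr0 expR0 cos0 sin0; ring.
apply: (@ge0_FTC_eq _ _ F).
- move=> x x0; rewrite mulr_ge0 ?expR_ge0//.
  have : `|c1 * cos (b * x)| <= c0.
    by rewrite normrM; apply: le_trans c10; rewrite ler_piMr// ler_norml cos_geN1 cos_le1.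
  by rewrite ler_norml => /andP[]; lra.
- move=> x x0; apply: continuousM.
    by apply: der_continuous; notypeclasses refine (der_eq _ (erefl _)); der.
  by apply: der_continuous; notypeclasses refine (der_eq _ (erefl _)); der.
- by apply: cvg_at_right_filter; exact: (der_continuous (dF 0)).
pose K := `|c0 / eps| + `|c1| * ((`|b| + eps) / (eps ^+ 2 + b ^+ 2)).
have hg x : `|g x| <= K.
  apply: le_trans (ler_normD _ _) _; rewrite normrN lerD// normrM ler_wpM2l//.
  rewrite normrM normfV (ger0_norm (ltW d0)) ler_wpM2r ?invr_ge0 ?(ltW d0)//.
  apply: le_trans (ler_normB _ _) _; rewrite !normrM (ger0_norm (ltW e0)) lerD//.
    by rewrite ler_piMr// ler_norml sin_geN1 sin_le1.
  by rewrite ler_piMr// ?(ltW e0)// ler_norml cos_geN1 cos_le1.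
have h := cvg_expRN_scale e0.
apply: (@squeeze_cvgr _ _ _ _ (fun x => - (expR (- (eps * x)) * K)) (fun x => expR (- (eps * x)) * K)).
- near=> x; rewrite -ler_norml /F normrM (ger0_norm (expR_ge0 _)).
  by rewrite ler_wpM2l ?expR_ge0.
- rewrite -oppr0; apply: cvgN; rewrite -[X in _ --> X](mul0r K).
  by apply: cvgM => //; exact: cvg_cst.
- by rewrite -[X in _ --> X](mul0r K); apply: cvgM => //; exact: cvg_cst.
Unshelve. all: by end_near. Qed.

Definition damp (eps x : R) : R := ip x * expR (- (eps * x)).

Lemma damp_ge0 eps x : 0 <= damp eps x.
Proof. by rewrite mulr_ge0 ?ip_ge0 ?expR_ge0. Qed.

Lemma meas_damp eps : measurable_fun setT (damp eps).
Proof. by rewrite /damp /ip; mea. Qed.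

Lemma damp_integral eps : 0 < eps -> (\int[leb]_x (damp eps x)%:E = (eps^-1)%:E)%E.
Proof.
move=> e0; have := @laplace_trig eps 0 1 0 e0.
rewrite normr0 ler01 => /(_ isT); rewrite mul0r addr0 mul1r => <-.
by apply: eq_integral => x _; rewrite /damp mul0r addr0 mulr1.
Qed.

Lemma damp_integrable eps : 0 < eps -> leb.-integrable setT (EFin \o damp eps).
Proof.
move=> e0; apply/integrableP; split; first by apply/measurable_EFinP; exact: meas_damp.
rewrite (_ : (\int[leb]_x `|(EFin \o damp eps) x|)%E = (eps^-1)%:E) ?ltry//.
by rewrite -damp_integral//; apply: eq_integral => x _; rewrite /= ger0_norm ?damp_ge0.
Qed.

Lemma damp_cos eps b : 0 < eps ->
  Rintegral leb setT (fun x => damp eps x * cos (b * x)) = eps / (eps ^+ 2 + b ^+ 2).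
Proof.
move=> e0.
have mc : measurable_fun setT (fun x : R => cos (b * x)) by mea.
have c1 (x : R) : `|cos (b * x)| <= 1 by rewrite ler_norml cos_geN1 cos_le1.
have i1 := integrable_bdd_mul (damp_integrable e0) mc c1.
have h : Rintegral leb setT (fun x => damp eps x + damp eps x * cos (b * x)) =
    eps^-1 + eps / (eps ^+ 2 + b ^+ 2).
  have := @laplace_trig eps b 1 1 e0; rewrite normr1 lexx => /(_ isT); rewrite !mul1r => E.
  rewrite /Rintegral -[RHS]/(fine (_)%:E) -E; congr fine; apply: eq_integral => x _.
  by rewrite /damp; congr EFin; ring.
move: h; rewrite RintegralD//; last exact: damp_integrable.
rewrite {1}/Rintegral damp_integral//= => /addrI; exact.
Qed.

End poisson.

(** By the arithmetic-geometric mean inequality, |G y| |G z| P is at most half of (G y)^2 P plus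
    half of (G z)^2 P; by symmetry and Tonelli the two halves have the same integral. *)
Lemma schur_symmetric (R : realType) (P : R -> R -> R) (G : R -> R) (M : R) :
  measurable_fun setT (fun p : R * R => P p.1 p.2) -> (forall y z, 0 <= P y z) ->
  (forall y z, P y z = P z y) ->
  (forall y, (\int[@lebesgue_measure R]_z (ip z * P y z)%:E <= M%:E)%E) ->
  measurable_fun setT G -> (forall y, y <= 0 -> G y = 0) ->
  (\int[@lebesgue_measure R]_y \int[@lebesgue_measure R]_z (`|G y| * (`|G z| * P y z))%:E <=
   M%:E * \int[@lebesgue_measure R]_y (G y ^+ 2)%:E)%E.
Proof.
move=> mP P0 PC hM mG G0; set leb := @lebesgue_measure R.
have mip : measurable_fun setT (@ip R) := @meas_ip R.
have M0 : 0 <= M.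
  by rewrite -lee_fin; apply: le_trans (hM 0); apply: integral_ge0 => z _; rewrite lee_fin mulr_ge0.
pose A y z := 2^-1 * G y ^+ 2 * (ip z * P y z).
have AE y z : A y z = 2^-1 * G y ^+ 2 * (ip z * P y z) by [].
have A0 y z : 0 <= A y z by apply: mulr_ge0; apply: mulr_ge0 => //; exact: sqr_ge0.
have mA : measurable_fun setT (fun p : R * R => A p.1 p.2) by rewrite /A; mea.
clearbody A.
have le1 y z : `|G y| * (`|G z| * P y z) <= A y z + A z y.
  rewrite !AE [P z y]PC mulrA.
  have h2 : 0 <= 2^-1 :> R by [].
  have rhs0 : 0 <= 2^-1 * G y ^+ 2 * (ip z * P y z) + 2^-1 * G z ^+ 2 * (ip y * P y z).
    by apply: addr_ge0; apply: mulr_ge0; apply: mulr_ge0 => //; exact: sqr_ge0.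
  have [y0|y0] := leP y 0; first by rewrite {1}G0// normr0 !mul0r.
  have [z0|z0] := leP z 0; first by rewrite {1}(G0 z z0) normr0 mulr0 mul0r.
  rewrite !ip1// !mul1r -mulrDl ler_wpM2r//.
  rewrite -(real_normK (num_real (G y))) -(real_normK (num_real (G z))).
  by have := sqr_ge0 (`|G y| - `|G z|); move: `|G y| `|G z| => u v; nra.
have A0' y : (0 <= \int[leb]_z (A y z)%:E)%E by apply: integral_ge0 => z _; rewrite lee_fin.
have A0'' y : (0 <= \int[leb]_z (A z y)%:E)%E by apply: integral_ge0 => z _; rewrite lee_fin.
have mA1 : measurable_fun setT (fun y => \int[leb]_z (A y z)%:E)%E.
  by apply: (@meas_integral _ _ _ (fun y z => (A y z)%:E)) => [|y z]; [mea|rewrite lee_fin].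
have mA2 : measurable_fun setT (fun y => \int[leb]_z (A z y)%:E)%E.
  by apply: (@meas_integral _ _ _ (fun y z => (A z y)%:E)) => [|y z]; [mea|rewrite lee_fin].
apply: (@le_trans _ _ (\int[leb]_y (\int[leb]_z (A y z)%:E + \int[leb]_z (A z y)%:E))%E).
  apply: le_ge0_integral => y _; first by apply: integral_ge0 => z _; rewrite lee_fin !mulr_ge0.
  rewrite -ge0_integral_add//; last 2 first.
  - by apply: (@meas_comp2 _ _ _ A (cst y) id).
  - by apply: (@meas_comp2 _ _ _ A id (cst y)).
  by apply: le_ge0_integral => z _; rewrite lee_fin// !mulr_ge0.
rewrite ge0_integralD//.
have JE : (\int[leb]_y \int[leb]_z (A z y)%:E = \int[leb]_y \int[leb]_z (A y z)%:E)%E.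
  by apply: (@tonelli _ (fun y z => (A z y)%:E)) => [|y z]; [mea|rewrite lee_fin].
rewrite JE.
have JB : (\int[leb]_y \int[leb]_z (A y z)%:E <= (2^-1 * M)%:E * \int[leb]_y (G y ^+ 2)%:E)%E.
  have ps0 : 0 <= 2^-1 * M by rewrite mulr_ge0.
  have mG2 : measurable_fun setT (fun y => G y ^+ 2) by mea.
  have <- := @ge0_integral_mulc _ _ _ leb setT measurableT (2^-1 * M) (fun y => G y ^+ 2) ps0 (fun y _ => sqr_ge0 _) mG2.
  apply: le_ge0_integral => y _ //.
  have c0 : 0 <= 2^-1 * G y ^+ 2 by apply: mulr_ge0 => //; exact: sqr_ge0.
  have ipP0 z : 0 <= ip z * P y z by apply: mulr_ge0.
  have mipP : measurable_fun setT (fun z => ip z * P y z) by mea.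
  have E := @ge0_integral_mulc _ _ _ leb setT measurableT (2^-1 * G y ^+ 2) (fun z => ip z * P y z) c0 (fun z _ => ipP0 z) mipP.
  under eq_integral do rewrite AE.
  rewrite E (_ : 2^-1 * M * G y ^+ 2 = 2^-1 * G y ^+ 2 * M); last by ring.
  by rewrite [in leRHS]EFinM lee_wpmul2l// lee_fin.
apply: le_trans (leeD JB JB) _; rewrite -ge0_muleDl ?lee_fin ?mulr_ge0//.
by rewrite -EFinD le_eqVlt; apply/orP; left; apply/eqP; congr (_%:E * _)%E; field.
Qed.

Section trig_L2.
Variable R : realType.
Local Notation leb := (@lebesgue_measure R).

(** The primitive is an arctangent, whose increments are below pi whatever [eps] is: this uniformity
    is what allows the damping to be removed afterwards. *)
Lemma poisson_halfline_le (eps s c : R) : 0 < eps -> 0 < s ->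
  (\int[leb]_y (ip y * (eps / (eps ^+ 2 + (s * (y - c)) ^+ 2)))%:E <= (pi / s)%:E)%E.
Proof.
move=> e0 s0; rewrite -integral_pos.
have d0 y : 0 < eps ^+ 2 + (s * (y - c)) ^+ 2 by rewrite ltr_pwDl ?exprn_gt0 ?sqr_ge0.
have dF (y : R) : is_derive y 1 (fun y => s^-1 * atan (s * (y - c) / eps))
    (eps / (eps ^+ 2 + (s * (y - c)) ^+ 2)).
  notypeclasses refine (der_eq _ _); first by der.
  by rewrite /=; field; rewrite (gt_eqF s0) (gt_eqF e0) (gt_eqF (d0 y)).
apply: (@ge0_FTC_le _ _ (fun y => s^-1 * atan (s * (y - c) / eps))).
- by move=> y _; rewrite divr_ge0 ?(ltW e0) ?(ltW (d0 y)).
- move=> y _; apply: der_continuous; notypeclasses refine (der_eq _ (erefl _)); der.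
  by rewrite gt_eqF.
- move=> x y _ _; rewrite -mulrBr mulrC ler_wpM2r ?invr_ge0 ?(ltW s0)//.
  have := atan_ltpi2 (s * (y - c) / eps); have := atan_gtNpi2 (s * (x - c) / eps); lra.
Qed.

Variables (phi : R -> R) (G : R -> R) (s : R).
Hypothesis s0 : 0 < s.
Hypothesis mphi : measurable_fun setT phi.
Hypothesis phi1 : forall x, `|phi x| <= 1.
Hypothesis phi2 : forall eps u v, 0 < eps ->
  `|Rintegral leb setT (fun x => damp eps x * (phi (u * x) * phi (v * x)))| <=
   eps / (eps ^+ 2 + (u - v) ^+ 2) + eps / (eps ^+ 2 + (u + v) ^+ 2).
Hypothesis iG : leb.-integrable setT (EFin \o G).
Hypothesis G0 : forall y, y <= 0 -> G y = 0.

Let T x := Rintegral leb setT (fun y => G y * phi (s * x * y)).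

(** Expanding T^2 and integrating first in x is legitimate because the damping and [G] are
    integrable and [phi] is bounded. By [phi2] the x-integral is dominated by Poisson kernels at s(y
    - z) and s(y + z), each of mass at most pi/s in z, and Schur's test concludes. *)
Lemma damped_trig_L2 eps : 0 < eps ->
  (\int[leb]_x (damp eps x * T x ^+ 2)%:E <= (2 * pi / s)%:E * \int[leb]_y (G y ^+ 2)%:E)%E.
Proof.
move=> e0.
have mG : measurable_fun setT G by apply/measurable_EFinP; case/integrableP : iG.
have mT : measurable_fun setT T.
  by apply: (@meas_Rintegral _ _ _ (fun x y => G y * phi (s * x * y))); mea.
have mpx (x : R) : measurable_fun setT (fun y => phi (s * x * y)) by mea.
have mpy (y : R) : measurable_fun setT (fun x => phi (s * x * y)) by mea.
pose N := Rintegral leb setT (fun x => `|G x|).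
have TN x : `|T x| <= N.
  by have := norm_Rintegral_bdd_mul iG (mpx x) (fun y => phi1 _); rewrite mulr1.
have iA := damp_integrable e0.
have iAT : leb.-integrable setT (EFin \o (fun x => damp eps x * T x)).
  exact: integrable_bdd_mul iA mT TN.
have iATT : leb.-integrable setT (EFin \o (fun x => damp eps x * T x ^+ 2)).
  rewrite (_ : (fun x => _) = fun x => damp eps x * T x * T x); first exact: integrable_bdd_mul iAT mT TN.
  by apply/funext => x; ring.
pose Q y z := Rintegral leb setT (fun x => damp eps x * (phi (s * y * x) * phi (s * z * x))).
have mk : measurable_fun setT (fun p : R * R => phi (s * p.1 * p.2)) by mea.
have E : Rintegral leb setT (fun x => damp eps x * T x ^+ 2) =
    Rintegral leb setT (fun y => G y * Rintegral leb setT (fun z => G z * Q y z)).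
  transitivity (Rintegral leb setT (fun x => damp eps x * T x * T x)).
    by apply: eq_Rintegral => x _; ring.
  rewrite (fubini_kernel iAT iG mk (fun x y => phi1 (s * x * y))).
  apply: eq_Rintegral => y _; congr (_ * _).
  transitivity (Rintegral leb setT (fun x => damp eps x * phi (s * x * y) * T x)).
    by apply: eq_Rintegral => x _; ring.
  have iAp := integrable_bdd_mul iA (mpy y) (fun x => phi1 (s * x * y)).
  rewrite (fubini_kernel iAp iG mk (fun x y => phi1 (s * x * y))).
  apply: eq_Rintegral => z _; congr (_ * _); apply: eq_Rintegral => x _.
  by rewrite -mulrA; congr (_ * (phi _ * phi _)); ring.
have -> : (\int[leb]_x (damp eps x * T x ^+ 2)%:E = (Rintegral leb setT (fun x => damp eps x * T x ^+ 2))%:E)%E.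
  by rewrite /Rintegral fineK//; exact: integrable_fin_num.
pose P y z := eps / (eps ^+ 2 + (s * y - s * z) ^+ 2) + eps / (eps ^+ 2 + (s * y + s * z) ^+ 2).
have P0 y z : 0 <= P y z by rewrite addr_ge0// divr_ge0 ?(ltW e0)// addr_ge0// sqr_ge0.
have PC y z : P y z = P z y by rewrite /P -(opprB (s * y)) sqrrN [s * z + _]addrC.
have mP : measurable_fun setT (fun p : R * R => P p.1 p.2) by rewrite /P; mea.
have mip : measurable_fun setT (@ip R) := @meas_ip R.
rewrite E; apply: le_trans (_ : _ <= \int[leb]_y \int[leb]_z (`|G y| * (`|G z| * P y z))%:E)%E _.
  apply: (@le_trans _ _ (`|Rintegral leb setT (fun y => G y * Rintegral leb setT (fun z => G z * Q y z))|%:E)).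
    by rewrite lee_fin ler_norm.
  apply: le_trans (norm_Rintegral_le _ _ _) _; apply: le_ge0_integral => y _ //.
  rewrite normrM EFinM; under eq_integral do rewrite EFinM.
  rewrite ge0_integralZl//; last 2 first.
  - by apply: (@meas_EFin _ _ _ (fun z => `|G z| * P y z)); mea.
  - by move=> z _; rewrite lee_fin mulr_ge0.
  rewrite lee_wpmul2l//; apply: le_trans (norm_Rintegral_le _ _ _) _.
  apply: le_ge0_integral => z _ //; rewrite lee_fin normrM ler_wpM2l//.
  exact: phi2.
have hM y : (\int[leb]_z (ip z * P y z)%:E <= (2 * pi / s)%:E)%E.
  have -> : 2 * pi / s = pi / s + pi / s by ring.
  rewrite EFinD; apply: le_trans (leeD (poisson_halfline_le y e0 s0) (poisson_halfline_le (- y) e0 s0)).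
  rewrite -ge0_integral_add//; last 4 first.
  - by move=> z _; rewrite mulr_ge0 ?ip_ge0// divr_ge0 ?(ltW e0)// addr_ge0// sqr_ge0.
  - by move=> z _; rewrite mulr_ge0 ?ip_ge0// divr_ge0 ?(ltW e0)// addr_ge0// sqr_ge0.
  - by mea.
  - by mea.
  rewrite le_eqVlt; apply/orP; left; apply/eqP; apply: eq_integral => z _; congr EFin.
  rewrite -mulrDr; congr (_ * _); rewrite /P -(opprB (s * z)) sqrrN -mulrBr opprK.
  by rewrite (_ : s * y + s * z = s * (z + y))//; ring.
exact: schur_symmetric.
Qed.

(* The damping is removed on ]-oo, n] with eps = 1/(n+1), where it is at least e^-1. *)
Lemma trig_L2 :
  (\int[leb]_x (ip x * T x ^+ 2)%:E <= (expR 1 * (2 * pi / s))%:E * \int[leb]_y (G y ^+ 2)%:E)%E.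
Proof.
have mG : measurable_fun setT G by apply/measurable_EFinP; case/integrableP : iG.
have mT : measurable_fun setT T.
  by apply: (@meas_Rintegral _ _ _ (fun x y => G y * phi (s * x * y))); mea.
have Teq := damped_trig_L2.
move: (T) mT Teq => T' mT Teq.
have mip : measurable_fun setT (@ip R) := @meas_ip R.
have f0 x : 0 <= ip x * T' x ^+ 2 by apply: mulr_ge0 => //; exact: sqr_ge0.
have mf : measurable_fun setT (fun x => (ip x * T' x ^+ 2)%:E) by mea.
pose D (n : nat) : set R := `]-oo, n%:R]%classic.
have cvg : (\int[leb]_(x in D n) (ip x * T' x ^+ 2)%:E)%E @[n --> \oo] -->
    (\int[leb]_(x in \bigcup_n D n) (ip x * T' x ^+ 2)%:E)%E.
  apply: (@ge0_nondecreasing_set_cvg_integral _ _ _ _ _ leb) => //.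
  - apply/nondecreasing_seqP => n; rewrite subsetEset => x; rewrite /D/= !in_itv/= => xn.
    by apply: le_trans xn _; rewrite ler_nat.
  - by move=> i; exact: measurable_itv.
  - by move=> i; apply: measurable_funTS.
  - by move=> i x _; rewrite lee_fin.
have DT : \bigcup_n D n = [set: R].
  apply/seteqP; split => // x _; exists (Num.truncn `|x|).+1 => //; rewrite /D/= in_itv/=.
  by apply: le_trans (ler_norm _) (ltW (truncnS_gt _)).
rewrite DT in cvg; rewrite -(cvg_lim _ cvg)//; apply: lime_le.
  by apply/cvg_ex; eexists; exact: cvg.
near=> n.
pose eps : R := n.+1%:R^-1.
have e0 : 0 < eps by rewrite invr_gt0.
rewrite EFinM -muleA.
apply: (@le_trans _ _ ((expR 1)%:E * \int[leb]_x (damp eps x * T' x ^+ 2)%:E)%E); last first.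
  by rewrite lee_wpmul2l ?lee_fin ?expR_ge0//; exact: Teq.
have md : measurable_fun setT (damp eps) := @meas_damp R eps.
rewrite -ge0_integral_mulc ?expR_ge0//; last 2 first.
- by move=> x _; apply: mulr_ge0; [exact: damp_ge0|exact: sqr_ge0].
- by mea.
rewrite [leLHS]integral_mkcond; apply: le_ge0_integral => x _.
  by rewrite patchE; case: ifP => // _; rewrite lee_fin.
have d0 : 0 <= expR 1 * (damp eps x * T' x ^+ 2).
  by apply: mulr_ge0; [exact: expR_ge0|apply: mulr_ge0; [exact: damp_ge0|exact: sqr_ge0]].
rewrite patchE; case: ifPn => [|_]; last by rewrite lee_fin.
rewrite inE /D/= in_itv/= => xn; rewrite lee_fin /damp.
rewrite (_ : expR 1 * _ = ip x * (expR 1 * expR (- (eps * x)) * T' x ^+ 2)); last by ring.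
rewrite ler_wpM2l// ler_peMl ?sqr_ge0// -expRD; apply: le_trans (expR_ge1Dx _).
rewrite lerDl subr_ge0 /eps ler_pdivrMl// mulr1.
by apply: le_trans xn _; rewrite ler_nat.
Unshelve. all: by end_near. Qed.

End trig_L2.

Section cos_sin_L2.
Variable R : realType.
Local Notation leb := (@lebesgue_measure R).

Let poisson_ge0 (eps b : R) : 0 < eps -> 0 <= eps / (eps ^+ 2 + b ^+ 2).
Proof. by move=> e0; rewrite divr_ge0 ?(ltW e0)// addr_ge0// sqr_ge0. Qed.

Lemma damp_cos_cos (eps u v : R) : 0 < eps ->
  `|Rintegral leb setT (fun x => damp eps x * (cos (u * x) * cos (v * x)))| <=
   eps / (eps ^+ 2 + (u - v) ^+ 2) + eps / (eps ^+ 2 + (u + v) ^+ 2).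
Proof.
move=> e0; have iA := damp_integrable e0.
have c1 b (x : R) : `|cos (b * x)| <= 1 by rewrite ler_norml cos_geN1 cos_le1.
have mc b : measurable_fun setT (fun x : R => cos (b * x)) by mea.
rewrite (_ : (fun x => _) = fun x => 2^-1 * (damp eps x * cos ((u - v) * x) + damp eps x * cos ((u + v) * x))); last first.
  by apply/funext => x; rewrite mulrBl mulrDl cosB cosD; field.
have i1 b := integrable_bdd_mul iA (mc b) (c1 b).
rewrite RintegralZl//; last first.
  by have := integrableD measurableT (i1 (u - v)) (i1 (u + v)).
rewrite RintegralD// !damp_cos// ger0_norm.
  by rewrite ler_piMl ?addr_ge0 ?poisson_ge0// invf_le1// ler1n.
by rewrite mulr_ge0 ?addr_ge0 ?poisson_ge0.
Qed.

Lemma damp_sin_sin (eps u v : R) : 0 < eps ->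
  `|Rintegral leb setT (fun x => damp eps x * (sin (u * x) * sin (v * x)))| <=
   eps / (eps ^+ 2 + (u - v) ^+ 2) + eps / (eps ^+ 2 + (u + v) ^+ 2).
Proof.
move=> e0; have iA := damp_integrable e0.
have c1 b (x : R) : `|cos (b * x)| <= 1 by rewrite ler_norml cos_geN1 cos_le1.
have mc b : measurable_fun setT (fun x : R => cos (b * x)) by mea.
rewrite (_ : (fun x => _) = fun x => 2^-1 * (damp eps x * cos ((u - v) * x) - damp eps x * cos ((u + v) * x))); last first.
  by apply/funext => x; rewrite mulrBl mulrDl cosB cosD; field.
have i1 b := integrable_bdd_mul iA (mc b) (c1 b).
rewrite RintegralZl//; last first.
  by have := integrableB measurableT (i1 (u - v)) (i1 (u + v)).
rewrite RintegralB// !damp_cos//.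
have h1 := poisson_ge0 (u - v) e0; have h2 := poisson_ge0 (u + v) e0.
by rewrite ler_norml; move: (eps / _) (eps / _) h1 h2 => X Y; lra.
Qed.

Variables (G : R -> R) (s : R).
Hypothesis s0 : 0 < s.
Hypothesis iG : leb.-integrable setT (EFin \o G).
Hypothesis G0 : forall y, y <= 0 -> G y = 0.

Lemma cos_L2 : (\int[leb]_x (ip x * Rintegral leb setT (fun y => G y * cos (s * x * y)) ^+ 2)%:E
   <= (expR 1 * (2 * pi / s))%:E * \int[leb]_y (G y ^+ 2)%:E)%E.
Proof.
apply: (@trig_L2 R cos G s s0) => //.
- by apply: continuous_measurable_fun; exact: continuous_cos.
- by move=> x; rewrite ler_norml cos_geN1 cos_le1.
- exact: damp_cos_cos.
Qed.

Lemma sin_L2 : (\int[leb]_x (ip x * Rintegral leb setT (fun y => G y * sin (s * x * y)) ^+ 2)%:E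
   <= (expR 1 * (2 * pi / s))%:E * \int[leb]_y (G y ^+ 2)%:E)%E.
Proof.
apply: (@trig_L2 R sin G s s0) => //.
- by apply: continuous_measurable_fun; exact: continuous_sin.
- by move=> x; rewrite ler_norml sin_geN1 sin_le1.
- exact: damp_sin_sin.
Qed.

End cos_sin_L2.

Lemma integrable_addr (R : realType) (f g : R -> R) :
  (@lebesgue_measure R).-integrable setT (EFin \o f) ->
  (@lebesgue_measure R).-integrable setT (EFin \o g) ->
  (@lebesgue_measure R).-integrable setT (EFin \o (fun x => f x + g x)).
Proof. by move=> fi gi; have := integrableD measurableT fi gi. Qed.

(** * Schur's test for the kernel 1/(1 + s x y) *)

Section remainder.
Variable R : realType.
Local Notation leb := (@lebesgue_measure R).

Lemma half_weight_integral (c : R) : 0 < c ->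
  (\int[leb]_y (ip y * (y `^ (- 2^-1) / (1 + c * y)))%:E <= (pi * c `^ (- 2^-1))%:E)%E.
Proof.
move=> c0; rewrite -integral_pos.
have d1 (y : R) : 0 < y -> 0 < 1 + c * y by move=> y0; rewrite addr_gt0// mulr_gt0.
have dF (y : R) : 0 < y -> is_derive y 1 (fun y => 2 * c `^ (- 2^-1) * atan ((c * y) `^ (2^-1)))
    (y `^ (- 2^-1) / (1 + c * y)).
  move=> y0; have cy : 0 < c * y by rewrite mulr_gt0.
  notypeclasses refine (der_eq _ _); first by der.
  rewrite /= -powR_mulrn ?powR_ge0// -powRrM mulVf ?pnatr_eq0// powRr1 ?(ltW cy)//.
  rewrite (_ : 2^-1 - 1 = - 2^-1 :> R); last by field.
  rewrite (@powRM _ c y (- 2^-1)) ?(ltW c0) ?(ltW y0)//.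
  have E : c `^ (- 2^-1) * c `^ (- 2^-1) * c = 1.
    rewrite -powRD ?(gt_eqF c0) ?implybT// (_ : - 2^-1 + - 2^-1 = -1 :> R); last by field.
    by rewrite powR_inv1 ?(ltW c0)// mulVf// gt_eqF.
  transitivity (y `^ (- 2^-1) / (1 + c * y) * (c `^ (- 2^-1) * c `^ (- 2^-1) * c)); last by rewrite E mulr1.
  by field; rewrite gt_eqF// d1.
apply: (@ge0_FTC_le _ _ (fun y => 2 * c `^ (- 2^-1) * atan ((c * y) `^ (2^-1)))).
- by move=> y y0; rewrite divr_ge0 ?powR_ge0 ?(ltW (d1 y y0)).
- move=> y y0; apply: der_continuous; notypeclasses refine (der_eq _ (erefl _)); der.
  by rewrite gt_eqF// d1.
- move=> x y _ _; rewrite -mulrBr (mulrC pi) (mulrC 2) -mulrA ler_wpM2l ?powR_ge0//.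
  have := atan_ltpi2 ((c * y) `^ (2^-1)).
  have : 0 <= atan ((c * x) `^ (2^-1)) by rewrite -(@atan0 R); apply: le_atan; rewrite powR_ge0.
  lra.
Qed.

Lemma powR_half_sqr (x p : R) : 0 <= x -> (x `^ (p / 2)) ^+ 2 = x `^ p.
Proof. by move=> x0; rewrite -powR_mulrn ?powR_ge0// -powRrM divfK ?pnatr_eq0. Qed.

Variables (G : R -> R) (s : R).
Hypothesis s0 : 0 < s.
Hypothesis mG : measurable_fun setT G.
Hypothesis G0 : forall y, y <= 0 -> G y = 0.

(** Cauchy-Schwarz is applied to the factors |G| y^(1/4) (1 + sxy)^(-1/2) and y^(-1/4) (1 +
    sxy)^(-1/2). The second contributes pi (s x)^(-1/2), and integrating in x after Tonelli gives pi
    (s y)^(-1/2); the half powers of y cancel and pi^2 / s remains. *)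
Lemma schur_remainder :
  (\int[leb]_x ((ip x)%:E * poweR (\int[leb]_y (`|G y| / (1 + s * x * y))%:E) 2) <=
   (pi ^+ 2 / s)%:E * \int[leb]_y (G y ^+ 2)%:E)%E.
Proof.
have mip : measurable_fun setT (@ip R) := @meas_ip R.
pose p := s `^ (- 2^-1).
have p0 : 0 <= p by exact: powR_ge0.
have pp : p * p = s^-1.
  rewrite -powRD ?(gt_eqF s0) ?implybT// (_ : - 2^-1 + - 2^-1 = -1 :> R); last by field.
  by rewrite powR_inv1 ?(ltW s0).
have d1 (x y : R) : 0 < x -> 0 < y -> 0 < 1 + s * x * y by move=> x0 y0; rewrite addr_gt0// !mulr_gt0.
pose K x y := pi * p * (ip x * x `^ (- 2^-1) / (1 + s * x * y) * (G y ^+ 2 * y `^ (2^-1))).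
have K0 x y : 0 <= K x y.
  have [y0|y0] := leP y 0; first by rewrite /K (G0 y0) expr2 !mul0r !mulr0.
  have [x0|x0] := leP x 0; first by rewrite /K (ip0 x0) !mul0r !mulr0.
  apply: mulr_ge0; first by rewrite mulr_ge0 ?pi_ge0.
  apply: mulr_ge0; last by apply: mulr_ge0; rewrite ?sqr_ge0 ?powR_ge0.
  by rewrite divr_ge0 ?(ltW (d1 x y x0 y0))// mulr_ge0 ?powR_ge0.
have mK : measurable_fun setT (fun p : R * R => K p.1 p.2) by rewrite /K; mea.
apply: (@le_trans _ _ (\int[leb]_x \int[leb]_y (K x y)%:E)%E).
  apply: le_ge0_integral => x _; first by rewrite mule_ge0 ?poweR_ge0// lee_fin.
  have [x0|x0] := leP x 0.
    by rewrite ip0// mul0e; apply: integral_ge0 => y _; rewrite lee_fin.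
  rewrite (ip1 x0) mul1e.
  pose f y := `|G y| * (y `^ (2^-1 / 2) * (1 + s * x * y) `^ (- 1 / 2)).
  pose g y := ip y * (y `^ (- 2^-1 / 2) * (1 + s * x * y) `^ (- 1 / 2)).
  have mf : measurable_fun setT f by rewrite /f; mea.
  have mg : measurable_fun setT g by rewrite /g; mea.
  have f0 y : 0 <= f y by rewrite mulr_ge0// mulr_ge0 ?powR_ge0.
  have g0 y : 0 <= g y by rewrite mulr_ge0// mulr_ge0 ?powR_ge0.
  have fg y : `|G y| / (1 + s * x * y) = f y * g y.
    have [y0|y0] := leP y 0; first by rewrite /f (G0 y0) normr0 !mul0r.
    rewrite /f /g (ip1 y0) mul1r.
    have -> : `|G y| * (y `^ (2^-1 / 2) * (1 + s * x * y) `^ (-1 / 2)) *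
       (y `^ (- 2^-1 / 2) * (1 + s * x * y) `^ (-1 / 2)) =
       `|G y| * ((y `^ (2^-1 / 2) * y `^ (- 2^-1 / 2)) * (1 + s * x * y) `^ (-1 / 2) ^+ 2) by ring.
    rewrite powR_half_sqr ?(ltW (d1 x y x0 y0))// powR_inv1 ?(ltW (d1 x y x0 y0))//.
    rewrite -powRD ?(gt_eqF y0) ?implybT// (_ : 2^-1 / 2 + - 2^-1 / 2 = 0 :> R); last by field.
    by rewrite powRr0 mul1r.
  under eq_integral do rewrite fg.
  apply: le_trans (cauchy_schwarz mf mg f0 g0) _.
  have Eg : (\int[leb]_y (g y ^+ 2)%:E <= (pi * (s * x) `^ (- 2^-1))%:E)%E.
    apply: le_trans (half_weight_integral (mulr_gt0 s0 x0)).
    apply: le_ge0_integral => y _; rewrite lee_fin ?sqr_ge0//.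
    have [y0|y0] := leP y 0; first by rewrite /g (ip0 y0) !mul0r expr2 mul0r.
    rewrite /g (ip1 y0) !mul1r exprMn !powR_half_sqr ?(ltW y0) ?(ltW (d1 x y x0 y0))//.
    by rewrite powR_inv1 ?(ltW (d1 x y x0 y0)).
  apply: le_trans (lee_wpmul2l _ Eg) _; first by apply: integral_ge0 => y _; rewrite lee_fin sqr_ge0.
  rewrite muleC -ge0_integral_mulc//; last 3 first.
  - by rewrite mulr_ge0 ?pi_ge0 ?powR_ge0.
  - by move=> y _; exact: sqr_ge0.
  - by mea.
  apply: le_ge0_integral => y _.
    by rewrite lee_fin mulr_ge0 ?sqr_ge0// mulr_ge0 ?pi_ge0 ?powR_ge0.
  rewrite lee_fin /K.
  have [y0|y0] := leP y 0; first by rewrite /f (G0 y0) normr0 !mul0r expr2 !mul0r !mulr0.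
  rewrite /f (ip1 x0) !exprMn !powR_half_sqr ?(ltW y0) ?(ltW (d1 x y x0 y0))//.
  rewrite powR_inv1 ?(ltW (d1 x y x0 y0))// real_normK ?num_real//.
  rewrite powRM ?(ltW s0) ?(ltW x0)// -/p le_eqVlt; apply/orP; left; apply/eqP.
  by field; rewrite gt_eqF// d1.
rewrite (@tonelli _ (fun x y => (K x y)%:E)); last 2 first.
- by mea.
- by move=> x y; rewrite lee_fin.
have c0 : 0 <= pi ^+ 2 / s by rewrite divr_ge0 ?sqr_ge0 ?(ltW s0).
rewrite -ge0_integral_mulc//; last 2 first.
- by move=> y _; exact: sqr_ge0.
- by mea.
apply: le_ge0_integral => y _; first by apply: integral_ge0 => x _; rewrite lee_fin.
have [y0|y0] := leP y 0.
  rewrite integral0_eq => [|x _]; last by rewrite /K (G0 y0) expr2 !mul0r !mulr0.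
  by rewrite lee_fin; apply: mulr_ge0 => //; exact: sqr_ge0.
have c1 : 0 <= pi * p * (G y ^+ 2 * y `^ (2^-1)).
  by apply: mulr_ge0; apply: mulr_ge0; rewrite ?pi_ge0 ?powR_ge0 ?sqr_ge0.
have h0 x : 0 <= ip x * (x `^ (- 2^-1) / (1 + s * y * x)).
  have [x0|x0] := leP x 0; first by rewrite (ip0 x0) !mul0r.
  by rewrite ip1// mul1r divr_ge0 ?powR_ge0 ?(ltW (d1 y x y0 x0)).
have mh : measurable_fun setT (fun x => ip x * (x `^ (- 2^-1) / (1 + s * y * x))) by mea.
have E := @ge0_integral_mulc _ _ _ leb setT measurableT _ _ c1 (fun x _ => h0 x) mh.
rewrite (_ : (\int[leb]_x (K x y)%:E = \int[leb]_x (pi * p * (G y ^+ 2 * y `^ (2^-1)) *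
    (ip x * (x `^ (- 2^-1) / (1 + s * y * x))))%:E)%E); last first.
  by apply: eq_integral => x _; congr EFin; rewrite /K (mulrAC s y x); ring.
rewrite E; apply: le_trans (lee_wpmul2l _ (half_weight_integral (mulr_gt0 s0 y0))) _.
  by rewrite lee_fin.
rewrite -EFinM lee_fin powRM ?(ltW s0) ?(ltW y0)// -/p.
have Ey : y `^ (2^-1) * y `^ (- 2^-1) = 1.
  by rewrite -powRD ?(gt_eqF y0) ?implybT// subrr powRr0.
rewrite [leLHS](_ : _ = pi ^+ 2 * (p * p) * G y ^+ 2 * (y `^ (2^-1) * y `^ (- 2^-1))); last by ring.
by rewrite Ey pp mulr1.
Qed.

End remainder.

(** * The weighted L^2 bound of the Hankel transform *)

Section hankel.
Variable R : realType.
Local Notation leb := (@lebesgue_measure R).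
Variable a : R.
Hypothesis a0 : 0 <= a.

Definition wt (y : R) : R := ip y * y `^ a.

Lemma wt_ge0 y : 0 <= wt y. Proof. by rewrite mulr_ge0 ?ip_ge0 ?powR_ge0. Qed.

Lemma meas_wt : measurable_fun setT wt.
Proof. by have mip := @meas_ip R; rewrite /wt; mea. Qed.

(** The amplitude of the propagator kernel is kept apart, in [kap], so that here [s] acts as a pure
    dilation. *)
Definition hankel (s : R) (g : R -> R) (x : R) : R :=
  Rintegral leb setT (fun y => wt y * g y * bphi a ((s * x * y) ^+ 2 / 4)).

Lemma meas_bphi : measurable_fun setT (bphi a).
Proof.
apply: continuous_measurable_fun => x; apply: der_continuous; exact: der_bphi.
Qed.

(** The isometry g -> y^(a/2) g from L^2(y^a dy) to unweighted L^2 of the half line, which brings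
    the problem to the trigonometric transforms. *)
Definition halfwt (g : R -> R) (y : R) : R := ip y * y `^ (a / 2) * g y.

Lemma halfwt_sqr g y : halfwt g y ^+ 2 = wt y * g y ^+ 2.
Proof.
have [y0|y0] := leP y 0; first by rewrite /halfwt /wt (ip0 y0) !mul0r expr2 mul0r.
by rewrite /halfwt /wt (ip1 y0) !mul1r exprMn powR_half_sqr// ltW.
Qed.

(** Passing from [bphi] to [bk] releases the factor (s x)^(-a/2); its square cancels the weight x^a
    and leaves s^(-a). The missing factor 1/s comes from the three unweighted estimates, for the
    cosine, the sine and the remainder. *)
Lemma hankel_L2 : exists2 C : R, 0 < C & forall (s : R) (g : R -> R), 0 < s ->
  measurable_fun setT g -> leb.-integrable setT (EFin \o halfwt g) ->
  (\int[leb]_x (wt x * hankel s g x ^+ 2)%:E <=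
   (C * s `^ (- (a + 1)))%:E * \int[leb]_y (wt y * g y ^+ 2)%:E)%E.
Proof.
have [al [be [M hM]]] := bk_asymptotics a0.
have M0 : 0 <= M.
  have := le_trans (normr_ge0 _) (hM 1 ltr01); rewrite pmulr_lge0// invr_gt0; lra.
pose e1 : R := expR 1 * (2 * pi).
(* The 3 is from (u + v + w)^2 <= 3 (u^2 + v^2 + w^2); the final 1 only makes the constant
   positive. *)
pose C := 3 * ((al ^+ 2 + be ^+ 2) * e1 + M ^+ 2 * pi ^+ 2) + 1.
have e10 : 0 <= e1 by rewrite mulr_ge0 ?expR_ge0// mulr_ge0 ?pi_ge0.
exists C.
  rewrite /C ltr_wpDl// mulr_ge0// addr_ge0// mulr_ge0 ?addr_ge0 ?sqr_ge0//.
move=> s g s0 mg iG; set G := halfwt g in iG *.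
have mip : measurable_fun setT (@ip R) := @meas_ip R.
have mbphi := meas_bphi.
have mwt := meas_wt.
have mG : measurable_fun setT G by rewrite /G /halfwt; mea.
have G0 y : y <= 0 -> G y = 0 by move=> y0; rewrite /G /halfwt ip0// !mul0r.
have GE y : wt y * g y ^+ 2 = G y ^+ 2 by rewrite halfwt_sqr.
under [X in (_ <= _ * X)%E]eq_integral do rewrite GE.
pose Tc x := Rintegral leb setT (fun y => G y * cos (s * x * y)).
pose Ts x := Rintegral leb setT (fun y => G y * sin (s * x * y)).
pose Tr x := Rintegral leb setT (fun y => `|G y| / (1 + s * x * y)).
have G1 (x y : R) : 0 < x -> `|G y| / (1 + s * x * y) <= `|G y| /\ 0 <= `|G y| / (1 + s * x * y).
  move=> x0; have [y0|y0] := leP y 0; first by rewrite (G0 _ y0) normr0 mul0r.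
  have h : 1 <= 1 + s * x * y by rewrite lerDl !mulr_ge0 ?(ltW s0) ?(ltW x0) ?(ltW y0).
  have h' : 0 < 1 + s * x * y by lra.
  by rewrite divr_ge0 ?(ltW h')// ler_pdivrMr// ler_peMr.
have TrE (x : R) : 0 < x -> (Tr x)%:E = (\int[leb]_y (`|G y| / (1 + s * x * y))%:E)%E.
  move=> x0; rewrite /Tr /Rintegral fineK// ge0_fin_numE; last first.
    by apply: integral_ge0 => y _; rewrite lee_fin (G1 x y x0).2.
  apply: (@le_lt_trans _ _ (\int[leb]_y `|(G y)%:E|)%E); last by case/integrableP : iG.
  by apply: le_ge0_integral => y _; rewrite lee_fin ?(G1 x y x0).1 ?(G1 x y x0).2.
have main (x : R) : 0 < x -> wt x * hankel s g x ^+ 2 <=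
    s `^ (- a) * (3 * (al ^+ 2 * Tc x ^+ 2 + be ^+ 2 * Ts x ^+ 2 + M ^+ 2 * Tr x ^+ 2)).
  move=> x0; pose K y := bk a (s * x * y).
  pose rho y := ip y * (K y - (al * cos (s * x * y) + be * sin (s * x * y))).
  have mrho : measurable_fun setT rho by rewrite /rho /K /bk; mea.
  have rhoM y : `|rho y| <= M.
    have [y0|y0] := leP y 0; first by rewrite /rho (ip0 y0) mul0r normr0.
    have z0 : 0 < s * x * y by rewrite !mulr_gt0.
    rewrite /rho (ip1 y0) mul1r; apply: le_trans (hM _ z0) _.
    rewrite ler_pdivrMr; last by lra.
    by rewrite ler_peMr//; lra.
  have icos : leb.-integrable setT (EFin \o (fun y => G y * cos (s * x * y))).
    apply: (integrable_bdd_mul (M := 1) iG) => [|y]; first by mea.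
    by rewrite ler_norml cos_geN1 cos_le1.
  have isin : leb.-integrable setT (EFin \o (fun y => G y * sin (s * x * y))).
    apply: (integrable_bdd_mul (M := 1) iG) => [|y]; first by mea.
    by rewrite ler_norml sin_geN1 sin_le1.
  have irho := integrable_bdd_mul iG mrho rhoM.
  have HE : hankel s g x = (s * x) `^ (- (a / 2)) * (al * Tc x + be * Ts x +
      Rintegral leb setT (fun y => G y * rho y)).
    rewrite /Tc /Ts -!RintegralZl//.
    have i1 := integrable_scale al icos; have i2 := integrable_scale be isin.
    rewrite -RintegralD// -RintegralD//; last exact: integrable_addr.
    rewrite -RintegralZl//; last by apply: integrable_addr => //; exact: integrable_addr.
    apply: eq_Rintegral => y _.
    have [y0|y0] := leP y 0; first by rewrite (G0 _ y0) /wt (ip0 y0); ring.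
    rewrite /rho /K /bk /wt (ip1 y0) /G /halfwt (ip1 y0).
    have E : (s * x * y) `^ (a / 2) = (s * x) `^ (a / 2) * y `^ (a / 2).
      by rewrite powRM// ?mulr_ge0 ?ltW.
    have E2 : (s * x) `^ (- (a / 2)) * (s * x) `^ (a / 2) = 1.
      rewrite -powRD ?addNr ?powRr0//.
      by rewrite (gt_eqF (mulr_gt0 s0 x0)) implybT.
    have E3 : y `^ a = y `^ (a / 2) * y `^ (a / 2).
      by rewrite -expr2 powR_half_sqr// ltW.
    rewrite E E3.
    transitivity (y `^ (a / 2) * y `^ (a / 2) * g y * bphi a ((s * x * y) ^+ 2 / 4) *
      ((s * x) `^ (- (a / 2)) * (s * x) `^ (a / 2))); last by ring.
    by rewrite E2; ring.
  have hr : `|Rintegral leb setT (fun y => G y * rho y)| <= M * Tr x.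
    rewrite -lee_fin; apply: le_trans (norm_Rintegral_le _ _ _) _.
    rewrite EFinM TrE//.
    have mGx : measurable_fun setT (fun y => `|G y| / (1 + s * x * y)) by mea.
    rewrite -ge0_integral_mulc//; last by move=> y _; exact: (G1 x y x0).2.
    apply: le_ge0_integral => y _; rewrite lee_fin// normrM.
    have [y0|y0] := leP y 0; first by rewrite (G0 _ y0) normr0 !mul0r mulr0.
    rewrite mulrCA ler_wpM2l// /rho (ip1 y0) mul1r hM//.
    by rewrite !mulr_gt0.
  rewrite HE exprMn -mulNr powR_half_sqr ?mulr_ge0 ?(ltW s0) ?(ltW x0)//.
  rewrite powRM ?(ltW s0) ?(ltW x0)// /wt (ip1 x0) mul1r.
  have Ex : x `^ a * x `^ (- a) = 1 by rewrite -powRD ?subrr ?powRr0// (gt_eqF x0) implybT.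
  rewrite (_ : x `^ a * (s `^ (- a) * x `^ (- a) * _) =
    (x `^ a * x `^ (- a)) * (s `^ (- a) * (al * Tc x + be * Ts x + Rintegral leb setT (fun y => G y * rho y)) ^+ 2)); last by ring.
  rewrite Ex mul1r ler_wpM2l ?powR_ge0//.
  move: (Rintegral _ _ _) hr => I hI.
  have : I ^+ 2 <= (M * Tr x) ^+ 2.
    by rewrite -(real_normK (num_real I)) lerXn2r ?nnegrE// (le_trans _ hI).
  rewrite -!exprMn; move: (al * Tc x) (be * Ts x) (M * Tr x) => u v w hw.
  have := sqr_ge0 (u - v); have := sqr_ge0 (u - I); have := sqr_ge0 (v - I); nra.
have mTc : measurable_fun setT Tc.
  by apply: (@meas_Rintegral _ _ _ (fun x y => G y * cos (s * x * y))); mea.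
have mTs : measurable_fun setT Ts.
  by apply: (@meas_Rintegral _ _ _ (fun x y => G y * sin (s * x * y))); mea.
have mTr : measurable_fun setT Tr.
  by apply: (@meas_Rintegral _ _ _ (fun x y => `|G y| / (1 + s * x * y))); mea.
have Tr0 x : 0 < x -> 0 <= Tr x.
  by move=> x0; apply: Rintegral_ge0 => y _; exact: (G1 x y x0).2.
have Hc : (\int[leb]_x (ip x * Tc x ^+ 2)%:E <= (expR 1 * (2 * pi / s))%:E * \int[leb]_y (G y ^+ 2)%:E)%E.
  exact: cos_L2.
have Hs : (\int[leb]_x (ip x * Ts x ^+ 2)%:E <= (expR 1 * (2 * pi / s))%:E * \int[leb]_y (G y ^+ 2)%:E)%E.
  exact: sin_L2.
have Hr : (\int[leb]_x (ip x * Tr x ^+ 2)%:E <= (pi ^+ 2 / s)%:E * \int[leb]_y (G y ^+ 2)%:E)%E.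
  apply: le_trans (@schur_remainder R G s s0 mG G0).
  rewrite le_eqVlt; apply/orP; left; apply/eqP; apply: eq_integral => x _.
  have [x0|x0] := leP x 0; first by rewrite ip0// mul0r mul0e.
  by rewrite -TrE// poweR_EFin -EFinM powR_mulrn ?Tr0.
have q0 (c : R) (T : R -> R) x : 0 <= c ^+ 2 * (ip x * T x ^+ 2).
  by apply: mulr_ge0; rewrite ?sqr_ge0// mulr_ge0 ?sqr_ge0 ?ip_ge0.
have qi0 (T : R -> R) x : 0 <= ip x * T x ^+ 2 by rewrite mulr_ge0 ?sqr_ge0 ?ip_ge0.
clearbody Tc Ts Tr G.
set J := (\int[leb]_y (G y ^+ 2)%:E)%E in Hc Hs Hr *.
have J0 : (0 <= J)%E by apply: integral_ge0 => y _; rewrite lee_fin sqr_ge0.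
clearbody J.
apply: (@le_trans _ _ (\int[leb]_x (s `^ (- a) * 3 * (al ^+ 2 * (ip x * Tc x ^+ 2) +
    be ^+ 2 * (ip x * Ts x ^+ 2) + M ^+ 2 * (ip x * Tr x ^+ 2)))%:E)%E).
  apply: le_ge0_integral => x _; rewrite lee_fin.
    by apply: mulr_ge0; [exact: wt_ge0|exact: sqr_ge0].
  have [x0|x0] := leP x 0; first by rewrite /wt ip0// !mul0r !mulr0 !addr0 mulr0.
  by apply: le_trans (main _ x0) _; rewrite (ip1 x0) !mul1r mulrA.
rewrite ge0_integral_mulc//; last 3 first.
- by rewrite mulr_ge0 ?powR_ge0.
- by move=> x _; rewrite !addr_ge0.
- by mea.
rewrite ge0_integral_add//; last 3 first.
- by move=> x _; rewrite addr_ge0.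
- by mea.
- by mea.
rewrite ge0_integral_add//; last 2 first.
- by mea.
- by mea.
rewrite !ge0_integral_mulc ?sqr_ge0//; last 3 first.
- by mea.
- by mea.
- by mea.
apply: (@le_trans _ _ ((s `^ (- a) * 3)%:E * ((al ^+ 2)%:E * ((expR 1 * (2 * pi / s))%:E * J) +
   (be ^+ 2)%:E * ((expR 1 * (2 * pi / s))%:E * J) + (M ^+ 2)%:E * ((pi ^+ 2 / s)%:E * J)))%E).
  rewrite lee_wpmul2l ?lee_fin ?mulr_ge0 ?powR_ge0//.
  by apply: leeD; [apply: leeD|]; rewrite lee_wpmul2l ?lee_fin ?sqr_ge0.
have t0 : 0 <= expR 1 * (2 * pi / s) by rewrite mulr_ge0 ?expR_ge0// divr_ge0 ?(ltW s0)// mulr_ge0 ?pi_ge0.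
have t1 : 0 <= pi ^+ 2 / s by rewrite divr_ge0 ?sqr_ge0 ?(ltW s0).
rewrite !muleA -!EFinM -!ge0_muleDl ?lee_fin ?addr_ge0//; try by rewrite mulr_ge0 ?sqr_ge0.
rewrite muleA -!EFinD -!EFinM lee_wpmul2r// lee_fin.
have -> : s `^ (- (a + 1)) = s `^ (- a) / s.
  rewrite opprD powRD ?(gt_eqF s0) ?implybT//; congr (_ * _).
  by rewrite powR_inv1 ?(ltW s0).
have st : 0 <= s `^ (- a) / s by rewrite divr_ge0 ?powR_ge0 ?(ltW s0).
rewrite [leLHS](_ : _ = (C - 1) * (s `^ (- a) / s)); last first.
  by rewrite /C /e1; field; rewrite gt_eqF.
by rewrite ler_wpM2r// gerBl.
Qed.

End hankel.

Ltac pos := repeat first [ assumption | exact: sqr_ge0 | exact: powR_ge0 | exact: normr_ge0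
  | exact: ler0n | exact: expR_ge0 | exact: wt_ge0 | by apply: ltW | by [] | apply: exprn_ge0
  | apply: mulr_ge0 | rewrite invr_ge0 | apply: addr_ge0 ].

(** * Interpolation *)

Section weak_to_strong.
Variable R : realType.
Local Notation leb := (@lebesgue_measure R).

Lemma powR2_gt1 (s : R) : 0 < s -> 1 < 2 `^ s.
Proof.
move=> s0; apply: (@le_lt_trans _ _ (1 `^ s)); first by rewrite powR1.
by apply: gt0_ltr_powR; rewrite ?nnegrE ?ler01 ?ler0n ?ltr1n.
Qed.

(** The minimum makes the induction close: if L <= D the bound for L/2 plus the first term is
    exactly the bound for L, and if L > D the first term vanishes while the minimum does not
    decrease when L/2 is replaced by L. *)
Lemma truncated_geometric_sum (s D : R) (n : nat) (L : R) : 0 < s -> 0 <= D -> 0 < L ->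
  \sum_(0 <= k < n) (L / 2 ^+ k) `^ s * (L / 2 ^+ k <= D)%R%:R <=
  (Num.min L D) `^ s / (1 - 2 `^ (- s)).
Proof.
move=> s0 D0.
have rho1 : 0 < 1 - 2 `^ (- s) :> R.
  by rewrite subr_gt0 powRN invf_lt1 ?powR_gt0// powR2_gt1.
elim: n L => [|n IH] L L0.
  by rewrite big_nil divr_ge0 ?powR_ge0 ?(ltW rho1).
rewrite big_nat_recl//= expr0 divr1.
have L20 : 0 < L / 2 by rewrite divr_gt0.
have E k : L / 2 ^+ k.+1 = L / 2 / 2 ^+ k by rewrite exprS invfM mulrA.
under eq_bigr do rewrite E.
have IH2 := IH _ L20; apply: le_trans (lerD (lexx _) IH2) _.
have [LD|DL] := leP L D.
  rewrite mulr1 min_l; last by apply: le_trans LD; rewrite ler_pdivrMr// ler_peMr ?(ltW L0)// ler1n.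
  rewrite powRM ?(ltW L0)// -powR_inv1// -powRrM mulN1r.
  rewrite le_eqVlt; apply/orP; left; apply/eqP; field; rewrite gt_eqF//.
rewrite mulr0 add0r ler_wpM2r ?invr_ge0 ?(ltW rho1)//.
have mL : Num.min (L / 2) D <= D by rewrite ge_min lexx orbT.
by apply: ge0_ler_powR; rewrite ?nnegrE ?(ltW s0)// le_min (ltW L20).
Qed.

(* Dyadic layer-cake: the levels are Lam / 2^k. *)
Lemma weak_to_strong (om w D u : R -> R) (Lam q e : R) :
  measurable_fun setT om -> measurable_fun setT w ->
  measurable_fun setT D -> measurable_fun setT u ->
  (forall x, 0 <= om x) -> (forall x, 0 <= w x) -> (forall x, 0 <= D x) ->
  (forall x, 0 <= u x) -> (forall x, u x <= Lam) -> 0 < q -> e < q ->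
  (forall mu, 0 < mu -> (\int[leb]_x (om x * (mu < u x)%R%:R)%:E <=
     \int[leb]_y (w y * mu `^ (- e) * (mu <= D y)%R%:R)%:E)%E) ->
  (\int[leb]_x (om x * u x `^ q)%:E <=
   (2 `^ q / (1 - 2 `^ (- (q - e))))%:E * \int[leb]_y (w y * D y `^ (q - e))%:E)%E.
Proof.
move=> mom mw mD mu om0 w0 D0 u0 uLam q0 eq H.
have s0 : 0 < q - e by rewrite subr_gt0.
have rho1 : 0 < 1 - 2 `^ (- (q - e)) :> R.
  by rewrite subr_gt0 powRN invf_lt1 ?powR_gt0// powR2_gt1.
(* Strictly above all values of [u], so the least k with [L k < u x] is positive; minimality then
   gives [u x <= 2 * L k]. *)
pose L0 := Lam + 1.
have L00 : 0 < L0 by rewrite /L0; have := le_trans (u0 0) (uLam 0); lra.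
pose L (k : nat) := L0 / 2 ^+ k.
have Lpos k : 0 < L k by rewrite divr_gt0 ?exprn_gt0.
have t1 x k : 0 <= om x * ((2 * L k) `^ q * (L k < u x)%R%:R) by rewrite !mulr_ge0 ?powR_ge0.
have t2 x k : 0 <= w x * (2 `^ q * (L k `^ (q - e) * (L k <= D x)%R%:R)) by rewrite !mulr_ge0 ?powR_ge0.
apply: (@le_trans _ _ (\int[leb]_x \sum_(0 <= k <oo) (om x * ((2 * L k) `^ q * (L k < u x)%R%:R))%:E)%E).
  apply: le_ge0_integral => x _; first by rewrite lee_fin mulr_ge0 ?powR_ge0.
  have [ux0|ux0] := leP (u x) 0.
    have ux : u x = 0 by apply/le_anti; rewrite ux0 u0.
    have -> : u x `^ q = 0 by rewrite ux powR0 ?(gt_eqF q0).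
    by rewrite mulr0; apply: nneseries_ge0 => k _ _; rewrite lee_fin.
  have ex : exists k, L k < u x.
    have [k hk] : exists k : nat, L0 / u x < k%:R.
      by exists (Num.truncn (L0 / u x)).+1; exact: truncnS_gt.
    exists k; rewrite /L ltr_pdivrMr ?exprn_gt0//.
    rewrite ltr_pdivrMr// in hk; apply: lt_trans hk _.
    rewrite mulrC ltr_pM2l//; elim: k => [|k IH]; first by rewrite expr0.
    rewrite exprS -natr1; have : (1 : R) <= 2 ^+ k by rewrite exprn_ege1// ler1n.
    by lra.
  case: (ex_minnP ex) => k Lk kmin.
  have k0 : (0 < k)%N.
    rewrite lt0n; apply/eqP => k0; move: Lk; rewrite k0 /L expr0 divr1 /L0.
    by have := uLam x; lra.
  have uk : u x <= 2 * L k.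
    rewrite leNgt; apply/negP => h; have : (k <= k.-1)%N.
      apply: kmin; apply: le_lt_trans h; rewrite /L -{2}(prednK k0) exprS.
      by rewrite le_eqVlt; apply/orP; left; apply/eqP; field; rewrite expf_neq0.
    by rewrite leqNgt prednK// leqnn.
  apply: le_trans (nneseries_lim_ge k.+1 _); last by move=> i _ _; rewrite lee_fin.
  rewrite big_nat_recr//= -[leLHS]add0e leeD//.
    by apply: sume_ge0 => i _; rewrite lee_fin.
  rewrite lee_fin Lk mulr1 ler_wpM2l//.
  by apply: ge0_ler_powR; rewrite ?nnegrE ?(ltW q0) ?(ltW ux0)// mulr_ge0// ltW.
rewrite integral_nneseries//; last 2 first.
- by move=> k; mea.
- by move=> k x _; rewrite lee_fin.
apply: (@le_trans _ _ (\sum_(0 <= k <oo) \int[leb]_x (w x * (2 `^ q * (L k `^ (q - e) * (L k <= D x)%R%:R)))%:E)%E).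
  apply: lee_nneseries => [k _ _|k _].
    by apply: integral_ge0 => x _; rewrite lee_fin.
  have c0 : 0 <= (2 * L k) `^ q by exact: powR_ge0.
  apply: (@le_trans _ _ (((2 * L k) `^ q)%:E * \int[leb]_x (om x * (L k < u x)%R%:R)%:E)%E).
    rewrite -ge0_integral_mulc//; last 2 first.
    - by move=> x _; rewrite mulr_ge0.
    - by mea.
    rewrite le_eqVlt; apply/orP; left; apply/eqP; apply: eq_integral => x _; congr EFin; ring.
  apply: le_trans (lee_wpmul2l _ (H _ (Lpos k))) _; first by rewrite lee_fin.
  rewrite -ge0_integral_mulc//; last 2 first.
  - by move=> x _; rewrite !mulr_ge0 ?powR_ge0.
  - by mea.
  rewrite le_eqVlt; apply/orP; left; apply/eqP; apply: eq_integral => x _; congr EFin.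
  rewrite powRM ?(ltW (Lpos k))// powRD ?(gt_eqF (Lpos k)) ?implybT//; ring.
rewrite -integral_nneseries//; last 2 first.
- by move=> k; mea.
- by move=> k x _; rewrite lee_fin.
rewrite -ge0_integral_mulc//; last 3 first.
- by rewrite divr_ge0 ?powR_ge0 ?(ltW rho1).
- by move=> x _; rewrite mulr_ge0 ?powR_ge0.
- by mea.
apply: le_ge0_integral => x _.
  by apply: nneseries_ge0 => k _ _; rewrite lee_fin.
apply: lime_le; first by apply: is_cvg_nneseries => k _ _; rewrite lee_fin.
near=> n; rewrite sumEFin lee_fin.
rewrite -mulr_sumr -mulr_sumr.
have h := truncated_geometric_sum n s0 (D0 x) L00.
apply: (@le_trans _ _ (w x * (2 `^ q * (D x `^ (q - e) / (1 - 2 `^ (- (q - e))))))).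
  rewrite ler_wpM2l// ler_wpM2l ?powR_ge0//; apply: le_trans h _.
  rewrite ler_wpM2r ?invr_ge0 ?(ltW rho1)//.
  have mL : Num.min L0 (D x) <= D x by rewrite ge_min lexx orbT.
  by apply: ge0_ler_powR; rewrite ?nnegrE ?(ltW s0) ?le_min ?(ltW L00) ?D0.
by rewrite le_eqVlt; apply/orP; left; apply/eqP; field; rewrite gt_eqF.
Unshelve. all: by end_near. Qed.

End weak_to_strong.

(** * The Hankel transform from the dual exponent r' to r *)

Section hankel_Lr.
Variable R : realType.
Local Notation leb := (@lebesgue_measure R).
Variable a : R.
Hypothesis a0 : 0 <= a.

Definition hconst : R := `|bphi a 0| + 1.

Lemma hconst_gt0 : 0 < hconst.
Proof. by rewrite /hconst ltr_wpDl. Qed.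

Lemma bphi_sqr_le z : `|bphi a (z ^+ 2 / 4)| <= hconst.
Proof.
apply: (@le_trans _ _ `|bphi a 0|); last by rewrite lerDl.
by apply: bphi_bounded => //; rewrite divr_ge0// sqr_ge0.
Qed.

Lemma norm_hankel_le s g x : measurable_fun setT g ->
  (`|hankel a s g x|%:E <= hconst%:E * \int[leb]_y (wt a y * `|g y|)%:E)%E.
Proof.
move=> mg; have mwt := @meas_wt R a.
apply: le_trans (norm_Rintegral_le _ _ _) _.
rewrite -ge0_integral_mulc ?(ltW hconst_gt0)//; last 2 first.
- by move=> y _; rewrite mulr_ge0 ?wt_ge0.
- by mea.
apply: le_ge0_integral => y _; rewrite lee_fin// normrM mulrC normrM (ger0_norm (wt_ge0 _ _)).
by rewrite ler_wpM2r ?bphi_sqr_le// mulr_ge0 ?wt_ge0.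
Qed.

Lemma meas_hankel s g : measurable_fun setT g -> measurable_fun setT (hankel a s g).
Proof.
move=> mg; have mwt := @meas_wt R a; have mb := meas_bphi a0.
apply: (@meas_Rintegral _ _ _ (fun x y => wt a y * g y * bphi a ((s * x * y) ^+ 2 / 4))).
by mea.
Qed.

Lemma hankelD s g1 g2 x :
  leb.-integrable setT (EFin \o (fun y => wt a y * g1 y)) ->
  leb.-integrable setT (EFin \o (fun y => wt a y * g2 y)) ->
  hankel a s (fun y => g1 y + g2 y) x = hankel a s g1 x + hankel a s g2 x.
Proof.
move=> i1 i2; have mb := meas_bphi a0.
have mk : measurable_fun setT (fun y => bphi a ((s * x * y) ^+ 2 / 4)) by mea.
have kM y := bphi_sqr_le (s * x * y).
rewrite /hankel -RintegralD//.
- by apply: eq_Rintegral => y _; ring.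
- exact: integrable_bdd_mul i1 mk kM.
- exact: integrable_bdd_mul i2 mk kM.
Qed.

(* At level [mu] the datum is cut where |g|^(-1/(r-1)) crosses a multiple of [mu]: the
   large values contribute at most [mu/2] pointwise, the small ones are estimated in L^2. *)
Lemma hankel_Lr (r : R) : 2 < r -> exists2 C : R, 0 < C & forall (s N : R) (g : R -> R), 0 < s -> 0 < N ->
  measurable_fun setT g -> leb.-integrable setT (EFin \o halfwt a g) ->
  leb.-integrable setT (EFin \o (fun y => wt a y * g y)) ->
  (\int[leb]_y (wt a y * `|g y| `^ (r / (r - 1)))%:E <= N%:E)%E ->
  (\int[leb]_x (wt a x * `|hankel a s g x| `^ r)%:E <= (C * s `^ (- (a + 1)) * N `^ (r - 1))%:E)%E.
Proof.
move=> r2; have [C0 C00 hC0] := hankel_L2 a0.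
have A0 := hconst_gt0; set A := hconst in A0.
have r1 : 0 < r - 1 by lra.
pose K := 2 `^ r / (1 - 2 `^ (- (r - 2))).
have K0 : 0 < K.
  rewrite divr_gt0 ?powR_gt0// subr_gt0 powRN invf_lt1 ?powR_gt0// powR2_gt1; lra.
have KE : 2 `^ r / (1 - 2 `^ (- (r - 2))) = K by [].
clearbody K.
exists (K * (4 * C0 * (2 * A) `^ (r - 2))).
  have A20 : 0 < 2 * A by rewrite mulr_gt0.
  by apply: mulr_gt0 => //; apply: mulr_gt0; [apply: mulr_gt0|exact: powR_gt0].
move=> s N g s0 N0 mg ih iw gN.
have mwt := @meas_wt R a.
have w0 y : 0 <= wt a y by exact: wt_ge0.
pose B := C0 * s `^ (- (a + 1)).
have B0 : 0 <= B by rewrite mulr_ge0 ?powR_ge0 ?(ltW C00).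
have BE : B = C0 * s `^ (- (a + 1)) by [].
clearbody B.
(* Where D y < mu, |g| = |g|^(-1/(r-1)) |g|^(r/(r-1)) <= mu/(2 A N) |g|^(r/(r-1)). This part has L^1
   norm at most mu/(2A), hence a transform bounded by mu/2. At zeros of g the power is 0 by
   convention and the point falls harmlessly into this part. *)
pose D y := 2 * A * N * `|g y| `^ (- (r - 1)^-1).
have D0 y : 0 <= D y by rewrite mulr_ge0 ?powR_ge0// !mulr_ge0 ?(ltW A0) ?(ltW N0).
have mD : measurable_fun setT D by rewrite /D; mea.
have DE y : D y = 2 * A * N * `|g y| `^ (- (r - 1)^-1) by [].
clearbody D.
have mH := @meas_hankel s g mg.
have iw' : (\int[leb]_y (wt a y * `|g y|)%:E < +oo)%E.
  case/integrableP : iw => _; apply: le_lt_trans; apply: le_ge0_integral => y _.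
    by rewrite lee_fin mulr_ge0.
  by rewrite /= lee_fin normrM (ger0_norm (w0 _)).
have [W WE] : exists W : R, (\int[leb]_y (wt a y * `|g y|)%:E)%E = W%:E.
  exists (fine (\int[leb]_y (wt a y * `|g y|)%:E)%E); rewrite fineK// ge0_fin_numE//.
  by apply: integral_ge0 => y _; rewrite lee_fin mulr_ge0.
have HW x : `|hankel a s g x| <= A * W.
  by rewrite -lee_fin EFinM -WE; exact: norm_hankel_le.
have wk (mu : R) : 0 < mu -> (\int[leb]_x (wt a x * (mu < `|hankel a s g x|)%R%:R)%:E <=
    \int[leb]_y (4 * B * (wt a y * g y ^+ 2) * mu `^ (- 2) * (mu <= D y)%R%:R)%:E)%E.
  move=> mu0.
  pose gl y := g y * (mu <= D y)%R%:R; pose gh y := g y * (D y < mu)%R%:R.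
  have gE y : g y = gl y + gh y by rewrite /gl /gh leNgt; case: ltP => _ /=; ring.
  have mgl : measurable_fun setT gl by rewrite /gl; mea.
  have mgh : measurable_fun setT gh by rewrite /gh; mea.
  have b1 (b : bool) : `|b%:R : R| <= 1 by case: b; rewrite ?normr1 ?normr0.
  have mbl : measurable_fun setT (fun y => (mu <= D y)%R%:R : R) by mea.
  have mbh : measurable_fun setT (fun y => (D y < mu)%R%:R : R) by mea.
  have iwl : leb.-integrable setT (EFin \o (fun y => wt a y * gl y)).
    have := integrable_bdd_mul iw mbl (fun y => b1 _).
    by congr (_.-integrable _ (EFin \o _)); apply/funext => y; rewrite /gl mulrA.
  have iwh : leb.-integrable setT (EFin \o (fun y => wt a y * gh y)).
    have := integrable_bdd_mul iw mbh (fun y => b1 _).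
    by congr (_.-integrable _ (EFin \o _)); apply/funext => y; rewrite /gh mulrA.
  have ihl : leb.-integrable setT (EFin \o halfwt a gl).
    have := integrable_bdd_mul ih mbl (fun y => b1 _).
    by congr (_.-integrable _ (EFin \o _)); apply/funext => y; rewrite /halfwt /gl mulrA.
  have HE x : hankel a s g x = hankel a s gl x + hankel a s gh x.
    by rewrite -hankelD//; congr (hankel a s _ x); apply/funext.
  have Hh x : `|hankel a s gh x| <= mu / 2.
    rewrite -lee_fin; apply: le_trans (norm_hankel_le s x mgh) _; rewrite -/A.
    have cc : 0 <= mu / (2 * A * N) by rewrite divr_ge0 ?(ltW mu0)// !mulr_ge0 ?(ltW A0) ?(ltW N0).
    have mgr : measurable_fun setT (fun y => wt a y * `|g y| `^ (r / (r - 1))) by mea.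
    have gr0 y : 0 <= wt a y * `|g y| `^ (r / (r - 1)) by rewrite mulr_ge0 ?powR_ge0.
    apply: (@le_trans _ _ (A%:E * ((mu / (2 * A * N))%:E * N%:E))%E); last first.
      by rewrite -!EFinM lee_fin le_eqVlt; apply/orP; left; apply/eqP; field; rewrite !gt_eqF.
    rewrite lee_wpmul2l ?lee_fin ?(ltW A0)//.
    apply: le_trans (lee_wpmul2l _ gN); last by rewrite lee_fin.
    rewrite -ge0_integral_mulc//.
    apply: le_ge0_integral => y _; rewrite lee_fin; first by rewrite mulr_ge0.
    rewrite mulrCA ler_wpM2l// /gh normrM.
    have [Dm|_] := ltP (D y) mu; last by rewrite normr0 mulr0 mulr_ge0 ?powR_ge0.
    rewrite normr1 mulr1.
    have [->|gy] := eqVneq (g y) 0; first by rewrite normr0 mulr_ge0 ?powR_ge0.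
    have gy0 : 0 < `|g y| by rewrite normr_gt0.
    rewrite DE in Dm; rewrite mulrAC ler_pdivlMr ?mulr_gt0//.
    have E : `|g y| = `|g y| `^ (- (r - 1)^-1) * `|g y| `^ (r / (r - 1)).
      rewrite -powRD ?(gt_eqF gy0) ?implybT//.
      have -> : - (r - 1)^-1 + r / (r - 1) = 1 by field; rewrite gt_eqF.
      by rewrite powRr1.
    have Q0 : 0 <= `|g y| `^ (r / (r - 1)) by exact: powR_ge0.
    move: E Dm Q0; move: (_ `^ (- _)) (_ `^ (_ / _)) => P Q E Dm Q0.
    rewrite [X in X * _]E mulrC mulrA ler_wpM2r//; exact: ltW.
  have mHl := @meas_hankel s gl mgl.
  (* Chebyshev: where the full transform exceeds mu, that of [gl] is at least mu/2, so 4 mu^(-2)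
     times its square is at least 1. *)
  apply: (@le_trans _ _ ((4 * mu `^ (- 2))%:E * \int[leb]_x (wt a x * hankel a s gl x ^+ 2)%:E)%E).
    rewrite -ge0_integral_mulc//; last 3 first.
    - by rewrite mulr_ge0 ?powR_ge0.
    - by move=> x _; rewrite mulr_ge0 ?sqr_ge0.
    - by mea.
    apply: le_ge0_integral => x _; rewrite lee_fin; first by rewrite mulr_ge0.
    rewrite mulrCA ler_wpM2l//.
    have [Hx|_] := ltP mu `|hankel a s g x|; last by rewrite mulr_ge0 ?sqr_ge0// mulr_ge0 ?powR_ge0.
    have hl : mu / 2 <= `|hankel a s gl x|.
      have : `|hankel a s g x| <= `|hankel a s gl x| + `|hankel a s gh x| by rewrite HE ler_normD.
      by have := Hh x; lra.
    have -> : mu `^ (- 2) = mu ^- 2 by rewrite powR_invn ?(ltW mu0).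
    rewrite mulrAC ler_pdivlMr ?exprn_gt0// mul1r -(real_normK (num_real (hankel a s gl x))).
    by move: `|_| hl => z hz; nra.
  have := hC0 s gl s0 mgl ihl; rewrite -BE => hB.
  apply: le_trans (lee_wpmul2l _ hB) _; first by rewrite lee_fin mulr_ge0 ?powR_ge0.
  rewrite muleA -EFinM -ge0_integral_mulc//; last 3 first.
  - by apply: mulr_ge0 => //; rewrite mulr_ge0 ?powR_ge0.
  - by move=> x _; rewrite mulr_ge0 ?sqr_ge0.
  - by mea.
  apply: le_ge0_integral => y _; rewrite lee_fin.
    by pos.
  rewrite le_eqVlt; apply/orP; left; apply/eqP; rewrite /gl exprMn.
  by case: (mu <= D y) => /=; rewrite ?expr1n ?expr0n/=; ring.
have W2S := @weak_to_strong R (wt a) (fun y => 4 * B * (wt a y * g y ^+ 2)) D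
  (fun x => `|hankel a s g x|) (A * W) r 2.
apply: le_trans (W2S _ _ _ _ _ _ _ _ _ _ _ _) _ => //.
- by mea.
- by mea.
- by move=> y; pos.
- by lra.
rewrite KE -(mulrA K) -(mulrA K) EFinM.
apply: lee_wpmul2l; first by rewrite lee_fin ltW.
have mgr : measurable_fun setT (fun y => wt a y * `|g y| `^ (r / (r - 1))) by mea.
have gr0 y : 0 <= wt a y * `|g y| `^ (r / (r - 1)) by rewrite mulr_ge0 ?powR_ge0.
have c0 : 0 <= 4 * B * (2 * A * N) `^ (r - 2) by rewrite !mulr_ge0 ?powR_ge0.
(* The exponents match because 2 - (r-2)/(r-1) = r/(r-1): the weak L^2 bound, summed over levels,
   returns the L^(r') integral of g. *)
rewrite (_ : (\int[leb]_y (4 * B * (wt a y * g y ^+ 2) * D y `^ (r - 2))%:E =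
   \int[leb]_y (4 * B * (2 * A * N) `^ (r - 2) * (wt a y * `|g y| `^ (r / (r - 1))))%:E)%E); last first.
  apply: eq_integral => y _; congr EFin.
  have -> : D y `^ (r - 2) = (2 * A * N) `^ (r - 2) * `|g y| `^ (- (r - 1)^-1 * (r - 2)).
    by rewrite DE powRM ?powR_ge0// ?mulr_ge0 ?(ltW A0) ?(ltW N0)// -powRrM.
  have -> : `|g y| `^ (r / (r - 1)) = g y ^+ 2 * `|g y| `^ (- (r - 1)^-1 * (r - 2)).
    have [->|gy] := eqVneq (g y) 0.
      by rewrite normr0 powR0 ?expr2 ?mul0r// mulf_neq0 ?invr_neq0// gt_eqF//; lra.
    have gy0 : 0 < `|g y| by rewrite normr_gt0.
    rewrite -(real_normK (num_real (g y))) -powR_mulrn// -powRD ?(gt_eqF gy0) ?implybT//.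
    by congr (_ `^ _); field; rewrite gt_eqF.
  by ring.
rewrite ge0_integral_mulc//; apply: le_trans (lee_wpmul2l _ gN) _; first by rewrite lee_fin.
rewrite -EFinM lee_fin powRM ?(ltW N0) ?mulr_ge0 ?(ltW A0)//.
have -> : N `^ (r - 1) = N `^ (r - 2) * N.
  rewrite -[X in _ = _ * X](powRr1 (ltW N0)) -powRD ?(gt_eqF N0) ?implybT//.
  by congr (_ `^ _); ring.
by rewrite le_eqVlt; apply/orP; left; apply/eqP; rewrite BE; ring.
Qed.

End hankel_Lr.

(** * The Hardy-Littlewood-Sobolev inequality *)

Section hls.
Variable R : realType.
Local Notation leb := (@lebesgue_measure R).

Lemma lee_poweR (x y : \bar R) (r : R) : 0 <= r -> (0 <= x)%E -> (x <= y)%E ->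
  (poweR x r <= poweR y r)%E.
Proof.
move=> r0 x0 xy; apply: gt0_ler_poweR => //; rewrite in_itv/= leey andbT//.
exact: le_trans xy.
Qed.

Lemma even_kernel_integral (k : R -> R) (M : R) : measurable_fun setT k ->
  (forall x, 0 <= k x) -> (\int[leb]_(x in `]0%R, +oo[) (k x)%:E <= M%:E)%E ->
  (\int[leb]_x (ip `|x| * k `|x|)%:E <= (2 * M)%:E)%E.
Proof.
move=> mk k0; rewrite integral_pos => kM; have mip := @meas_ip R.
have h0 x : 0 <= ip x * k x by rewrite mulr_ge0 ?ip_ge0.
rewrite (_ : (\int[leb]_x (ip `|x| * k `|x|)%:E)%E =
    (\int[leb]_x (ip x * k x + ip (- x) * k (- x))%:E)%E); last first.
  apply: eq_integral => x _; congr EFin.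
  have [x0|x0|<-] := ltgtP 0 x.
  - by rewrite gtr0_norm// (@ip0 _ (- x)) ?mul0r ?addr0// oppr_le0 ltW.
  - by rewrite ltr0_norm// (@ip0 _ x) ?mul0r ?add0r// ltW.
  - by rewrite normr0 oppr0 ip0// !mul0r addr0.
have mm : measurable_fun setT (fun x => ip x * k x) by mea.
rewrite ge0_integral_add//; last by mea.
rewrite (@ge0_integral_opp _ (fun x => (ip x * k x)%:E)); last 2 first.
- by mea.
- by move=> x; rewrite lee_fin.
by rewrite mulr2n mulrDl !mul1r EFinD leeD.
Qed.

Variable lam : R.
Hypotheses (lam0 : 0 < lam) (lam1 : lam < 1).

Let lam2 : 0 <= 2 - lam. Proof. by move: lam1; lra. Qed.

(** A majorant of |x|^(-lam) on |x| <= rho with an elementary integral: a rescaled [hker], where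
    2^(2-lam) compensates the factor (1 + |x|/rho)^(-(2-lam)), at least 2^(-(2-lam)) there. *)
Definition near_kernel (rho x : R) : R :=
  ip `|x| * (2 `^ (2 - lam) * rho `^ (- lam) * hker (1 - lam) (`|x| / rho)).

Definition near_const : R := 2 * (2 `^ (2 - lam) / (1 - lam)).

Lemma near_const_gt0 : 0 < near_const.
Proof. by rewrite mulr_gt0// divr_gt0 ?powR_gt0// subr_gt0. Qed.

Lemma near_kernel_ge0 rho x : 0 <= near_kernel rho x.
Proof.
rewrite /near_kernel; apply: mulr_ge0; first exact: ip_ge0.
by apply: mulr_ge0; [apply: mulr_ge0; exact: powR_ge0|exact: hker_ge0].
Qed.

Lemma meas_near_kernel rho : measurable_fun setT (near_kernel rho).
Proof. by have mip := @meas_ip R; rewrite /near_kernel /hker; mea. Qed.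

Lemma le_near_kernel rho x : 0 < rho -> `|x| <= rho -> `|x| `^ (- lam) <= near_kernel rho x.
Proof.
move=> rho0 xr; have [->|x0] := eqVneq x 0.
  by rewrite normr0 powR0 ?near_kernel_ge0// oppr_eq0 gt_eqF.
have ax0 : 0 < `|x| by rewrite normr_gt0.
have y0 : 0 < 1 + `|x| / rho by rewrite addr_gt0// divr_gt0.
rewrite /near_kernel ip1// mul1r /hker.
have -> : 1 - lam - 1 = - lam by ring.
rewrite powRM ?(ltW ax0) ?invr_ge0 ?(ltW rho0)//.
have E : rho `^ (- lam) * rho^-1 `^ (- lam) = 1.
  by rewrite -powRM ?invr_ge0 ?(ltW rho0)// divff ?gt_eqF// powR1.
rewrite (_ : 2 `^ (2 - lam) * rho `^ (- lam) * _ = `|x| `^ (- lam) *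
  (2 `^ (2 - lam) * (1 + `|x| / rho) `^ (- (1 - lam + 1))) * (rho `^ (- lam) * rho^-1 `^ (- lam))); last by ring.
rewrite E mulr1 ler_peMr ?powR_ge0//.
have -> : 1 - lam + 1 = 2 - lam by ring.
rewrite powRN ler_pdivlMr ?powR_gt0// mul1r.
apply: ge0_ler_powR; rewrite ?nnegrE ?(ltW y0) ?lam2//.
have : `|x| / rho <= 1 by rewrite ler_pdivrMr// mul1r.
lra.
Qed.

Lemma near_kernel_integral rho : 0 < rho ->
  (\int[leb]_x (near_kernel rho x)%:E <= (near_const * rho `^ (1 - lam))%:E)%E.
Proof.
move=> rho0; have s0 : 0 < 1 - lam by rewrite subr_gt0.
have c0 : 0 <= 2 `^ (2 - lam) * rho `^ (- lam) by rewrite mulr_ge0 ?powR_ge0.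
rewrite /near_const -mulrA.
apply: (@even_kernel_integral (fun x => 2 `^ (2 - lam) * rho `^ (- lam) * hker (1 - lam) (x / rho))).
- by rewrite /hker; mea.
- by move=> x; apply: mulr_ge0 => //; exact: hker_ge0.
have dx (x : R) : is_derive x 1 (fun x => x / rho) rho^-1.
  by have := der_mul (der_id x) (der_cst rho^-1 x); rewrite mul1r mulr0 addr0.
have dF (x : R) : 0 < x -> is_derive x 1 (fun x => rho * ((1 - lam)^-1 * (x / rho / (1 + x / rho)) `^ (1 - lam)))
    (hker (1 - lam) (x / rho)).
  move=> x0; have xr : 0 < x / rho by rewrite divr_gt0.
  have h := @der_hker _ (1 - lam) (x / rho) s0 xr.
  notypeclasses refine (der_eq (der_mul (der_cst rho x) (@der_comp _ _ (fun x => x / rho) x _ _ h (dx x))) _).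
  by rewrite mul0r add0r mulrCA divff ?mulr1// gt_eqF.
rewrite ge0_integral_mulc//; last 2 first.
- by move=> x _; exact: hker_ge0.
- by rewrite /hker; mea.
have -> : 2 `^ (2 - lam) / (1 - lam) * rho `^ (1 - lam) =
    2 `^ (2 - lam) * rho `^ (- lam) * (rho * (1 - lam)^-1).
  have -> : rho `^ (1 - lam) = rho * rho `^ (- lam).
    by rewrite powRD ?(gt_eqF rho0) ?implybT// powRr1 ?(ltW rho0).
  ring.
rewrite [in leRHS]EFinM; apply: lee_wpmul2l; first by rewrite lee_fin.
apply: ge0_FTC_le dF _.
- by move=> x x0; exact: hker_ge0.
- move=> x x0; have xr : 0 < x / rho by rewrite divr_gt0.
  rewrite /hker; apply: der_continuous; notypeclasses refine (der_eq _ (erefl _)); der.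
  all: rewrite ?gt_eqF ?addr_gt0//.
move=> x y x0 y0; rewrite -mulrBr ler_wpM2l ?(ltW rho0)// -mulrBr ler_piMr ?invr_ge0 ?(ltW s0)//.
have h z : 0 < z -> 0 <= (z / rho / (1 + z / rho)) `^ (1 - lam) <= 1.
  move=> z0; rewrite powR_ge0/=; apply: (@le_trans _ _ (1 `^ (1 - lam))); last by rewrite powR1.
  have zr : 0 < z / rho by rewrite divr_gt0.
  have z1 : 0 < 1 + z / rho by rewrite addr_gt0.
  apply: ge0_ler_powR; rewrite ?nnegrE ?(ltW s0) ?ler01//; first by rewrite divr_ge0 ?ltW.
  by rewrite ler_pdivrMr// mul1r lerDr.
by have := h x x0; have := h y y0; lra.
Qed.

(** For |x| > rho this dominates |x|^(-2), as rho + |x| <= 2 |x|. Since lam q = 2, its power 1/q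
    dominates |x|^(-lam), and the q-th power of that is integrable, as the Hoelder inequality
    demands. *)
Definition far_kernel (rho x : R) : R := ip `|x| * (4 * ((rho + `|x|) ^+ 2)^-1).

Lemma far_kernel_ge0 rho x : 0 <= far_kernel rho x.
Proof. by rewrite /far_kernel mulr_ge0 ?ip_ge0// mulr_ge0// invr_ge0 sqr_ge0. Qed.

Lemma meas_far_kernel rho : measurable_fun setT (far_kernel rho).
Proof. by have mip := @meas_ip R; rewrite /far_kernel; mea. Qed.

Lemma far_kernel_integral rho : 0 < rho ->
  (\int[leb]_x (far_kernel rho x)%:E <= (8 / rho)%:E)%E.
Proof.
move=> rho0; rewrite (_ : 8 / rho = 2 * (4 / rho)); last by rewrite mulrA -natrM.
apply: (@even_kernel_integral (fun x => 4 * ((rho + x) ^+ 2)^-1)).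
- by mea.
- by move=> x; rewrite mulr_ge0// invr_ge0 sqr_ge0.
have dF (x : R) : 0 < x -> is_derive x 1 (fun x => - (4 * (rho + x)^-1)) (4 * ((rho + x) ^+ 2)^-1).
  move=> x0; notypeclasses refine (der_eq _ _); first by der; rewrite gt_eqF// addr_gt0.
  by rewrite /=; field; rewrite gt_eqF// addr_gt0.
apply: ge0_FTC_le dF _.
- by move=> x x0; rewrite mulr_ge0// invr_ge0 sqr_ge0.
- move=> x x0; apply: der_continuous; notypeclasses refine (der_eq _ (erefl _)); der.
  by rewrite expf_neq0// gt_eqF// addr_gt0.
move=> x y x0 y0.
have : 0 <= 4 * (rho + y)^-1 by rewrite mulr_ge0// invr_ge0 ltW// addr_gt0.
have : 4 * (rho + x)^-1 <= 4 / rho.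
  by rewrite ler_wpM2l// lef_pV2 ?posrE ?addr_gt0// lerDl ltW.
lra.
Qed.

Variable q : R.
Hypothesis lamq : lam * q = 2.

Let q0 : 0 < q.
Proof. by rewrite -(pmulr_rgt0 _ lam0) lamq. Qed.

Let q2 : 2 < q.
Proof. by rewrite -lamq gtr_pMl. Qed.

Lemma le_far_kernel rho x : 0 < rho -> rho < `|x| ->
  `|x| `^ (- lam) <= far_kernel rho x `^ (q^-1).
Proof.
move=> rho0 xr; have x0 : 0 < `|x| by exact: lt_trans xr.
have -> : `|x| `^ (- lam) = (`|x| `^ (- 2)) `^ (q^-1).
  by rewrite -powRrM; congr (_ `^ _); rewrite -lamq; field; rewrite gt_eqF.
apply: ge0_ler_powR; rewrite ?nnegrE ?powR_ge0 ?far_kernel_ge0 ?invr_ge0 ?(ltW q0)//.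
rewrite /far_kernel ip1// mul1r powR_invn ?(ltW x0)//.
have r0 : 0 < rho + `|x| by rewrite addr_gt0.
rewrite ler_pdivlMr ?exprn_gt0// mulrC ler_pdivrMr ?exprn_gt0//.
by move: `|x| xr x0 r0 => z; nra.
Qed.

Section potential.
Variable n : R -> R.
Hypotheses (mn : measurable_fun setT n) (n0 : forall x, 0 <= n x).

Lemma riesz_kernel_ge0 t x : 0 <= `|t - x| `^ (- lam) * n x.
Proof. by rewrite mulr_ge0 ?powR_ge0. Qed.

Lemma integral_reflect (k : R -> R) (t : R) : measurable_fun setT k -> (forall x, 0 <= k x) ->
  (\int[leb]_x (k (t - x))%:E = \int[leb]_x (k x)%:E)%E.
Proof.
move=> mk k0.
have mk' : measurable_fun setT (fun x : R => (k (- x))%:E) by mea.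
rewrite -(@ge0_integral_opp _ (fun x => (k x)%:E)); last 2 first.
- by mea.
- by move=> x; rewrite lee_fin.
rewrite -(ge0_integral_shift (- t) mk'); last by move=> x; rewrite lee_fin.
by apply: eq_integral => x _; congr ((k _)%:E); ring.
Qed.

(** Within distance 1 the kernel is integrable and n bounded; beyond, the kernel is at most 1 and n
    integrable. The bound makes the potential a real bounded function and does not enter the
    constant of [hls]. *)
Lemma riesz_bounded (B W : R) : 0 <= B -> (forall x, n x <= B) ->
  (\int[leb]_x (n x)%:E <= W%:E)%E -> forall t,
  (\int[leb]_x (`|t - x| `^ (- lam) * n x)%:E <= (B * near_const + W)%:E)%E.
Proof.
move=> B0 nB nW t; have mk := meas_near_kernel 1.
apply: (@le_trans _ _ (\int[leb]_x (B * near_kernel 1 (t - x) + n x)%:E)%E).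
  apply: le_ge0_integral => x _; first by rewrite lee_fin riesz_kernel_ge0.
  rewrite lee_fin; have [tx|tx] := leP `|t - x| 1.
    rewrite -[leLHS]addr0 lerD// mulrC.
    by apply: ler_pM; rewrite ?powR_ge0// le_near_kernel.
  rewrite -[leLHS]add0r lerD ?mulr_ge0 ?near_kernel_ge0// ler_piMl//.
  have h : 1 <= `|t - x| `^ lam.
    apply: (@le_trans _ _ (1 `^ lam)); first by rewrite powR1.
    by apply: ge0_ler_powR; rewrite ?nnegrE ?(ltW lam0) ?(ltW tx).
  by rewrite powRN invf_le1// (lt_le_trans ltr01).
rewrite ge0_integral_add//; last 2 first.
- by move=> x _; rewrite mulr_ge0 ?near_kernel_ge0.
- by mea.
rewrite EFinD; apply: leeD => //.
rewrite (@ge0_integral_mulc _ _ _ leb setT measurableT B (fun x => near_kernel 1 (t - x)))//; last 2 first.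
- by move=> x _; exact: near_kernel_ge0.
- by mea.
rewrite (@integral_reflect (near_kernel 1))//; last exact: near_kernel_ge0.
rewrite EFinM; apply: lee_wpmul2l; first by rewrite lee_fin.
by apply: le_trans (near_kernel_integral ltr01) _; rewrite powR1 mulr1.
Qed.

Lemma far_potential_le (S rho t : R) : 0 < S -> 0 < rho ->
  (\int[leb]_x (n x `^ (q / (q - 1)))%:E <= S%:E)%E ->
  (\int[leb]_x (far_kernel rho (t - x) `^ (q^-1) * n x)%:E <=
   ((8 / rho) `^ (q^-1) * S `^ ((q - 1) / q))%:E)%E.
Proof.
move=> S0 rho0 nS; have mk := meas_far_kernel rho; have q1 : 0 < q - 1 by move: q2; lra.
have q'0 : 0 < q / (q - 1) by rewrite divr_gt0.
have qq : q^-1 + (q / (q - 1))^-1 = 1 by field; rewrite !gt_eqF.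
have mf : measurable_fun setT (fun x : R => far_kernel rho (t - x) `^ (q^-1)) by mea.
apply: le_trans (ge0_hoelder mf mn _ n0 q0 q'0 qq) _; first by move=> x; exact: powR_ge0.
rewrite EFinM (_ : (q / (q - 1))^-1 = (q - 1) / q); last by rewrite invfM invrK mulrC.
have -> : (\int[leb]_x ((far_kernel rho (t - x) `^ q^-1) `^ q)%:E)%E = (\int[leb]_x (far_kernel rho x)%:E)%E.
  rewrite -(@integral_reflect (far_kernel rho) t)//; last exact: far_kernel_ge0.
  by apply: eq_integral => x _; rewrite -powRrM mulVf ?gt_eqF// powRr1 ?far_kernel_ge0.
have i0 : (0 <= \int[leb]_x (far_kernel rho x)%:E)%E.
  by apply: integral_ge0 => x _; rewrite lee_fin far_kernel_ge0.
have j0 : (0 <= \int[leb]_x (n x `^ (q / (q - 1)))%:E)%E.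
  by apply: integral_ge0 => x _; rewrite lee_fin powR_ge0.
rewrite -!poweR_EFin; apply: lee_pmul; rewrite ?poweR_ge0//.
  by apply: lee_poweR; [rewrite invr_ge0 ltW|exact: i0|exact: far_kernel_integral].
by apply: lee_poweR => //; rewrite divr_ge0 ?(ltW q0) ?(ltW q1).
Qed.

End potential.

(* For each level [mu], the kernel is split at the radius [rho] and [n] where [D]
   crosses [mu]; both are chosen so that the far part and the near part of the small
   values of [n] contribute at most [mu/4] each. *)
Lemma hls : exists2 C : R, 0 < C & forall (n : R -> R) (B W S : R),
  measurable_fun setT n -> (forall x, 0 <= n x) -> (forall x, n x <= B) ->
  (\int[leb]_x (n x)%:E <= W%:E)%E -> 0 < S ->
  (\int[leb]_x (n x `^ (q / (q - 1)))%:E <= S%:E)%E ->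
  (\int[leb]_t poweR (\int[leb]_x (`|t - x| `^ (- lam) * n x)%:E) q <= (C * S `^ (q - 1))%:E)%E.
Proof.
have q1 : 0 < q - 1 by move: q2; lra.
pose K := 2 `^ q / (1 - 2 `^ (- (q - (q - 1)))).
have K0 : 0 < K.
  rewrite divr_gt0 ?powR_gt0// subr_gt0 powRN invf_lt1 ?powR_gt0// powR2_gt1//.
  by rewrite subKr.
have KE : 2 `^ q / (1 - 2 `^ (- (q - (q - 1)))) = K by [].
clearbody K.
pose c1 := 8 * 4 `^ q.
have c10 : 0 < c1 by rewrite mulr_gt0 ?powR_gt0.
have c1E : c1 = 8 * 4 `^ q by [].
clearbody c1.
pose z := near_const * c1 `^ (1 - lam).
have z0 : 0 < z by rewrite /z mulr_gt0 ?near_const_gt0 ?powR_gt0.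
have zE : z = near_const * c1 `^ (1 - lam) by [].
clearbody z.
have z40 : 0 < 4 * z by rewrite mulr_gt0.
exists (K * (2 * z * (4 * z) `^ ((q - 1)^-1))).
  by apply: mulr_gt0 => //; apply: mulr_gt0; [rewrite mulr_gt0|exact: powR_gt0].
move=> n B W S mn n0 nB nW S0 nS.
have B0 : 0 <= B by exact: le_trans (n0 0) (nB 0).
have rk0 t x : (0 <= (`|t - x| `^ (- lam) * n x)%:E)%E by rewrite lee_fin riesz_kernel_ge0.
pose u t := fine (\int[leb]_x (`|t - x| `^ (- lam) * n x)%:E)%E.
have uE t : (\int[leb]_x (`|t - x| `^ (- lam) * n x)%:E)%E = (u t)%:E.
  rewrite /u fineK// ge0_fin_numE; last by apply: integral_ge0 => x _.
  by apply: le_lt_trans (riesz_bounded mn n0 B0 nB nW t) _; exact: ltry.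
have mu_ : measurable_fun setT u.
  have h : measurable_fun setT (fun t : R => Rintegral leb setT (fun x : R => `|t - x| `^ (- lam) * n x)).
    by apply: (@meas_Rintegral _ _ R (fun t x : R => `|t - x| `^ (- lam) * n x)); mea.
  exact: h.
have u0 t : 0 <= u t by rewrite -lee_fin -uE integral_ge0.
have uL t : u t <= B * near_const + W by rewrite -lee_fin -uE; exact: riesz_bounded.
clearbody u.
pose Z := z * S `^ ((q - 1) * (1 - lam)).
have Z0 : 0 < Z by rewrite /Z mulr_gt0 ?powR_gt0.
have ZE : Z = z * S `^ ((q - 1) * (1 - lam)) by [].
clearbody Z.
(* D x < mu means n x < mu^(q-1)/(4Z). The near kernel has mass at most Z mu^(-(q-2)) for the radius
   chosen below, so these small values contribute at most mu/4. *)
pose D x := (4 * Z * n x) `^ ((q - 1)^-1).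
have DE x : D x = (4 * Z * n x) `^ ((q - 1)^-1) by [].
have mD : measurable_fun setT D by rewrite /D; mea.
have D0 x : 0 <= D x by exact: powR_ge0.
clearbody D.
have wk (mu : R) : 0 < mu -> (\int[leb]_t (1 * (mu < u t)%R%:R)%:E <=
    \int[leb]_x (2 * Z * n x * mu `^ (- (q - 1)) * (mu <= D x)%R%:R)%:E)%E.
  move=> mu0.
  (* Solves (8/rho)^(1/q) S^((q-1)/q) = mu/4, the Hoelder bound for the far part. *)
  pose rho := c1 * S `^ (q - 1) * mu `^ (- q).
  have rho0 : 0 < rho by rewrite !mulr_gt0 ?powR_gt0.
  have rhoE : rho = c1 * S `^ (q - 1) * mu `^ (- q) by [].
  clearbody rho.
  pose nl x := n x * (D x < mu)%R%:R; pose nh x := n x * (mu <= D x)%R%:R.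
  have mnl : measurable_fun setT nl by rewrite /nl; mea.
  have mnh : measurable_fun setT nh by rewrite /nh; mea.
  have nl0 x : 0 <= nl x by rewrite mulr_ge0.
  have nh0 x : 0 <= nh x by rewrite mulr_ge0.
  have nE x : n x = nl x + nh x by rewrite /nl /nh leNgt; case: ltP => _ /=; ring.
  have mnk := meas_near_kernel rho; have nk0 := near_kernel_ge0 rho.
  have mfk := meas_far_kernel rho.
  have nearE : near_const * rho `^ (1 - lam) = Z * mu `^ (- (q - 2)).
    rewrite ZE zE rhoE !powRM ?mulr_ge0 ?powR_ge0 ?(ltW c10)// -!powRrM.
    have -> : - q * (1 - lam) = - (q - 2) by rewrite -lamq; ring.
    by ring.
  have far_le t : (\int[leb]_x (far_kernel rho (t - x) `^ q^-1 * n x)%:E <= (mu / 4)%:E)%E.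
    apply: le_trans (far_potential_le mn n0 t S0 rho0 nS) _.
    have E8 : 8 / rho = (mu / 4) `^ q * (S `^ (- (q - 1))).
      have E4 : (4^-1 : R) `^ q = (4 `^ q)^-1 by rewrite -powR_inv1// -powRrM mulN1r powRN.
      rewrite rhoE c1E !powRN powRM ?(ltW mu0)// E4.
      by field; rewrite !gt_eqF ?powR_gt0.
    rewrite E8 lee_fin powRM ?powR_ge0// -!powRrM divff ?gt_eqF// powRr1 ?divr_ge0 ?(ltW mu0)//.
    rewrite -mulrA -powRD ?(gt_eqF S0) ?implybT//.
    by rewrite mulNr addNr powRr0 mulr1.
  have nl_le x : nl x <= mu `^ (q - 1) / (4 * Z).
    rewrite /nl; have [Dm|_] := ltP (D x) mu; last first.
      by rewrite mulr0 divr_ge0 ?powR_ge0// mulr_ge0 ?(ltW Z0).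
    rewrite mulr1 ler_pdivlMr ?mulr_gt0// mulrC.
    have y0 : 0 <= 4 * Z * n x by rewrite mulr_ge0// mulr_ge0 ?(ltW Z0).
    have <- : D x `^ (q - 1) = 4 * Z * n x by rewrite DE -powRrM mulVf ?gt_eqF// powRr1.
    by apply: ge0_ler_powR; rewrite ?nnegrE ?(ltW q1) ?(ltW mu0) ?(ltW Dm).
  have mrk t : measurable_fun setT (fun x : R => near_kernel rho (t - x)) by mea.
  have low_le t : (\int[leb]_x (near_kernel rho (t - x) * nl x)%:E <= (mu / 4)%:E)%E.
    have c0 : 0 <= mu `^ (q - 1) / (4 * Z) by rewrite divr_ge0 ?powR_ge0// mulr_ge0 ?(ltW Z0).
    apply: (@le_trans _ _ ((mu `^ (q - 1) / (4 * Z))%:E * \int[leb]_x (near_kernel rho (t - x))%:E)%E).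
      rewrite -(@ge0_integral_mulc _ _ _ leb setT measurableT _ (fun x => near_kernel rho (t - x)))//; last exact: (mrk t).
      apply: le_ge0_integral => x _; rewrite lee_fin; first by rewrite mulr_ge0.
      by rewrite mulrC ler_wpM2r.
    rewrite (@integral_reflect (near_kernel rho))//.
    apply: le_trans (lee_wpmul2l _ (near_kernel_integral rho0)) _; first by rewrite lee_fin.
    rewrite nearE -EFinM lee_fin le_eqVlt; apply/orP; left; apply/eqP.
    have -> : mu `^ (q - 1) = mu * mu `^ (q - 2).
      rewrite -{2}(powRr1 (ltW mu0)) -powRD ?(gt_eqF mu0) ?implybT//.
      by congr (_ `^ _); ring.
    by rewrite powRN; field; rewrite !gt_eqF// powR_gt0.
  have split_le t : ((u t)%:E <= (mu / 4)%:E + ((mu / 4)%:E + \int[leb]_x (near_kernel rho (t - x) * nh x)%:E))%E.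
    rewrite -uE.
    have mf1 : measurable_fun setT (fun x : R => far_kernel rho (t - x) `^ q^-1 * n x) by mea.
    have mf2 : measurable_fun setT (fun x : R => near_kernel rho (t - x) * nl x) by mea.
    have mf3 : measurable_fun setT (fun x : R => near_kernel rho (t - x) * nh x) by mea.
    have f10 x : 0 <= far_kernel rho (t - x) `^ q^-1 * n x by rewrite mulr_ge0 ?powR_ge0.
    have f20 x : 0 <= near_kernel rho (t - x) * nl x by rewrite mulr_ge0.
    have f30 x : 0 <= near_kernel rho (t - x) * nh x by rewrite mulr_ge0.
    apply: (@le_trans _ _ (\int[leb]_x (far_kernel rho (t - x) `^ q^-1 * n x +
       (near_kernel rho (t - x) * nl x + near_kernel rho (t - x) * nh x))%:E)%E).
      apply: le_ge0_integral => x _; rewrite // lee_fin.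
      rewrite -mulrDr -nE -mulrDl ler_wpM2r//.
      have [h|h] := leP `|t - x| rho.
        by rewrite -[leLHS]add0r lerD ?powR_ge0// le_near_kernel.
      by rewrite -[leLHS]addr0 lerD// le_far_kernel.
    rewrite ge0_integral_add//; last 2 first.
    - by move=> x _; rewrite addr_ge0.
    - exact: meas_add.
    rewrite ge0_integral_add//.
    by apply: leeD => //; apply: leeD.
  have mk2 : measurable_fun setT (fun p : R * R => (near_kernel rho (p.1 - p.2) * nh p.2)%:E) by mea.
  have i0 t : (0 <= \int[leb]_x (near_kernel rho (t - x) * nh x)%:E)%E.
    by apply: integral_ge0 => x _; rewrite lee_fin mulr_ge0.
  (* Chebyshev in L^1: where u > mu, the near part of the large values exceeds mu/2. *)
  apply: (@le_trans _ _ (\int[leb]_t ((2 / mu)%:E * \int[leb]_x (near_kernel rho (t - x) * nh x)%:E))%E).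
    apply: le_ge0_integral => t _; first by rewrite lee_fin mul1r.
    have [mt|_] := ltP mu (u t); last by rewrite mulr0 mule_ge0// lee_fin divr_ge0 ?(ltW mu0).
    have := split_le t; have := i0 t.
    case: (\int[leb]_x (near_kernel rho (t - x) * nh x)%:E)%E => [v| |] //=.
      rewrite -!EFinD -EFinM !lee_fin mulr1 => v0 h.
      rewrite mulrAC ler_pdivlMr//; lra.
    by move=> _ _; rewrite gt0_muley ?leey// lte_fin divr_gt0.
  rewrite ge0_integralZl_EFin//; last 2 first.
  - apply: (@meas_integral _ _ R (fun t x : R => (near_kernel rho (t - x) * nh x)%:E) mk2).
    by move=> t x; rewrite lee_fin mulr_ge0.
  - by rewrite divr_ge0 ?(ltW mu0).
  rewrite (@tonelli _ (fun t x => (near_kernel rho (t - x) * nh x)%:E))//; last first.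
    by move=> t x; rewrite lee_fin mulr_ge0.
  rewrite (_ : (\int[leb]_x \int[leb]_t (near_kernel rho (t - x) * nh x)%:E)%E =
     (\int[leb]_x ((nh x)%:E * \int[leb]_t (near_kernel rho t)%:E))%E); last first.
    apply: eq_integral => x _.
    rewrite -(@ge0_integral_shift _ (fun t => (near_kernel rho t)%:E) (- x)); last 2 first.
    - by mea.
    - by move=> t; rewrite lee_fin.
    rewrite -(@ge0_integral_mulc _ _ _ leb setT measurableT (nh x) (fun t => near_kernel rho (t - x)))//.
      by apply: eq_integral => t _; rewrite mulrC.
    by mea.
  have I0 : (0 <= \int[leb]_t (near_kernel rho t)%:E)%E.
    by apply: integral_ge0 => x _; rewrite lee_fin.
  apply: (@le_trans _ _ ((2 / mu)%:E * \int[leb]_x ((near_const * rho `^ (1 - lam)) * nh x)%:E)%E).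
    apply: lee_wpmul2l; first by rewrite lee_fin divr_ge0 ?(ltW mu0).
    apply: le_ge0_integral => x _; first by rewrite mule_ge0 ?lee_fin.
    rewrite muleC [in leRHS]EFinM; apply: lee_wpmul2r; first by rewrite lee_fin.
    exact: near_kernel_integral.
  have c0 : 0 <= near_const * rho `^ (1 - lam) by rewrite mulr_ge0 ?powR_ge0// ltW ?near_const_gt0.
  rewrite -ge0_integral_mulc//; last 3 first.
  - by rewrite divr_ge0 ?(ltW mu0).
  - by move=> x _; rewrite mulr_ge0.
  - by mea.
  rewrite nearE le_eqVlt; apply/orP; left; apply/eqP; apply: eq_integral => x _; congr EFin.
  have -> : mu `^ (- (q - 1)) = mu^-1 * mu `^ (- (q - 2)).
    rewrite -powR_inv1 ?(ltW mu0)// -powRD ?(gt_eqF mu0) ?implybT//.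
    by congr (_ `^ _); ring.
  by rewrite /nh; ring.
rewrite (_ : (\int[leb]_t poweR (\int[leb]_x (`|t - x| `^ (- lam) * n x)%:E) q)%E =
  (\int[leb]_t (1 * u t `^ q)%:E)%E); last first.
  by apply: eq_integral => t _; rewrite uE poweR_EFin mul1r.
(* Here e = q - 1, so D enters with exponent 1, and n D is a multiple of n^(1 + 1/(q-1)) =
   n^(q'). *)
apply: le_trans (@weak_to_strong R (cst 1) (fun x => 2 * Z * n x) D u _ q (q - 1)
  _ _ _ _ _ _ _ _ uL _ _ wk) _ => //.
- by mea.
- by move=> x; rewrite mulr_ge0// mulr_ge0 ?(ltW Z0).
- by rewrite ltrBlDr ltrDl.
have Z40 : 0 < 4 * Z by rewrite mulr_gt0.
have mnq : measurable_fun setT (fun x => n x `^ (q / (q - 1))) by mea.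
rewrite (_ : (\int[leb]_x (2 * Z * n x * D x `^ (q - (q - 1)))%:E)%E =
  ((2 * Z * (4 * Z) `^ (q - 1)^-1)%:E * \int[leb]_x (n x `^ (q / (q - 1)))%:E)%E); last first.
  have c0 : 0 <= 2 * Z * (4 * Z) `^ (q - 1)^-1 by rewrite !mulr_ge0 ?powR_ge0 ?(ltW Z0).
  rewrite -(@ge0_integral_mulc _ _ _ leb setT measurableT _ (fun x => n x `^ (q / (q - 1))) c0
    (fun x _ => powR_ge0 _ _) mnq).
  apply: eq_integral => x _; congr EFin.
  rewrite subKr powRr1// DE powRM ?(ltW Z40)//.
  have -> : n x `^ (q / (q - 1)) = n x * n x `^ (q - 1)^-1.
    have [->|nx] := eqVneq (n x) 0.
      by rewrite mul0r powR0// gt_eqF// divr_gt0.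
    rewrite -{2}(powRr1 (n0 x)) -powRD ?nx ?implybT//.
    by congr (_ `^ _); field; rewrite gt_eqF.
  by ring.
rewrite KE muleA -EFinM.
have c0 : 0 <= K * (2 * Z * (4 * Z) `^ (q - 1)^-1) by rewrite mulr_ge0 ?(ltW K0)// !mulr_ge0 ?powR_ge0 ?(ltW Z0).
apply: le_trans (lee_wpmul2l _ nS) _; first by rewrite lee_fin.
rewrite -EFinM lee_fin le_eqVlt; apply/orP; left; apply/eqP.
have -> : 4 * Z = 4 * z * S `^ ((q - 1) * (1 - lam)) by rewrite ZE mulrA.
rewrite powRM ?(ltW z40) ?powR_ge0// -powRrM.
have -> : (q - 1) * (1 - lam) / (q - 1) = 1 - lam by field; rewrite gt_eqF.
(* The exponents add up to q - lam q + 1, which is q - 1 because lam q = 2. *)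
have -> : S `^ (q - 1) = S `^ ((q - 1) * (1 - lam)) * S `^ (1 - lam) * S.
  rewrite -{4}(powRr1 (ltW S0)) -!powRD ?(gt_eqF S0) ?implybT//.
  congr (_ `^ _).
  have -> : (q - 1) * (1 - lam) + (1 - lam) + 1 = q - lam * q + 1 by ring.
  by rewrite lamq; ring.
by rewrite ZE; ring.
Qed.

End hls.

(** * The Strichartz estimate *)

Section plane.
Variable R : realType.
Local Notation leb := (@lebesgue_measure R).

Lemma rat_neighbourhood (x e : R) : 0 < e -> exists a b : rat,
  (x \in `]ratr a, ratr b[) /\ forall y : R, (y \in `]ratr a, ratr b[) -> `|x - y| < e.
Proof.
move=> e0.
have [|a] := @rat_in_itvoo R (x - e) x; first by rewrite ltrBlDr ltrDl.
have [|b] := @rat_in_itvoo R x (x + e); first by rewrite ltrDl.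
rewrite !in_itv/= => /andP[xb be] /andP[ea ax].
exists a, b; rewrite in_itv/= ax xb; split=> // y.
by rewrite in_itv/= => /andP[ay yb]; rewrite ltr_norml; lra.
Qed.

(** Measurability on the plane refers to the product sigma-algebra; an open set belongs to it as a
    countable union of rational boxes. *)
Lemma open_measurable_plane (U : set (R * R)) : open U -> measurable U.
Proof.
move=> oU.
pose box (a b c d : rat) : set (R * R) := `]ratr a, ratr b[%classic `*` `]ratr c, ratr d[%classic.
have -> : U = \bigcup_a \bigcup_b \bigcup_c \bigcup_d
    (if pselect (box a b c d `<=` U) then box a b c d else set0).
  apply/seteqP; split => [[x t] Uxt|p [a _ [b _ [c _ [d _]]]]]; last first.
    by case: pselect => // h; exact: h.
  have /nbhs_ballP[e /= e0 eU] := open_nbhs_nbhs (conj oU Uxt).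
  have [a [b [xab hab]]] := rat_neighbourhood x e0.
  have [c [d [tcd hcd]]] := rat_neighbourhood t e0.
  exists a => //; exists b => //; exists c => //; exists d => //.
  case: pselect => [p|]; first by split.
  case=> -[y s] [/= yab scd]; apply: eU; split => /=; [exact: hab|exact: hcd].
by do 4 (apply: bigcupT_measurable_rat => ?); case: pselect => [p|n]; [exact: measurableX|exact: measurable0].
Qed.

(** [Splus] gives continuity of F for x > 0 only, and its values elsewhere are arbitrary; the factor
    [ip] replaces them by 0. *)
Lemma meas_halfplane (h : R -> R -> R) :
  (forall x t : R, 0 < x -> {for (x, t), continuous (fun p : R * R => h p.1 p.2)}) ->
  measurable_fun setT (fun p : R * R => ip p.1 * h p.1 p.2).
Proof.
move=> ch.
pose H : set (R * R) := [set p | 0 < p.1].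
have oH : open H.
  rewrite openE => -[x t] /= x0; exists ([set y : R | 0 < y], setT) => /=.
    by split; [apply: open_nbhs_nbhs; split; [exact: open_gt|]|exact: filterT].
  by move=> [y s] [].
have oV V : open V -> open (H `&` (fun p : R * R => h p.1 p.2) @^-1` V).
  move=> oV; rewrite openE => -[x t] [/= x0 Vxt]; apply: filterI.
    by apply: open_nbhs_nbhs; split.
  by apply: (ch x t x0); apply: open_nbhs_nbhs; split.
have mH : measurable H by exact: open_measurable_plane.
have mh : measurable_fun H (fun p => h p.1 p.2).
  apply: (measurability _ (RGenOpens.measurableE R)) => _ [_ [a [b ->]] <-].
  by apply: open_measurable_plane; apply: oV; exact: interval_open.
have := (measurable_restrictT (fun p => h p.1 p.2) mH).1 mh.
congr (measurable_fun _ _); apply/funext => p; rewrite patchE.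
case: ifPn; first by rewrite inE /= => p0; rewrite ip1// mul1r.
by rewrite notin_setE/= => /negP; rewrite -leNgt => p0; rewrite ip0// mul0r.
Qed.

(** As [f] may fail to be measurable, the modification is made on the majorant: [g] is given the
    value f c at c, which leaves its integral unchanged. *)
Lemma le_integral_off_point (c : R) (f g : R -> \bar R) :
  measurable_fun setT g -> (forall x, (0 <= f x)%E) -> (forall x, x != c -> (f x <= g x)%E) ->
  (\int[leb]_x f x <= \int[leb]_x g x)%E.
Proof.
move=> mg f0 fg; pose g' x := if x == c then f c else g x.
have gg' x : (setT `\ c) x -> g' x = g x by move=> [_ /eqP /negbTE]; rewrite /g' => ->.
have mg' : measurable_fun (setT `\ c) g'.
  by apply: eq_measurable_fun (measurable_funTS mg) => x /set_mem /gg'.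
have mT : measurable (setT `\ c : set R) by apply: measurableD.
apply: (@le_trans _ _ (\int[leb]_x g' x)%E).
  by apply: le_ge0_integral => // x _; rewrite /g'; case: eqVneq => [->|/fg].
rewrite -(integral_setD1 mT mg') -(integral_setD1 mT (measurable_funTS mg)).
rewrite le_eqVlt; apply/orP; left; apply/eqP; apply: eq_integral => x /set_mem; exact: gg'.
Qed.

(* Minkowski's integral inequality, obtained from Hoelder with respect to nu(t) dt. *)
Lemma weighted_minkowski (w nu : R -> R) (G : R -> R -> R) (r C V : R) :
  measurable_fun setT w -> measurable_fun setT nu ->
  measurable_fun setT (fun p : R * R => G p.1 p.2) ->
  (forall x, 0 <= w x) -> (forall t, 0 <= nu t) -> (forall x t, 0 <= G x t) ->
  (forall x t, nu t = 0 -> G x t = 0) -> 1 < r -> 0 <= C ->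
  (forall t, (\int[leb]_x (w x * G x t `^ r)%:E <= (C * nu t `^ r)%:E)%E) ->
  (\int[leb]_t (nu t)%:E <= V%:E)%E ->
  (\int[leb]_x ((w x)%:E * poweR (\int[leb]_t (G x t)%:E) r) <= (C * V `^ r)%:E)%E.
Proof.
move=> mw mnu mG w0 nu0 G0 nuG r1 C0 hG nuV.
have r0 : 0 < r by exact: lt_trans r1.
have rB : 0 < r - 1 by rewrite subr_gt0.
have i0 : (0 <= \int[leb]_t (nu t)%:E)%E by apply: integral_ge0 => t _; rewrite lee_fin.
have V0 : 0 <= V by rewrite -lee_fin; exact: le_trans nuV.
have k0 x t : 0 <= nu t `^ (- (r - 1)) * (w x * G x t `^ r) by rewrite mulr_ge0 ?mulr_ge0 ?powR_ge0.
have step x : (poweR (\int[leb]_t (G x t)%:E) r <=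
    (V `^ (r - 1))%:E * \int[leb]_t (nu t `^ (- (r - 1)) * G x t `^ r)%:E)%E.
  have mGx : measurable_fun setT (G x) by apply: (@meas_comp2 _ _ _ G (cst x) id).
  have rq0 : 0 < r / (r - 1) by rewrite divr_gt0.
  have rq1 : (r / (r - 1))^-1 + r^-1 = 1 by field; rewrite !gt_eqF.
  have m1 : measurable_fun setT (fun t => nu t `^ ((r - 1) / r)) by mea.
  have m2 : measurable_fun setT (fun t => G x t * nu t `^ (- ((r - 1) / r))) by mea.
  have h := ge0_hoelder m1 m2 (fun t => powR_ge0 _ _)
    (fun t => mulr_ge0 (G0 x t) (powR_ge0 _ _)) rq0 r0 rq1.
  (* Where nu t = 0 the powers of nu no longer cancel; there [nuG] makes both sides 0. *)
  have E t : nu t `^ ((r - 1) / r) * (G x t * nu t `^ (- ((r - 1) / r))) = G x t.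
    have [nu00|nun] := eqVneq (nu t) 0; first by rewrite nuG// mul0r mulr0.
    by rewrite mulrCA -powRD ?nun ?implybT// subrr powRr0 mulr1.
  rewrite (_ : (\int[leb]_t (G x t)%:E)%E =
    (\int[leb]_t (nu t `^ ((r - 1) / r) * (G x t * nu t `^ (- ((r - 1) / r))))%:E)%E); last first.
    by apply: eq_integral => t _; rewrite E.
  have E1 : (\int[leb]_t ((nu t `^ ((r - 1) / r)) `^ (r / (r - 1)))%:E = \int[leb]_t (nu t)%:E)%E.
    apply: eq_integral => t _; rewrite -powRrM.
    have -> : (r - 1) / r * (r / (r - 1)) = 1 by field; rewrite !gt_eqF.
    by rewrite powRr1.
  have E2 : (\int[leb]_t ((G x t * nu t `^ (- ((r - 1) / r))) `^ r)%:E =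
      \int[leb]_t (nu t `^ (- (r - 1)) * G x t `^ r)%:E)%E.
    apply: eq_integral => t _; rewrite powRM ?powR_ge0// -powRrM mulrC.
    by congr (_ `^ _ * _)%:E; field; rewrite gt_eqF.
  rewrite E1 E2 in h.
  apply: le_trans (lee_poweR (ltW r0) _ h) _.
    by apply: integral_ge0 => t _; rewrite E lee_fin.
  have j0 : (0 <= \int[leb]_t (nu t `^ (- (r - 1)) * G x t `^ r)%:E)%E.
    by apply: integral_ge0 => t _; rewrite lee_fin mulr_ge0 ?powR_ge0.
  rewrite poweRM ?poweR_ge0// -!poweRrM mulVf ?gt_eqF// poweRe1//.
  have -> : (r / (r - 1))^-1 * r = r - 1 by field; rewrite !gt_eqF.
  apply: lee_wpmul2r => //; rewrite -poweR_EFin; apply: lee_poweR => //; exact: ltW.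
apply: (@le_trans _ _ ((V `^ (r - 1))%:E * \int[leb]_x \int[leb]_t (nu t `^ (- (r - 1)) * (w x * G x t `^ r))%:E)%E).
  have mK : measurable_fun setT (fun p : R * R => (nu p.2 `^ (- (r - 1)) * (w p.1 * G p.1 p.2 `^ r))%:E) by mea.
  rewrite -ge0_integralZl_EFin//; last 3 first.
  - by move=> x _; apply: integral_ge0 => t _; rewrite lee_fin.
  - by apply: (@meas_integral _ _ R (fun x t : R => (nu t `^ (- (r - 1)) * (w x * G x t `^ r))%:E) mK) => x t; rewrite lee_fin.
  - exact: powR_ge0.
  apply: le_ge0_integral => x _; first by rewrite mule_ge0 ?poweR_ge0// lee_fin.
  have mGx : measurable_fun setT (G x) by apply: (@meas_comp2 _ _ _ G (cst x) id).
  have mk : measurable_fun setT (fun t => nu t `^ (- (r - 1)) * G x t `^ r) by mea.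
  rewrite (_ : (\int[leb]_t (nu t `^ (- (r - 1)) * (w x * G x t `^ r))%:E)%E =
    ((w x)%:E * \int[leb]_t (nu t `^ (- (r - 1)) * G x t `^ r)%:E)%E); last first.
    rewrite -(@ge0_integral_mulc _ _ _ leb setT measurableT _ (fun t => nu t `^ (- (r - 1)) * G x t `^ r))//.
      by apply: eq_integral => t _; rewrite mulrCA.
    by move=> t _; rewrite mulr_ge0 ?powR_ge0.
  by rewrite muleCA; apply: lee_wpmul2l; rewrite ?lee_fin.
have mK : measurable_fun setT (fun p : R * R => (nu p.2 `^ (- (r - 1)) * (w p.1 * G p.1 p.2 `^ r))%:E) by mea.
rewrite (@tonelli _ (fun x t => (nu t `^ (- (r - 1)) * (w x * G x t `^ r))%:E) mK); last first.
  by move=> x t; rewrite lee_fin.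
have -> : C * V `^ r = V `^ (r - 1) * (C * V).
  have [->|Vn] := eqVneq V 0; first by rewrite powR0 ?gt_eqF// !mulr0.
  rewrite [RHS]mulrCA -{3}(powRr1 V0) -powRD ?Vn ?implybT//.
  by congr (_ * _ `^ _); ring.
rewrite EFinM; apply: lee_wpmul2l; first by rewrite lee_fin powR_ge0.
apply: (@le_trans _ _ (C%:E * \int[leb]_t (nu t)%:E)%E); last first.
  by rewrite EFinM; apply: lee_wpmul2l; rewrite ?lee_fin.
rewrite -ge0_integral_mulc//.
apply: le_ge0_integral => t _; first by apply: integral_ge0 => x _; rewrite lee_fin.
have mGt : measurable_fun setT (fun x => G x t) by apply: (@meas_comp2 _ _ _ G id (cst t)).
have mk : measurable_fun setT (fun x => w x * G x t `^ r) by mea.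
rewrite (@ge0_integral_mulc _ _ _ leb setT measurableT _ (fun x => w x * G x t `^ r)) ?powR_ge0//; last first.
  by move=> x _; rewrite mulr_ge0 ?powR_ge0.
apply: le_trans (lee_wpmul2l _ (hG t)) _; first by rewrite lee_fin powR_ge0.
rewrite -EFinM lee_fin mulrCA ler_wpM2l//.
have [->|nun] := eqVneq (nu t) 0; first by rewrite powR0 ?mul0r// oppr_eq0 gt_eqF.
rewrite -powRD ?nun ?implybT//.
have -> : - (r - 1) + r = 1 by ring.
by rewrite powRr1.
Qed.

End plane.

(** * The dispersive estimate from the dual exponent r' to r *)

Section dispersion.
Variable R : realType.
Local Notation leb := (@lebesgue_measure R).

(** A strictly positive integrable profile: it dominates the data in both variables and later serves
    as a perturbation making weights positive. *)
Definition lorentz (t : R) : R := (1 + t ^+ 2)^-1.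

Lemma onesqr_gt0 (t : R) : 0 < 1 + t ^+ 2.
Proof. by rewrite ltr_wpDr// sqr_ge0. Qed.

Lemma lorentz_gt0 t : 0 < lorentz t.
Proof. by rewrite invr_gt0 onesqr_gt0. Qed.

Lemma lorentz_le1 t : lorentz t <= 1.
Proof. by rewrite invf_le1 ?onesqr_gt0// lerDl sqr_ge0. Qed.

Lemma meas_lorentz : measurable_fun setT lorentz.
Proof. by rewrite /lorentz; mea. Qed.

Lemma lorentz_integral : (\int[leb]_t (lorentz t)%:E <= (2 * pi)%:E)%E.
Proof.
have mip := @meas_ip R; have ml := meas_lorentz.
apply: le_trans (even_kernel_integral ml (fun t => ltW (lorentz_gt0 t)) _).
  apply: (@le_integral_off_point _ 0) => [|t|t t0]; first by mea.
    by rewrite lee_fin ltW// lorentz_gt0.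
  by rewrite ip1 ?normr_gt0// mul1r /lorentz real_normK ?num_real.
have dF (t : R) : 0 < t -> is_derive t 1 atan (lorentz t).
  move=> _; have := @der_atan R id t 1 (der_id t); rewrite mulr1 => h; exact: h.
apply: ge0_FTC_le dF _ => [t _|t _|x y x0 _].
- by rewrite ltW// lorentz_gt0.
- rewrite /lorentz; apply: der_continuous; notypeclasses refine (der_eq _ (erefl _)); der.
  by rewrite gt_eqF// onesqr_gt0.
have := atan_ltpi2 y.
have : 0 <= atan x by rewrite -(@atan0 R); apply: le_atan; exact: ltW.
have := @pi_gt0 R; lra.
Qed.

Lemma lorentz_dominated (c : R) (f : R -> R) : measurable_fun setT f ->
  (forall t, `|f t| <= c * lorentz t) -> leb.-integrable setT (EFin \o f).
Proof.
move=> mf fc; have ml := meas_lorentz.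
have c0 : 0 <= c by rewrite -(pmulr_lge0 _ (lorentz_gt0 0)); exact: le_trans (fc 0).
apply/integrableP; split; first by apply: meas_EFin.
apply: (@le_lt_trans _ _ (c%:E * \int[leb]_t (lorentz t)%:E)%E).
  rewrite -(@ge0_integral_mulc _ _ _ leb setT measurableT c lorentz)//; last first.
    by move=> t _; rewrite ltW// lorentz_gt0.
  by apply: le_ge0_integral => t _; rewrite /= lee_fin.
apply: (@le_lt_trans _ _ (c%:E * (2 * pi)%:E)%E); last by rewrite -EFinM ltry.
by apply: lee_wpmul2l; rewrite ?lee_fin// lorentz_integral.
Qed.

Variable a : R.
Hypothesis a0 : 0 <= a.

Lemma weight_le_lorentz (b y : R) (m : nat) : 0 <= b -> b / 2 + 1 <= m%:R ->
  ip y * y `^ b * ((1 + y ^+ 2) ^+ m)^-1 <= lorentz y.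
Proof.
move=> b0 bm; have [y0|y0] := leP y 0; first by rewrite ip0// !mul0r ltW// lorentz_gt0.
rewrite ip1// mul1r.
have P0 := onesqr_gt0 y; have P1 : 1 <= 1 + y ^+ 2 by rewrite lerDl sqr_ge0.
rewrite -powR_invn ?(ltW P0)// /lorentz -powR_inv1 ?(ltW P0)//.
have h : y `^ b <= (1 + y ^+ 2) `^ (b / 2).
  have -> : y `^ b = (y ^+ 2) `^ (b / 2).
    by rewrite -powR_mulrn ?(ltW y0)// -powRrM mulrC divfK.
  apply: ge0_ler_powR; rewrite ?nnegrE ?sqr_ge0 ?divr_ge0 ?(ltW P0)//.
  by rewrite lerDr.
apply: (@le_trans _ _ ((1 + y ^+ 2) `^ (b / 2) * (1 + y ^+ 2) `^ (- m%:R))).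
  by rewrite ler_wpM2r ?powR_ge0.
rewrite -powRD ?(gt_eqF P0) ?implybT//.
by apply: ler_powR => //; move: bm; lra.
Qed.

Definition kap (s : R) : R := 2 `^ ((1 - a) / 2) * s `^ ((a + 1) / 2).

Lemma kap_ge0 s : 0 <= kap s.
Proof. by apply: mulr_ge0; exact: powR_ge0. Qed.

(** Power count: kap^r contributes s^((a+1) r/2) and [hankel_Lr] contributes s^(-(a+1)); the
    exponent is (a+1)(r/2 - 1) = lambda r with s = 1/(2 |sg|). The data [g1], [g2] will be the real
    and imaginary parts of the chirped function. *)
Lemma dispersive_Lr (r : R) : 2 < r -> exists2 C : R, 0 < C &
  forall (sg N : R) (g1 g2 : R -> R), sg != 0 -> 0 < N ->
  measurable_fun setT g1 -> measurable_fun setT g2 ->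
  leb.-integrable setT (EFin \o halfwt a g1) -> leb.-integrable setT (EFin \o halfwt a g2) ->
  leb.-integrable setT (EFin \o (fun y => wt a y * g1 y)) ->
  leb.-integrable setT (EFin \o (fun y => wt a y * g2 y)) ->
  (\int[leb]_y (wt a y * `|g1 y| `^ (r / (r - 1)))%:E <= N%:E)%E ->
  (\int[leb]_y (wt a y * `|g2 y| `^ (r / (r - 1)))%:E <= N%:E)%E ->
  (\int[leb]_x (wt a x * (kap (2 * `|sg|)^-1 * (`|hankel a (2 * `|sg|)^-1 g1 x| +
      `|hankel a (2 * `|sg|)^-1 g2 x|)) `^ r)%:E <=
   (C * (`|sg| `^ (- ((a + 1) * (2^-1 - r^-1)))) `^ r * N `^ (r - 1))%:E)%E.
Proof.
move=> r2; have [C0 C00 hC0] := hankel_Lr a0 r2.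
have r0 : 0 < r by lra.
pose c0 : R := 2 `^ ((1 - a) / 2).
have c00 : 0 < c0 by exact: powR_gt0.
pose lam := (a + 1) * (2^-1 - r^-1).
exists (2 * C0 * (2 * c0) `^ r * 2 `^ (- (lam * r))).
  by rewrite mulr_gt0 ?powR_gt0// mulr_gt0 ?powR_gt0 ?mulr_gt0.
move=> sg N g1 g2 sg0 N0 m1 m2 ih1 ih2 iw1 iw2 n1 n2.
have w0 : 0 < 2 * `|sg| by rewrite mulr_gt0 ?normr_gt0.
have s0 : 0 < (2 * `|sg|)^-1 by rewrite invr_gt0.
have b1 := hC0 _ _ _ s0 N0 m1 ih1 iw1 n1.
have b2 := hC0 _ _ _ s0 N0 m2 ih2 iw2 n2.
have mH1 := meas_hankel a0 (2 * `|sg|)^-1 m1.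
have mH2 := meas_hankel a0 (2 * `|sg|)^-1 m2.
have mwt := @meas_wt R a.
move: b1 b2 mH1 mH2; move: (hankel a _ g1) (hankel a _ g2) => H1 H2 b1 b2 mH1 mH2.
have mm1 : measurable_fun setT (fun x => wt a x * `|H1 x| `^ r) by mea.
have mm2 : measurable_fun setT (fun x => wt a x * `|H2 x| `^ r) by mea.
have k0 : 0 <= (2 * kap (2 * `|sg|)^-1) `^ r by exact: powR_ge0.
have p1 x : 0 <= wt a x * `|H1 x| `^ r by rewrite mulr_ge0 ?powR_ge0 ?wt_ge0.
have p2 x : 0 <= wt a x * `|H2 x| `^ r by rewrite mulr_ge0 ?powR_ge0 ?wt_ge0.
apply: (@le_trans _ _ (\int[leb]_x ((2 * kap (2 * `|sg|)^-1) `^ r * (wt a x * `|H1 x| `^ r + wt a x * `|H2 x| `^ r))%:E)%E).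
  apply: le_ge0_integral => x _; first by rewrite lee_fin mulr_ge0 ?powR_ge0 ?wt_ge0.
  rewrite lee_fin -mulrDr mulrCA ler_wpM2l ?wt_ge0//.
  have k00 := kap_ge0 (2 * `|sg|)^-1.
  have h2 : `|H1 x| + `|H2 x| <= 2 * Num.max `|H1 x| `|H2 x|.
    by rewrite mulr2n mulrDl mul1r lerD// le_max lexx ?orbT.
  have M0 : 0 <= Num.max `|H1 x| `|H2 x| by rewrite le_max normr_ge0.
  apply: (@le_trans _ _ ((2 * kap (2 * `|sg|)^-1 * Num.max `|H1 x| `|H2 x|) `^ r)).
    apply: ge0_ler_powR; rewrite ?nnegrE ?(ltW r0)//.
    - by apply: mulr_ge0 => //; apply: addr_ge0.
    - by apply: mulr_ge0 => //; apply: mulr_ge0.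
    - by rewrite [leRHS]mulrAC [leRHS]mulrC ler_wpM2l.
  rewrite powRM ?mulr_ge0// ler_wpM2l//.
  by have [_|_] := leP `|H1 x| `|H2 x|; rewrite ?lerDl ?lerDr powR_ge0.
rewrite (@ge0_integral_mulc _ _ _ leb setT measurableT _ (fun x => wt a x * `|H1 x| `^ r + wt a x * `|H2 x| `^ r))//; last 2 first.
- by move=> x _; rewrite addr_ge0.
- exact: meas_add.
rewrite ge0_integral_add//.
apply: le_trans (lee_wpmul2l _ (leeD b1 b2)) _; first by rewrite lee_fin.
rewrite -EFinD -EFinM lee_fin le_eqVlt; apply/orP; left; apply/eqP.
have -> : (2 * kap (2 * `|sg|)^-1) `^ r = (2 * c0) `^ r * (2 * `|sg|)^-1 `^ ((a + 1) / 2 * r).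
  by rewrite /kap mulrA powRM ?powR_ge0 ?mulr_ge0 ?(ltW c00)// -powRrM.
have E : (2 * `|sg|)^-1 `^ ((a + 1) / 2 * r) * (2 * `|sg|)^-1 `^ (- (a + 1)) =
    2 `^ (- (lam * r)) * (`|sg| `^ (- lam)) `^ r.
  rewrite -powRD ?(gt_eqF s0) ?implybT//.
  have -> : (a + 1) / 2 * r + - (a + 1) = lam * r by rewrite /lam; field; rewrite gt_eqF.
  rewrite -powR_inv1 ?(ltW w0)// -powRrM mulN1r powRM// -powRrM.
  by rewrite mulNr.
rewrite -/lam.
transitivity (2 * C0 * (2 * c0) `^ r * N `^ (r - 1) * ((2 * `|sg|)^-1 `^ ((a + 1) / 2 * r) * (2 * `|sg|)^-1 `^ (- (a + 1)))).
  by ring.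
by rewrite E; ring.
Qed.

End dispersion.

(** * Reduction of the propagator to Hankel transforms *)

Section propagator.
Variable R : realType.
Local Notation leb := (@lebesgue_measure R).
Variable a : R.
Hypothesis a0 : 0 <= a.

(** [chirp1] and [chirp2] are the real and imaginary parts of e^(i y^2/(4 sg)) (u + i v); the real
    form keeps all integrals real. *)
Definition chirp1 (sg : R) (u v : R -> R) (y : R) : R :=
  cos (y ^+ 2 / (4 * sg)) * u y - sin (y ^+ 2 / (4 * sg)) * v y.
Definition chirp2 (sg : R) (u v : R -> R) (y : R) : R :=
  cos (y ^+ 2 / (4 * sg)) * v y + sin (y ^+ 2 / (4 * sg)) * u y.

Lemma chirp_sqr sg u v y : chirp1 sg u v y ^+ 2 + chirp2 sg u v y ^+ 2 = u y ^+ 2 + v y ^+ 2.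
Proof.
rewrite -[RHS]mul1r -(cos2Dsin2 (y ^+ 2 / (4 * sg))) /chirp1 /chirp2; ring.
Qed.

Lemma norm_chirp1_le sg u v y : `|chirp1 sg u v y| <= Num.sqrt (u y ^+ 2 + v y ^+ 2).
Proof. by rewrite -sqrtr_sqr ler_sqrt ?addr_ge0 ?sqr_ge0// -(chirp_sqr sg) lerDl sqr_ge0. Qed.

Lemma norm_chirp2_le sg u v y : `|chirp2 sg u v y| <= Num.sqrt (u y ^+ 2 + v y ^+ 2).
Proof. by rewrite -sqrtr_sqr ler_sqrt ?addr_ge0 ?sqr_ge0// -(chirp_sqr sg) lerDr sqr_ge0. Qed.

(** The sign in front of (x^2 + y^2)/(4 |sg|) is that of [sg], so one quadratic phase covers both
    time directions and only the constant phase distinguishes them. *)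
Lemma Skernel_bphi (x y sg : R) : 0 < x -> 0 < y -> sg != 0 ->
  Skernel a x y sg = cexpi (if 0 < sg then - ((a + 1) * pi / 4) else (a + 1) * pi / 4) *
    ((kap a (2 * `|sg|)^-1 * bphi a (((2 * `|sg|)^-1 * x * y) ^+ 2 / 4))%:C)%C
    * cexpi (x ^+ 2 / (4 * sg) + y ^+ 2 / (4 * sg)).
Proof.
move=> x0 y0 sg0; rewrite /Skernel.
have w0 : 0 < 2 * `|sg| by rewrite mulr_gt0 ?normr_gt0.
have zE : x * y / (2 * `|sg|) = (2 * `|sg|)^-1 * x * y by ring.
have z0 : 0 < (2 * `|sg|)^-1 * x * y by rewrite !mulr_gt0 ?invr_gt0.
have -> : ((2 * `|sg|) `^ ((a + 1) / 2))^-1 * (x * y / (2 * `|sg|)) `^ ((1 - a) / 2) *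
    BesselJ ((a - 1) / 2) (x * y / (2 * `|sg|)) =
    kap a (2 * `|sg|)^-1 * bphi a (((2 * `|sg|)^-1 * x * y) ^+ 2 / 4).
  have E : (2 * `|sg|)^-1 `^ ((a + 1) / 2) = ((2 * `|sg|) `^ ((a + 1) / 2))^-1.
    by rewrite -(powR_inv1 (ltW w0)) -powRrM mulN1r powRN.
  rewrite zE -mulrA (BesselJ_bphi a0 z0) /kap E; ring.
case: ltgtP sg0 => // s0 _.
  have -> // : (x ^+ 2 + y ^+ 2) / (4 * `|sg|) = x ^+ 2 / (4 * sg) + y ^+ 2 / (4 * sg).
  by rewrite gtr0_norm//; field; rewrite gt_eqF.
have -> // : - ((x ^+ 2 + y ^+ 2) / (4 * `|sg|)) = x ^+ 2 / (4 * sg) + y ^+ 2 / (4 * sg).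
by rewrite ltr0_norm//; field; rewrite lt_eqF.
Qed.

Lemma integrable_hankel s x g : measurable_fun setT g ->
  leb.-integrable setT (EFin \o (fun y => wt a y * g y)) ->
  leb.-integrable setT (EFin \o (fun y => wt a y * g y * bphi a ((s * x * y) ^+ 2 / 4))).
Proof.
move=> mg ig; have mb := meas_bphi a0.
apply: (integrable_bdd_mul (M := hconst a)) => //; first by mea.
by move=> y; apply: bphi_sqr_le.
Qed.

Lemma Sa_le (sg x : R) (phi : R -> R[i]) : sg != 0 -> 0 < x ->
  let u y := ip y * complex.Re (phi y) in let v y := ip y * complex.Im (phi y) in
  let g1 := chirp1 sg u v in let g2 := chirp2 sg u v in
  measurable_fun setT g1 -> measurable_fun setT g2 ->
  leb.-integrable setT (EFin \o (fun y => wt a y * g1 y)) ->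
  leb.-integrable setT (EFin \o (fun y => wt a y * g2 y)) ->
  let B := kap a (2 * `|sg|)^-1 * (`|hankel a (2 * `|sg|)^-1 g1 x| + `|hankel a (2 * `|sg|)^-1 g2 x|) in
  `|complex.Re (Sa a sg phi x)| <= B /\ `|complex.Im (Sa a sg phi x)| <= B.
Proof.
move=> sg0 x0 u v g1 g2 m1 m2 i1 i2 B.
set s := (2 * `|sg|)^-1 in B *.
have j1 := integrable_hankel s x m1 i1; have j2 := integrable_hankel s x m2 i2.
pose th := if 0 < sg then - ((a + 1) * pi / 4) else (a + 1) * pi / 4.
(* The part of the phase independent of y: it leaves the integral as a rotation, bounded entrywise
   by 1. *)
pose T := th + x ^+ 2 / (4 * sg).
have kE y : 0 < y -> Skernel a x y sg * phi y = Complex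
    (kap a s * bphi a ((s * x * y) ^+ 2 / 4) * (cos T * g1 y - sin T * g2 y))
    (kap a s * bphi a ((s * x * y) ^+ 2 / 4) * (cos T * g2 y + sin T * g1 y)).
  move=> y0; rewrite Skernel_bphi// -/th -/s /g1 /g2 /chirp1 /chirp2 /u /v ip1//.
  case: (phi y) => p q /=; rewrite /T /cexpi.
  rewrite !cosD !sinD; move: (kap a s * _) => k.
  by apply/eqP; rewrite eq_complex /=; apply/andP; split; apply/eqP; ring.
have lin (c d : R) : `|c| <= kap a s -> `|d| <= kap a s ->
    `|Rintegral leb setT (fun y => c * (wt a y * g1 y * bphi a ((s * x * y) ^+ 2 / 4)) +
        d * (wt a y * g2 y * bphi a ((s * x * y) ^+ 2 / 4)))| <= B.
  move=> cs ds; rewrite RintegralD//; [|exact: integrable_scale|exact: integrable_scale].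
  rewrite !RintegralZl// -/(hankel a s g1 x) -/(hankel a s g2 x).
  by apply: le_trans (ler_normD _ _) _; rewrite !normrM /B mulrDr lerD// ler_wpM2r.
have ck : `|kap a s * cos T| <= kap a s.
  by rewrite normrM ger0_norm ?kap_ge0// ler_piMr ?kap_ge0// ler_norml cos_geN1 cos_le1.
have sk : `|kap a s * sin T| <= kap a s.
  by rewrite normrM ger0_norm ?kap_ge0// ler_piMr ?kap_ge0// ler_norml sin_geN1 sin_le1.
have nsk : `|- (kap a s * sin T)| <= kap a s by rewrite normrN.
rewrite /Sa (negbTE sg0) /cint /=; split.
  rewrite /Rintegral integral_pos.
  apply: le_trans (lin _ _ ck nsk); rewrite le_eqVlt; apply/orP; left; apply/eqP.
  congr (`|fine _|); apply: eq_integral => y _; congr EFin.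
  have [y0|y0] := leP y 0; first by rewrite /wt ip0// !mul0r !mulr0 addr0.
  by rewrite /wt kE//= ip1//; ring.
rewrite /Rintegral integral_pos.
apply: le_trans (lin _ _ sk ck); rewrite le_eqVlt; apply/orP; left; apply/eqP.
congr (`|fine _|); apply: eq_integral => y _; congr EFin.
have [y0|y0] := leP y 0; first by rewrite /wt ip0// !mul0r !mulr0 addr0.
by rewrite /wt kE//= ip1//; ring.
Qed.

End propagator.

(** * The spatial norm of the Duhamel integral *)

Section duhamel.
Variable R : realType.
Local Notation leb := (@lebesgue_measure R).

Lemma cabs_ge0 (z : R[i]) : 0 <= cabs z.
Proof. exact: sqrtr_ge0. Qed.

Lemma cabs_le (z : R[i]) : cabs z <= `|complex.Re z| + `|complex.Im z|.
Proof.
rewrite /cabs -(ger0_norm (addr_ge0 (normr_ge0 (complex.Re z)) (normr_ge0 (complex.Im z)))).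
rewrite -sqrtr_sqr ler_sqrt ?sqr_ge0//.
rewrite -(real_normK (num_real (complex.Re z))) -(real_normK (num_real (complex.Im z))).
have := normr_ge0 (complex.Re z); have := normr_ge0 (complex.Im z).
by move: `|_| `|_| => p q; nra.
Qed.

(* [nd] is any positive majorant of tau |-> ||F(., tau)||_{r'}: positivity makes it a
   weight in [weighted_minkowski] even at times where F vanishes. The single time
   tau = t, where [Sa a 0] is the identity, is discarded as a null set. *)
Lemma duhamel_Lr (a r : R) : 0 <= a -> 2 < r -> exists2 C : R, 0 < C &
  forall (F : R -> R -> R[i]) (M : R) (m : nat) (nd : R -> R),
  let u y tau := ip y * complex.Re (F y tau) in let v y tau := ip y * complex.Im (F y tau) in
  measurable_fun setT (fun p : R * R => u p.1 p.2) ->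
  measurable_fun setT (fun p : R * R => v p.1 p.2) ->
  a / 2 + 1 <= m%:R ->
  (forall y tau, ip y * cabs (F y tau) <= M * ((1 + y ^+ 2) ^+ m)^-1 * lorentz tau) ->
  measurable_fun setT nd -> (forall tau, 0 < nd tau) ->
  (forall tau, (\int[leb]_y (wt a y * (ip y * cabs (F y tau)) `^ (r / (r - 1)))%:E <=
     (nd tau `^ (r / (r - 1)))%:E)%E) ->
  forall t V : R,
  (\int[leb]_tau (`|t - tau| `^ (- ((a + 1) * (2^-1 - r^-1))) * nd tau)%:E <= V%:E)%E ->
  (\int[leb]_(x in `]0%R, +oo[) (cabs (Duhamel a F x t) `^ r * x `^ a)%:E <= (C * V `^ r)%:E)%E.
Proof.
move=> a0 r2; have [C0 C00 hC0] := dispersive_Lr a0 r2.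
exists (2 `^ r * C0); first by rewrite mulr_gt0 ?powR_gt0.
move=> F M m nd u v mu_ mv am FM mnd nd0 ndF t V hV.
have r0 : 0 < r by lra.
have r1 : 1 < r by lra.
have lam0 : 0 < (a + 1) * (2^-1 - r^-1).
  by rewrite mulr_gt0 ?subr_gt0 ?ltf_pV2 ?posrE ?ltr_wpDl.
move: (_ * (2^-1 - _)) lam0 hC0 hV => lam lam0 hC0 hV.
have mwt := @meas_wt R a; have mb := meas_bphi a0; have mip := @meas_ip R.
pose g1 tau := chirp1 (t - tau) (u ^~ tau) (v ^~ tau).
pose g2 tau := chirp2 (t - tau) (u ^~ tau) (v ^~ tau).
have AE y tau : Num.sqrt (u y tau ^+ 2 + v y tau ^+ 2) = ip y * cabs (F y tau).
  have [y0|y0] := leP y 0; first by rewrite /u /v ip0// !mul0r expr2 !mul0r addr0 sqrtr0.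
  by rewrite /u /v ip1// !mul1r.
have g1A tau y : `|g1 tau y| <= ip y * cabs (F y tau) by rewrite -AE; exact: norm_chirp1_le.
have g2A tau y : `|g2 tau y| <= ip y * cabs (F y tau) by rewrite -AE; exact: norm_chirp2_le.
have mg1 tau : measurable_fun setT (g1 tau) by rewrite /g1 /chirp1; mea.
have mg2 tau : measurable_fun setT (g2 tau) by rewrite /g2 /chirp2; mea.
pose s tau := (2 * `|t - tau|)^-1.
pose G x tau := kap a (s tau) * (`|hankel a (s tau) (g1 tau) x| + `|hankel a (s tau) (g2 tau) x|).
have mG : measurable_fun setT (fun p : R * R => G p.1 p.2).
  have mh1 : measurable_fun setT (fun p : R * R => hankel a (s p.2) (g1 p.2) p.1).
    apply: (@meas_Rintegral _ _ _ (fun (p : R * R) y => wt a y * g1 p.2 y * bphi a ((s p.2 * p.1 * y) ^+ 2 / 4))).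
    by rewrite /g1 /chirp1 /s; mea.
  have mh2 : measurable_fun setT (fun p : R * R => hankel a (s p.2) (g2 p.2) p.1).
    apply: (@meas_Rintegral _ _ _ (fun (p : R * R) y => wt a y * g2 p.2 y * bphi a ((s p.2 * p.1 * y) ^+ 2 / 4))).
    by rewrite /g2 /chirp2 /s; mea.
  by rewrite /G /kap /s; apply: meas_mul; [mea|apply: meas_add; apply: meas_norm].
have G0 x tau : 0 <= G x tau by apply: mulr_ge0; [exact: kap_ge0|exact: addr_ge0].
(* Default values: at tau = t the scale [s] is 0^-1 = 0 and [kap] vanishes with it. The weight
   |0|^(-lam) is 0 as well, so this identity supplies [nuG] at that time. *)
have Gt x : G x t = 0.
  rewrite /G /s subrr normr0 mulr0 invr0 /kap powR0 ?mulr0 ?mul0r//.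
  by rewrite gt_eqF// divr_gt0// ltr_wpDl.
(* Both integrability facts follow from one decay rate: b = a/2 for [halfwt] and b = a for the
   weight itself. *)
have dom (g : R -> R) (tau : R) : measurable_fun setT g -> (forall y, `|g y| <= ip y * cabs (F y tau)) ->
    leb.-integrable setT (EFin \o halfwt a g) /\
    leb.-integrable setT (EFin \o (fun y => wt a y * g y)).
  move=> mg gF.
  have gb b y : 0 <= b -> b / 2 + 1 <= m%:R -> `|ip y * y `^ b * g y| <= (M * lorentz tau) * lorentz y.
    move=> b0 bm; rewrite normrM ger0_norm ?mulr_ge0 ?ip_ge0 ?powR_ge0//.
    have M0 : 0 <= M * lorentz tau.
      have := le_trans (normr_ge0 _) (le_trans (gF y) (FM y tau)).
      by rewrite mulrAC pmulr_lge0// invr_gt0 exprn_gt0// onesqr_gt0.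
    apply: le_trans (ler_wpM2l M0 (weight_le_lorentz y b0 bm)).
    rewrite mulrCA ler_wpM2l ?mulr_ge0 ?ip_ge0 ?powR_ge0//.
    by apply: le_trans (gF y) (le_trans (FM y tau) _); rewrite mulrAC.
  split; apply: lorentz_dominated.
  - by rewrite /halfwt; mea.
  - by move=> y; apply: gb; [rewrite divr_ge0|move: am a0; lra].
  - by mea.
  - by move=> y; apply: gb.
have Nle (g : R -> R) (tau : R) : (forall y, `|g y| <= ip y * cabs (F y tau)) ->
    (\int[leb]_y (wt a y * `|g y| `^ (r / (r - 1)))%:E <= (nd tau `^ (r / (r - 1)))%:E)%E.
  move=> gF; apply: le_trans (ndF tau); apply: le_ge0_integral => y _.
    by rewrite lee_fin mulr_ge0 ?wt_ge0 ?powR_ge0.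
  rewrite lee_fin ler_wpM2l ?wt_ge0//; apply: ge0_ler_powR; rewrite ?nnegrE//.
    by rewrite divr_ge0 ?subr_ge0 ?(ltW r0) ?(ltW r1).
  by rewrite mulr_ge0 ?ip_ge0 ?cabs_ge0.
pose nu tau := `|t - tau| `^ (- lam) * nd tau.
have mnu : measurable_fun setT nu by rewrite /nu; mea.
have nu0 tau : 0 <= nu tau by rewrite mulr_ge0 ?powR_ge0 ?(ltW (nd0 _)).
have nuG x tau : nu tau = 0 -> G x tau = 0.
  move/eqP; rewrite mulf_eq0 (gt_eqF (nd0 _)) orbF powR_eq0 => /andP[/eqP h _].
  by move/normr0_eq0/subr0_eq: h => <-.
have hG tau : (\int[leb]_x (wt a x * G x tau `^ r)%:E <= (C0 * nu tau `^ r)%:E)%E.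
  have [->|tt] := eqVneq tau t.
    rewrite integral0_eq; first by rewrite lee_fin mulr_ge0 ?powR_ge0 ?(ltW C00).
    by move=> x _; rewrite Gt powR0 ?gt_eqF// mulr0.
  have tt0 : t - tau != 0 by rewrite subr_eq0 eq_sym.
  have [i1 j1] := dom _ _ (mg1 tau) (g1A tau).
  have [i2 j2] := dom _ _ (mg2 tau) (g2A tau).
  have N0 : 0 < nd tau `^ (r / (r - 1)) by rewrite powR_gt0.
  apply: le_trans (hC0 _ _ _ _ tt0 N0 (mg1 tau) (mg2 tau) i1 i2 j1 j2 (Nle _ _ (g1A tau)) (Nle _ _ (g2A tau))) _.
  rewrite lee_fin le_eqVlt; apply/orP; left; apply/eqP.
  rewrite /nu powRM ?powR_ge0 ?(ltW (nd0 _))// mulrA -[X in _ * X]powRrM divfK//.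
  by rewrite subr_eq0 gt_eqF.
have C0' := ltW C00.
have mink := weighted_minkowski mwt mnu mG (wt_ge0 a) nu0 G0 nuG r1 C0' hG hV.
rewrite integral_pos -mulrA EFinM.
apply: le_trans (lee_wpmul2l _ mink); last by rewrite lee_fin powR_ge0.
rewrite -ge0_integralZl_EFin ?powR_ge0//; last 2 first.
- by move=> x _; rewrite mule_ge0 ?poweR_ge0// lee_fin wt_ge0.
- apply: emeasurable_funM; first by mea.
  apply: (measurableT_comp (measurable_poweR _)).
  apply: (@meas_integral _ _ R (fun x tau : R => (G x tau)%:E)); first by mea.
  by move=> x tau; rewrite lee_fin.
apply: le_ge0_integral => x _; first by rewrite lee_fin mulr_ge0 ?ip_ge0// mulr_ge0 ?powR_ge0.
have [x0|x0] := leP x 0; first by rewrite ip0// mul0r mule_ge0 ?mule_ge0 ?poweR_ge0 ?lee_fin ?powR_ge0 ?wt_ge0.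
have mGx : measurable_fun setT (fun tau => (G x tau)%:E).
  by apply: meas_EFin; apply: (@meas_comp2 _ _ _ G (cst x) id).
have Sle tau : tau != t -> `|complex.Re (Sa a (t - tau) (F ^~ tau) x)| <= G x tau /\
    `|complex.Im (Sa a (t - tau) (F ^~ tau) x)| <= G x tau.
  move=> tt; have tt0 : t - tau != 0 by rewrite subr_eq0 eq_sym.
  have [i1 j1] := dom _ _ (mg1 tau) (g1A tau).
  have [i2 j2] := dom _ _ (mg2 tau) (g2A tau).
  exact: (Sa_le a0 tt0 x0 (mg1 tau) (mg2 tau) j1 j2).
have ReI : (`|complex.Re (Duhamel a F x t)|%:E <= \int[leb]_tau (G x tau)%:E)%E.
  apply: le_trans (norm_Rintegral_le _ _ _) _.
  apply: (@le_integral_off_point _ t) => // tau tt; rewrite ?lee_fin//.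
  by rewrite mulr1; case: (Sle _ tt).
have ImI : (`|complex.Im (Duhamel a F x t)|%:E <= \int[leb]_tau (G x tau)%:E)%E.
  apply: le_trans (norm_Rintegral_le _ _ _) _.
  apply: (@le_integral_off_point _ t) => // tau tt; rewrite ?lee_fin//.
  by rewrite mulr1; case: (Sle _ tt).
have i0 : (0 <= \int[leb]_tau (G x tau)%:E)%E by apply: integral_ge0 => tau _; rewrite lee_fin.
have absI : ((cabs (Duhamel a F x t))%:E <= 2%:E * \int[leb]_tau (G x tau)%:E)%E.
  apply: (@le_trans _ _ (`|complex.Re (Duhamel a F x t)| + `|complex.Im (Duhamel a F x t)|)%:E).
    by rewrite lee_fin cabs_le.
  rewrite EFinD (_ : 2%:E = 1 + 1)%E; last by rewrite -EFinD -natr1.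
  by rewrite ge0_muleDl// !mul1e leeD.
have powI := lee_poweR (ltW r0) (_ : (0 <= (cabs (Duhamel a F x t))%:E)%E) absI.
rewrite poweR_EFin poweRM ?lee_fin// poweR_EFin in powI.
rewrite (_ : ip x * (cabs (Duhamel a F x t) `^ r * x `^ a) = wt a x * cabs (Duhamel a F x t) `^ r); last first.
  by rewrite /wt -mulrA (mulrC (x `^ a)).
rewrite EFinM muleCA; apply: lee_wpmul2l; first by rewrite lee_fin wt_ge0.
exact: (powI (cabs_ge0 _)).
Qed.

End duhamel.

(** * Admissible exponents, decay of the data and mixed norms *)

Section mixed_norm.
Variable R : realType.
Local Notation leb := (@lebesgue_measure R).

(** For a <= 1 the middle bound follows from lambda < (a+1)/2 <= 1; for a > 1 it is the upper
    restriction on r. The value q = 0 is excluded because 2/0 reads as 0 whereas lambda is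
    positive. *)
Lemma admissible_exponents (a q r : R) : 0 <= a -> admissible a q r ->
  [/\ 0 < (a + 1) * (2^-1 - r^-1), (a + 1) * (2^-1 - r^-1) < 1 &
      (a + 1) * (2^-1 - r^-1) * q = 2].
Proof.
move=> a0 [r2 ra qE]; have r0 : 0 < r by lra.
have l0 : 0 < (a + 1) * (2^-1 - r^-1).
  by rewrite mulr_gt0 ?subr_gt0 ?ltf_pV2 ?posrE ?ltr_wpDl.
split=> //; last first.
  rewrite -qE; have [q0|q0] := eqVneq q 0; last by rewrite divfK.
  by move: l0; rewrite -qE q0 invr0 mulr0 ltxx.
have ir0 : 0 < r^-1 by rewrite invr_gt0.
have [a1|a1] := ltP 1 a; last first.
  have : (a + 1) * (2^-1 - r^-1) < 2 * 2^-1; last by rewrite divff.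
  apply: (@lt_le_trans _ _ ((a + 1) * 2^-1)); first by rewrite ltr_pM2l ?ltr_wpDl//; lra.
  by rewrite ler_wpM2r ?invr_ge0//; lra.
have := ra a1; rewrite ltr_pdivlMr; last by lra.
move=> h; have h2 : (a - 1) / 2 < (a + 1) * r^-1.
  by rewrite ltr_pdivlMr// mulrAC ltr_pdivrMr//; lra.
lra.
Qed.

(** The order 4m turns the square root into (1 + y^2 + tau^2)^(2m), and (1 + y^2 + tau^2)^2 >= (1 +
    y^2)(1 + tau^2) separates the variables. *)
Lemma Splus_decay (F : R -> R -> R[i]) (m : nat) : Splus F -> (0 < m)%N ->
  exists M : R, forall y tau, ip y * cabs (F y tau) <= M * ((1 + y ^+ 2) ^+ m)^-1 * lorentz tau.
Proof.
move=> [_ /(_ (4 * m)%N)[M hM]] m0; exists `|M| => y tau.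
have Y0 := onesqr_gt0 y; have T0 := onesqr_gt0 tau.
have R0 : 0 <= `|M| * ((1 + y ^+ 2) ^+ m)^-1 * lorentz tau.
  by rewrite mulr_ge0 ?mulr_ge0 ?invr_ge0 ?exprn_ge0 ?(ltW Y0) ?(ltW T0).
have [y0|y0] := leP y 0; first by rewrite ip0// mul0r.
rewrite ip1// mul1r /lorentz ler_pdivlMr// ler_pdivlMr ?exprn_gt0//.
have h := hM 0%N 0%N (leq0n _) y tau y0; rewrite /= in h.
apply: le_trans (le_trans h (ler_norm M)); rewrite -mulrA mulrC ler_wpM2r ?cabs_ge0//.
have X0 : 0 <= 1 + y ^+ 2 + tau ^+ 2 by rewrite !addr_ge0 ?sqr_ge0.
rewrite mulnC (_ : 4 = 2 * 2)%N// mulnA mulnC exprM sqr_sqrtr// mulnC exprM.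
apply: (@le_trans _ _ (((1 + tau ^+ 2) * (1 + y ^+ 2)) ^+ m)).
  rewrite exprMn ler_wpM2r ?exprn_ge0 ?(ltW Y0)//.
  rewrite -[leLHS]expr1; apply: ler_weXn2l => //; first by rewrite lerDl sqr_ge0.
apply: lerXn2r; rewrite ?nnegrE ?sqr_ge0 ?mulr_ge0 ?(ltW Y0) ?(ltW T0)//.
have := sqr_ge0 y; have := sqr_ge0 tau.
by move: (y ^+ 2) (tau ^+ 2) => p s; nra.
Qed.

(* Removes the perturbation that makes the majorant of the time profile positive. *)
Lemma le_perturbed_powR (J : \bar R) (K p S : R) : 0 < K -> 0 < p -> 0 <= S ->
  (forall eta, 0 < eta -> (J <= (K * (S + eta) `^ p)%:E)%E) ->
  (J <= (K * 2 `^ p * S `^ p)%:E)%E.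
Proof.
move=> K0 p0 S0 h; have [S00|Sn] := eqVneq S 0; last first.
  have S1 : 0 < S by rewrite lt_neqAle eq_sym Sn.
  apply: le_trans (h _ S1) _; rewrite -mulr2n -(mulr_natl S) powRM// mulrA lexx//.
rewrite S00 in h *; rewrite powR0 ?gt_eqF// mulr0.
apply/lee_addgt0Pr => e e0; rewrite add0e.
have eK : 0 < e / K by rewrite divr_gt0.
have ep : 0 < (e / K) `^ (p^-1) by rewrite powR_gt0.
apply: le_trans (h _ ep) _; rewrite add0r -powRrM mulVf ?gt_eqF// powRr1 ?(ltW eK)//.
by rewrite mulrC divfK ?gt_eqF.
Qed.

Lemma powR_add_le (x y p : R) : 0 <= x -> 0 <= y -> 0 <= p ->
  (x + y) `^ p <= 2 `^ p * (x `^ p + y `^ p).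
Proof.
move=> x0 y0 p0; have M0 : 0 <= Num.max x y by rewrite le_max x0.
apply: (@le_trans _ _ ((2 * Num.max x y) `^ p)).
  apply: ge0_ler_powR; rewrite ?nnegrE ?addr_ge0 ?mulr_ge0//.
  by rewrite mulr2n mulrDl mul1r lerD// le_max lexx ?orbT.
rewrite powRM// ler_wpM2l ?powR_ge0//.
by have [_|_] := leP x y; rewrite ?lerDl ?lerDr powR_ge0.
Qed.

(** The real number [S] is the q'-th power of the data norm, shown finite by the decay. The time
    profile [n] of the data may vanish, so the estimates are run with [nd], and the cost [eta] of
    the perturbation is removed by [le_perturbed_powR]. *)
Lemma mixed_norm_duhamel (a q r : R) : 0 <= a -> admissible a q r ->
  exists2 C : R, 0 < C & forall F : R -> R -> R[i], Splus F -> exists2 S : R, 0 <= S &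
  MixNorm a (conj_exp q) (conj_exp r) F = poweR S%:E (conj_exp q)^-1 /\
  (\int[leb]_t poweR (LrNorm a r (fun x => Duhamel a F x t)) q <= (C * S `^ (q - 1))%:E)%E.
Proof.
move=> a0 adm; have [lam0 lam1 lamq] := admissible_exponents a0 adm.
have r2 : 2 < r by case: adm.
have [C1 C10 hC1] := duhamel_Lr a0 r2.
have [C2 C20 hC2] := hls lam0 lam1 lamq.
have bnd := @riesz_bounded R _ lam0 lam1.
have q2 : 2 < q by rewrite -lamq gtr_pMl// -(pmulr_rgt0 _ lam0) lamq.
move: (_ * (2^-1 - _)) lam0 lam1 lamq hC1 hC2 bnd => lam lam0 lam1 lamq hC1 hC2 bnd.
have r1 : 0 < r - 1 by lra.
have q1 : 0 < q - 1 by lra.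
have r0 : 0 < r by lra.
have q0 : 0 < q by lra.
rewrite /conj_exp; set q' := q / (q - 1); set r' := r / (r - 1).
have q'0 : 0 < q' by rewrite divr_gt0.
have r'0 : 0 < r' by rewrite divr_gt0.
have q'1 : 1 <= q' by rewrite ler_pdivlMr// mul1r; lra.
have r'1 : 1 <= r' by rewrite ler_pdivlMr// mul1r; lra.
(* C1^(q/r) arises from raising the spatial bound to the power q/r, C2 is the constant of [hls], and
   the last factor is the loss of [powR_add_le] in splitting nd^(q'). *)
pose K := C1 `^ (q / r) * C2 * (2 `^ q') `^ (q - 1).
have K0 : 0 < K by rewrite /K !mulr_gt0 ?powR_gt0.
exists (K * 2 `^ (q - 1)); first by rewrite mulr_gt0 ?powR_gt0.
move=> F SF.
have mu_ : measurable_fun setT (fun p : R * R => ip p.1 * complex.Re (F p.1 p.2)).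
  apply: (@meas_halfplane _ (fun x t => complex.Re (F x t))) => x t x0.
  by have [_ []] := SF.1 [::] x t x0.
have mv : measurable_fun setT (fun p : R * R => ip p.1 * complex.Im (F p.1 p.2)).
  apply: (@meas_halfplane _ (fun x t => complex.Im (F x t))) => x t x0.
  by have [_ []] := SF.1 [::] x t x0.
pose m := (Num.truncn (a / 2 + 1)).+1.
have am : a / 2 + 1 <= m%:R by rewrite ltW// truncnS_gt.
have [M FM] := Splus_decay SF (ltn0Sn _ : (0 < m)%N).
pose A y tau := ip y * cabs (F y tau).
have A0 y tau : 0 <= A y tau by rewrite mulr_ge0 ?ip_ge0 ?cabs_ge0.
have mip := @meas_ip R; have mwt := @meas_wt R a; have mlo := @meas_lorentz R.
have mA : measurable_fun setT (fun p : R * R => A p.1 p.2).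
  rewrite (_ : (fun p => _) = fun p : R * R => Num.sqrt
    ((ip p.1 * complex.Re (F p.1 p.2)) ^+ 2 + (ip p.1 * complex.Im (F p.1 p.2)) ^+ 2)).
    apply: (meas_cont (h := Num.sqrt)); first exact: sqrt_continuous.
    by apply: meas_add; apply: meas_exp.
  apply/funext => -[y t] /=; rewrite /A; have [y0|y0] := leP y 0.
    by rewrite ip0// !mul0r expr2 !mul0r addr0 sqrtr0.
  by rewrite ip1// !mul1r.
have M0 : 0 <= M.
  have := le_trans (A0 0 0) (FM 0 0).
  by rewrite -mulrA pmulr_lge0// mulr_gt0 ?lorentz_gt0// invr_gt0 exprn_gt0// onesqr_gt0.
have Pi0 := @pi_gt0 R.
have NEle tau : (\int[leb]_y (wt a y * A y tau `^ r')%:E <= ((M * lorentz tau) `^ r' * (2 * pi))%:E)%E.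
  apply: (@le_trans _ _ (((M * lorentz tau) `^ r')%:E * \int[leb]_y (lorentz y)%:E)%E); last first.
    by rewrite EFinM; apply: lee_wpmul2l; rewrite ?lee_fin ?powR_ge0// lorentz_integral.
  rewrite -(@ge0_integral_mulc _ _ _ leb setT measurableT _ (@lorentz R))//; last 2 first.
  - exact: powR_ge0.
  - by move=> y _; rewrite ltW// lorentz_gt0.
  apply: le_ge0_integral => y _; rewrite lee_fin; first by rewrite mulr_ge0 ?wt_ge0 ?powR_ge0.
  have Y0 : 0 < (1 + y ^+ 2) ^+ m by rewrite exprn_gt0// onesqr_gt0.
  have ML : 0 <= M * lorentz tau by rewrite mulr_ge0// ltW// lorentz_gt0.
  apply: (@le_trans _ _ (wt a y * ((M * lorentz tau) `^ r' * ((1 + y ^+ 2) ^+ m)^-1))).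
    rewrite ler_wpM2l ?wt_ge0//.
    apply: (@le_trans _ _ ((M * lorentz tau * ((1 + y ^+ 2) ^+ m)^-1) `^ r')).
      apply: ge0_ler_powR; rewrite ?nnegrE ?(ltW r'0)//; first by rewrite mulr_ge0// invr_ge0 ltW.
      by apply: le_trans (FM y tau) _; rewrite mulrAC.
    rewrite powRM ?invr_ge0 ?(ltW Y0)// ler_wpM2l ?powR_ge0//.
    rewrite -[leRHS]powRr1 ?invr_ge0 ?(ltW Y0)//; apply: ger_powR => //.
    rewrite invr_gt0 Y0/= invf_le1// exprn_ege1// lerDl sqr_ge0//.
  rewrite mulrCA ler_wpM2l ?powR_ge0//; exact: weight_le_lorentz.
have i0 tau : (0 <= \int[leb]_y (wt a y * A y tau `^ r')%:E)%E.
  by apply: integral_ge0 => y _; rewrite lee_fin mulr_ge0 ?wt_ge0 ?powR_ge0.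
pose N tau := Rintegral leb setT (fun y => wt a y * A y tau `^ r').
have NE tau : (\int[leb]_y (wt a y * A y tau `^ r')%:E)%E = (N tau)%:E.
  by rewrite /N /Rintegral fineK// ge0_fin_numE//; apply: le_lt_trans (NEle tau) _; exact: ltry.
have N0 tau : 0 <= N tau by rewrite -lee_fin -NE.
have mN : measurable_fun setT N.
  apply: (@meas_Rintegral _ _ R (fun tau y : R => wt a y * A y tau `^ r')).
  by mea.
clearbody N.
pose n tau := N tau `^ r'^-1.
have mn : measurable_fun setT n by rewrite /n; mea.
have n0 tau : 0 <= n tau by exact: powR_ge0.
pose B0 := M * (2 * pi) `^ r'^-1.
have B00 : 0 <= B0 by rewrite mulr_ge0 ?powR_ge0.
have nB tau : n tau <= B0 * lorentz tau.
  have ML : 0 <= M * lorentz tau by rewrite mulr_ge0// ltW// lorentz_gt0.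
  have -> : B0 * lorentz tau = ((M * lorentz tau) `^ r' * (2 * pi)) `^ r'^-1.
    by rewrite powRM ?powR_ge0 ?mulr_ge0 ?(ltW Pi0)// -powRrM divff ?gt_eqF// powRr1// /B0 mulrAC.
  apply: ge0_ler_powR; rewrite ?nnegrE ?invr_ge0 ?(ltW r'0)//.
    by rewrite mulr_ge0 ?powR_ge0 ?mulr_ge0 ?(ltW Pi0).
  by rewrite -lee_fin -NE.
have SE0 : (\int[leb]_tau (n tau `^ q')%:E < +oo)%E.
  apply: (@le_lt_trans _ _ ((B0 `^ q')%:E * \int[leb]_tau (lorentz tau)%:E)%E).
    rewrite -(@ge0_integral_mulc _ _ _ leb setT measurableT _ (@lorentz R)) ?powR_ge0//; last first.
      by move=> y _; rewrite ltW// lorentz_gt0.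
    apply: le_ge0_integral => tau _; rewrite lee_fin ?powR_ge0//.
    have l0 := lorentz_gt0 tau.
    apply: (@le_trans _ _ ((B0 * lorentz tau) `^ q')).
      have Bl0 : 0 <= B0 * lorentz tau by apply: mulr_ge0 => //; exact: ltW.
      by apply: ge0_ler_powR; rewrite ?nnegrE ?(ltW q'0).
    rewrite powRM ?(ltW l0)// ler_wpM2l ?powR_ge0//.
    by rewrite -[leRHS]powRr1 ?(ltW l0)//; apply: ger_powR; rewrite ?l0 ?lorentz_le1.
  apply: (@le_lt_trans _ _ ((B0 `^ q')%:E * (2 * pi)%:E)%E); last by rewrite -EFinM ltry.
  by apply: lee_wpmul2l; rewrite ?lee_fin ?powR_ge0// lorentz_integral.
have [S SE] : exists S : R, (\int[leb]_tau (n tau `^ q')%:E)%E = S%:E.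
  exists (fine (\int[leb]_tau (n tau `^ q')%:E)%E); rewrite fineK// ge0_fin_numE//.
  by apply: integral_ge0 => tau _; rewrite lee_fin powR_ge0.
have S0 : 0 <= S.
  by rewrite -lee_fin -SE; apply: integral_ge0 => tau _; rewrite lee_fin powR_ge0.
exists S => //; split.
  rewrite /MixNorm -SE; congr (poweR _ _); apply: eq_integral => t _.
  rewrite /LrNorm integral_pos (_ : (\int[leb]_x _)%E = (N t)%:E); first by rewrite !poweR_EFin.
  rewrite -NE; apply: eq_integral => y _; congr EFin; rewrite /A /wt.
  have [y0|y0] := leP y 0; first by rewrite ip0// !mul0r.
  by rewrite ip1// !mul1r mulrC.
apply: le_perturbed_powR => // eta eta0.
(* Chosen so that the perturbation adds at most [eta] inside the time integral: lorentz^(q') <=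
   lorentz, and lorentz has integral at most 2 pi. *)
pose de := (eta / (2 * pi)) `^ q'^-1.
have et0 : 0 < eta / (2 * pi) by rewrite divr_gt0// mulr_gt0.
have de0 : 0 < de by rewrite powR_gt0.
have deE : de `^ q' * (2 * pi) = eta.
  by rewrite /de -powRrM mulVf ?gt_eqF// powRr1 ?(ltW et0)// divfK// gt_eqF// mulr_gt0.
clearbody de.
pose nd tau := n tau + de * lorentz tau.
have mnd : measurable_fun setT nd by rewrite /nd; mea.
have nd0 tau : 0 < nd tau.
  by rewrite ltr_wpDl// mulr_gt0 ?lorentz_gt0.
have nd0' tau : 0 <= nd tau by exact: ltW.
have ndl tau : nd tau <= (B0 + de) * lorentz tau by rewrite /nd mulrDl lerD.
have ndB tau : nd tau <= B0 + de.
  by apply: le_trans (ndl tau) _; rewrite ler_piMr ?lorentz_le1// addr_ge0// ltW.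
have ndW : (\int[leb]_tau (nd tau)%:E <= ((B0 + de) * (2 * pi))%:E)%E.
  apply: (@le_trans _ _ ((B0 + de)%:E * \int[leb]_tau (lorentz tau)%:E)%E); last first.
    by rewrite EFinM; apply: lee_wpmul2l; rewrite ?lee_fin ?lorentz_integral// addr_ge0// ltW.
  rewrite -(@ge0_integral_mulc _ _ _ leb setT measurableT _ (@lorentz R))//; last 2 first.
  - by rewrite addr_ge0// ltW.
  - by move=> y _; rewrite ltW// lorentz_gt0.
  by apply: le_ge0_integral => tau _; rewrite lee_fin.
have ndF tau : (\int[leb]_y (wt a y * A y tau `^ r')%:E <= (nd tau `^ r')%:E)%E.
  rewrite NE lee_fin.
  have <- : n tau `^ r' = N tau by rewrite /n -powRrM mulVf ?gt_eqF// powRr1.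
  apply: ge0_ler_powR; rewrite ?nnegrE ?(ltW r'0)//.
  by rewrite /nd lerDl mulr_ge0 ?(ltW de0)// ltW// lorentz_gt0.
have ndS : (\int[leb]_tau (nd tau `^ q')%:E <= (2 `^ q' * (S + eta))%:E)%E.
  have ml : measurable_fun setT (fun tau => de `^ q' * lorentz tau) by mea.
  have mnq : measurable_fun setT (fun tau => n tau `^ q') by mea.
  have l0 tau := ltW (@lorentz_gt0 R tau).
  apply: (@le_trans _ _ ((2 `^ q')%:E * \int[leb]_tau (n tau `^ q' + de `^ q' * lorentz tau)%:E)%E).
    rewrite -(@ge0_integral_mulc _ _ _ leb setT measurableT _ (fun tau => n tau `^ q' + de `^ q' * lorentz tau)) ?powR_ge0//; last 2 first.
    - by move=> tau _; rewrite addr_ge0 ?mulr_ge0 ?powR_ge0.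
    - exact: meas_add.
    apply: le_ge0_integral => tau _; rewrite lee_fin ?powR_ge0//.
    apply: le_trans (powR_add_le (n0 tau) _ (ltW q'0)) _; first by rewrite mulr_ge0 ?(ltW de0).
    rewrite ler_wpM2l ?powR_ge0// lerD2l powRM ?(ltW de0)// ler_wpM2l ?powR_ge0//.
    by rewrite -[leRHS]powRr1//; apply: ger_powR; rewrite ?lorentz_gt0 ?lorentz_le1.
  rewrite ge0_integral_add//; last 2 first.
  - by move=> tau _; exact: powR_ge0.
  - by move=> tau _; rewrite mulr_ge0 ?powR_ge0.
  rewrite EFinM SE; apply: lee_wpmul2l; first by rewrite lee_fin powR_ge0.
  rewrite EFinD leeD2l// -deE.
  rewrite (@ge0_integral_mulc _ _ _ leb setT measurableT _ (@lorentz R)) ?powR_ge0//.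
  by rewrite EFinM; apply: lee_wpmul2l; rewrite ?lee_fin ?powR_ge0// lorentz_integral.
have Bd0 : 0 <= B0 + de by rewrite addr_ge0// ltW.
pose V t := Rintegral leb setT (fun tau => `|t - tau| `^ (- lam) * nd tau).
have rk0 t : (0 <= \int[leb]_tau (`|t - tau| `^ (- lam) * nd tau)%:E)%E.
  by apply: integral_ge0 => tau _; rewrite lee_fin mulr_ge0 ?powR_ge0.
have VE t : (\int[leb]_tau (`|t - tau| `^ (- lam) * nd tau)%:E)%E = (V t)%:E.
  rewrite /V /Rintegral fineK// ge0_fin_numE//.
  by apply: le_lt_trans (bnd _ mnd nd0' _ _ Bd0 ndB ndW t) _; exact: ltry.
have mV : measurable_fun setT V.
  by apply: (@meas_Rintegral _ _ R (fun t tau : R => `|t - tau| `^ (- lam) * nd tau)); mea.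
have V0 t : 0 <= V t by rewrite -lee_fin -VE.
clearbody V.
have T0 : 0 < 2 `^ q' * (S + eta) by rewrite mulr_gt0 ?powR_gt0// ltr_wpDl.
have := hC2 nd _ _ _ mnd nd0' ndB ndW T0 ndS.
under eq_integral do rewrite VE poweR_EFin.
move=> hV.
apply: (@le_trans _ _ ((C1 `^ (q / r))%:E * \int[leb]_t (V t `^ q)%:E)%E).
  rewrite -(@ge0_integral_mulc _ _ _ leb setT measurableT _ (fun t => V t `^ q)) ?powR_ge0//; last 2 first.
  - by move=> t _; exact: powR_ge0.
  - by mea.
  apply: le_ge0_integral => t _; first exact: poweR_ge0.
  have h := hC1 F M m nd mu_ mv am FM mnd nd0 ndF t (V t) _.
  rewrite VE in h; have {}h := h (lexx _).
  have j0 : (0 <= \int[leb]_(x in `]0%R, +oo[) (cabs (Duhamel a F x t) `^ r * x `^ a)%:E)%E.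
    by apply: integral_ge0 => x _; rewrite lee_fin mulr_ge0 ?powR_ge0.
  rewrite /LrNorm -poweRrM.
  have qr0 : 0 <= r^-1 * q by rewrite mulr_ge0 ?invr_ge0 ?(ltW r0) ?(ltW q0).
  apply: le_trans (lee_poweR qr0 j0 h) _.
  rewrite poweR_EFin lee_fin powRM ?powR_ge0 ?(ltW C10)// -powRrM.
  by rewrite mulrA divff ?gt_eqF// mul1r (mulrC r^-1).
apply: le_trans (lee_wpmul2l _ hV) _; first by rewrite lee_fin powR_ge0.
rewrite -EFinM lee_fin powRM ?powR_ge0 ?addr_ge0 ?(ltW eta0)//.
by rewrite /K !mulrA.
Qed.

End mixed_norm.

Theorem theoremT (R : realType) (a q r : R) :
  0 <= a -> admissible a q r ->
  exists C : R, 0 < C /\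
    forall F : R -> R -> R[i], Splus F ->
      (MixNorm a q r (Duhamel a F)
        <= C%:E * MixNorm a (conj_exp q) (conj_exp r) F)%E.
Proof.
move=> a0 adm; have [C C0 hC] := mixed_norm_duhamel a0 adm.
have [lam0 lam1 lamq] := admissible_exponents a0 adm.
have q0 : 0 < q by rewrite -(pmulr_rgt0 _ lam0) lamq.
exists (C `^ q^-1); split; first by rewrite powR_gt0.
move=> F /hC[S S0 [-> h]]; rewrite /MixNorm.
have J0 : (0 <= \int[@lebesgue_measure R]_t poweR (LrNorm a r (fun x => Duhamel a F x t)) q)%E.
  by apply: integral_ge0 => t _; exact: poweR_ge0.
have iq0 : 0 <= q^-1 by rewrite invr_ge0 ltW.
apply: le_trans (lee_poweR iq0 J0 h) _.
rewrite !poweR_EFin -EFinM lee_fin powRM ?powR_ge0 ?(ltW C0)// -powRrM.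
by have -> : (conj_exp q)^-1 = (q - 1) / q by rewrite /conj_exp invfM invrK mulrC.
Qed.
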